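(* Let $T>0$, let $g:[0,T]\to\mathbb{R}$ be continuous and let $(W_t)$ be a standard Brownian motion. Let $(\mu_n)$ be a sequence of Schwartz distributions on $\mathbb{R}$ with compact supports contained in $[g(T),+\infty)$ such that, for $0\le t<T$, $U(g(t),t;\mu_n)\to 1$ as $n\to\infty$ and, for some constant $c$, $|U(w,t;\mu_n)|\le c$ for all $n$, all $0\le t<T$ and all $w\le g(t)$. Let $\sigma=\sup\{t\in(0,T]: W_t\ge g(t)\}$. Then, for $0<t\le T$, $$P(\sigma\le t)=N\left(\frac{g(t)}{\sqrt t}\right)-\lim_{n\to\infty}\int N_2\left(\frac{g(t)}{\sqrt t},-\frac{v}{\sqrt T};-\sqrt{\frac tT}\right)d\mu_n(v).$$ Furthermore, if $g$ is $C^1$ on an open subset $I$ of $[0,T]$ and the sequence $U(g(t),t;\mu_n')$ is uniformly bounded and converges to a continuous function of $t$ as $t\in I$ and $n\to\infty$, then, for $t\in I$, $$\frac{d}{dt}P(\sigma\le t)=\frac{1}{2\sqrt t}\,N'\left(\frac{g(t)}{\sqrt t}\right)\lim_{n\to\infty}U(g(t),t;\mu_n').$$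
   Context: $N(x)=(2\pi)^{-1/2}\int_{-\infty}^x e^{-s^2/2}\,ds$ is the standard normal distribution function and $N'$ its derivative. $N_2(x,y;\rho)=\int_{-\infty}^x\int_{-\infty}^y\frac{1}{2\pi\sqrt{1-\rho^2}}\exp\left(-\frac{u^2+v^2-2\rho uv}{2(1-\rho^2)}\right)du\,dv$ denotes the cumulative bivariate normal probability distribution function. $(W_t)$ starts at $W_0=0$. For a compactly supported Schwartz distribution $\mu$ on $\mathbb{R}$, $\int\phi(v)\,d\mu(v)$ denotes the pairing of $\mu$ with a function $\phi$, and $\mu'$ is the distributional derivative of $\mu$. For $u\in\mathbb{R}$, $U(u,t;\mu)=\int N\left(\frac{u-v}{\sqrt{T-t}}\right)d\mu(v)$ if $0\le t<T$, and $U(u,t;\mu)=0$ otherwise. The supremum of the empty set, in the definition of $\sigma$, is taken to be $0$.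
   Formalization: The formula for P(σ≤t) is stated for 0<t<T; at t=T, where N_2 has correlation −1 and an undefined density (and P(σ≤T)=1), P(σ<T)=N(g(T)/√T) is stated instead. The derivative formula takes I open in ℝ, which excludes t=0 and t=T. *)

(* Defs.v *)
From HB Require Import structures.
From mathcomp Require Import all_boot all_order all_algebra.
From mathcomp Require Import all_classical all_reals all_analysis.

Set Implicit Arguments.
Unset Strict Implicit.
Unset Printing Implicit Defensive.

Import Order.TTheory GRing.Theory Num.Theory.
Import numFieldNormedType.Exports.

Local Open Scope classical_set_scope.
Local Open Scope ring_scope.

Section normal_distribution_functions.
Context {R : realType}.
Implicit Types x y rho : R.

Definition normal_cdf x : R :=
  (Num.sqrt (2 * pi))^-1 *
  \int[lebesgue_measure]_(s in `]-oo, x]) expR (- s ^+ 2 / 2).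

Definition bivariate_normal_pdf rho (u v : R) : R :=
  (2 * pi * Num.sqrt (1 - rho ^+ 2))^-1 *
  expR (- ((u ^+ 2 + v ^+ 2 - 2 * rho * u * v) / (2 * (1 - rho ^+ 2)))).

(* Meaningful for -1 < rho < 1 only: the density degenerates at rho = -1, 1. *)
Definition bivariate_normal_cdf x y rho : R :=
  \int[lebesgue_measure]_(v in `]-oo, x])
    (\int[lebesgue_measure]_(u in `]-oo, y]) bivariate_normal_pdf rho u v).

End normal_distribution_functions.

Section distributions.
Context {R : realType}.
Implicit Types (phi psi chi : R -> R) (mu : (R -> R) -> R).

Definition smooth phi := forall (k : nat) (x : R), derivable (derive1n k phi) x 1.

Definition fun_support phi : set R := closure [set x | phi x != 0].

Definition test_function phi := smooth phi /\ compact (fun_support phi).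

(* A distribution is represented by a functional on all of R -> R, of which
   only the restriction to the test functions is constrained and ever used.
   Continuity on the space of test functions is expressed, as usual, by an
   estimate of finite order on each compact set. *)
Definition is_distribution mu :=
  (forall (a : R) phi psi, test_function phi -> test_function psi ->
     mu (fun x => a * phi x + psi x) = a * mu phi + mu psi) /\
  (forall K : set R, compact K -> exists (C : R) (m : nat),
     forall phi, test_function phi -> fun_support phi `<=` K ->
       `|mu phi| <= C * \sum_(k < m.+1) sup [set `|(derive1n k phi) x| | x in K]).

Definition vanishes_on mu (O : set R) :=
  forall phi, test_function phi -> fun_support phi `<=` O -> mu phi = 0.

Definition distribution_support mu : set R :=
  ~` \bigcup_(O in [set O | open O /\ vanishes_on mu O]) O.

Definition distribution_derive mu : (R -> R) -> R :=
  fun phi => - mu (derive1 phi).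

Definition is_cutoff mu chi :=
  test_function chi /\
  forall x, distribution_support mu x -> \forall y \near x, chi y = 1.

(* Extends a compactly supported distribution to all smooth functions.  The
   value does not depend on which cutoff function xget selects. *)
Definition pairing mu phi : R :=
  mu (fun x => xget (fun _ => 0) (is_cutoff mu) x * phi x).

Definition U (T : R) mu (u t : R) : R :=
  if 0 <= t < T
  then pairing mu (fun v => normal_cdf ((u - v) / Num.sqrt (T - t)))
  else 0.

End distributions.

Section brownian_motion.
Context {R : realType} {d : measure_display} {Omega : measurableType d}.
Variable P : probability Omega R.

Definition mutually_independent (n : nat) (X : 'I_n -> Omega -> R) :=
  forall A : 'I_n -> set R, (forall i, measurable (A i)) ->
    P (\bigcap_(i in [set: 'I_n]) (X i @^-1` A i)) =
    (\prod_(i < n) fine (P (X i @^-1` A i)))%:E.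

(* The variance of an increment being t - s, the second parameter (standard
   deviation) of normal_prob is Num.sqrt (t - s).  Only the variables W t with
   0 <= t are constrained. *)
Definition standard_brownian_motion (W : R -> {RV P >-> R}) :=
  [/\ forall w, W 0 w = 0,
      forall w, {within `[0, +oo[, continuous (fun t => W t w)},
      forall (n : nat) (s : nat -> R), 0 <= s 0%N ->
        (forall i, (i < n)%N -> s i <= s i.+1) ->
        mutually_independent (fun (i : 'I_n) w => W (s i.+1) w - W (s i) w) &
      forall s t, 0 <= s < t -> forall A : set R, measurable A ->
        P [set w | A (W t w - W s w)] = normal_prob 0 (Num.sqrt (t - s)) A].

(* The convention sup set0 = 0 is the one of the library. *)
Definition last_passage (W : R -> {RV P >-> R}) (g : R -> R) (T : R)
    (w : Omega) : R :=
  sup [set t | 0 < t <= T /\ g t <= W t w].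

End brownian_motion.

(* Main.v *)
Require Import Defs.
From HB Require Import structures.
From mathcomp Require Import all_boot all_order all_algebra.
From mathcomp Require Import all_classical all_reals all_analysis.
From mathcomp Require Import measurable_realfun.
From mathcomp Require Import ring lra.

(** Write u_n(w, t) for U T (mu n) w t. As a function of w and t, each kernel
    N((w - v) / sqrt (T - t)) solves the backward heat equation, hence so does
    u_n, and u_n(W_t, t) is a martingale before the time T. In the form used
    here (tame_below), the integral of u_n(W_r, r) over an event that is known
    at an earlier time is the pairing of mu_n with the function that maps v to
    the probability that the event occurs and W_T >= v; this does not depend
    on r.

    Fix t < T and stop this martingale, on the event W_t < g(t), when the path
    reaches the boundary g after t. There u_n is uniformly bounded and tends to
    1. If the path ends below g(T) without reaching the boundary, then
    u_n(W_r, r) tends to 0 as r tends to T, because mu_n lives on [g(T), +oo[.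
    Optional stopping and dominated convergence, first in r and then in n, give
    (potential_integral_cvg) that the integral of u_n(W_t, t) over the event
    W_t < g(t) tends to
       P(W_t < g(t)) - P(W_s < g(s) for all s in [t, T]).
    Up to a null event the last probability is that of sigma <= t, and the
    integral on the left is the pairing of mu_n with N_2, as W_t is normal
    (bivariate_normal_heat).

    For the derivative, write p(w, t) for the normal density of variance t. By
    the first part P(sigma <= t) is the limit of the integrals E_n(t) of
    p(w, t) (1 - u_n(w, t)) over w <= g(t). As p and u_n solve a forward and a
    backward heat equation, the time derivative of the integrand is the
    derivative in w of a flux, so that with all functions taken at (g(t), t)
       E_n' = g' p (1 - u_n) + (p_w (1 - u_n) + p (u_n)_w) / 2.
    Moreover (u_n)_w = U(w, t; mu_n'). When n tends to infinity the factors
    1 - u_n vanish, boundedly, and only p (u_n)_w / 2 survives. The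
    convergence of E_n' being merely bounded, the limit is taken in the
    integrated identity and then differentiated (is_derive_bounded_limit).

    Distributions enter through the functionals called tame, that is, linear
    on smooth functions with an estimate of finite order near the support.
    This suffices to differentiate potentials under the functional
    (tame_is_derive) and to exchange it with integrals (tame_integral). *)

Set Implicit Arguments.
Unset Strict Implicit.
Unset Printing Implicit Defensive.

Import Order.TTheory GRing.Theory Num.Theory.
Import numFieldNormedType.Exports.

Local Open Scope classical_set_scope.
Local Open Scope ring_scope.

(** * Calculus of smooth functions *)

Section smooth_calculus.
Context {R : realType}.
Implicit Types (f g df dg : R -> R) (x : R) (k : nat).

Lemma derive1_eq f df : (forall x, is_derive x 1 f (df x)) -> (derive1 f) = df.
Proof. by move=> h; apply/funext => x; rewrite derive1E derive_val. Qed.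

Lemma is_derive1 f x : derivable f x 1 -> is_derive x 1 f ((derive1 f) x).
Proof. by move=> h; apply: DeriveDef => //; rewrite derive1E. Qed.

Lemma is_derive_continuous f (x df : R) : is_derive x 1 f df -> {for x, continuous f}.
Proof. by case=> h _; apply: differentiable_continuous; apply/derivable1_diffP. Qed.

(** Differentiates f once and recurses on the derivative, so that induction on
    k goes through sums, products and inverses; derive1n peels the derivatives
    off from the other end. *)
Fixpoint times_derivable k f :=
  if k is k'.+1 then (forall x, derivable f x 1) /\ times_derivable k' (derive1 f)
  else True.

Lemma times_derivableS k f : times_derivable k.+1 f -> times_derivable k f.
Proof. by elim: k f => [//|k IH] f [df] /IH. Qed.

Lemma smoothP f : smooth f <-> forall k, times_derivable k f.
Proof.
split=> [sf k|df k].
  elim: k f sf => [//|k IH] f sf; split; first exact: (sf 0%N).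
  by apply: IH => j x; rewrite -derive1Sn.
elim: k f df => [|k IH] f df x; first by have [] := df 1%N.
by rewrite derive1Sn; apply: IH => j; have [] := df j.+1.
Qed.

Lemma smooth_derivable f x : smooth f -> derivable f x 1.
Proof. by move=> /(_ 0%N). Qed.

Lemma smooth_is_derive f x : smooth f -> is_derive x 1 f ((derive1 f) x).
Proof. by move=> sf; apply: is_derive1; exact: smooth_derivable. Qed.

Lemma smooth_derive1 f : smooth f -> smooth (derive1 f).
Proof. by move=> sf k x; rewrite -derive1Sn. Qed.

Lemma smooth_derive1n k f : smooth f -> smooth (derive1n k f).
Proof. by elim: k => [//|k IH] sf; rewrite derive1nS; apply/smooth_derive1/IH. Qed.

(** Smoothness is proved through explicit families: a sequence in which each
    function differentiates to the next consists of the iterated derivatives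
    of its first term. *)
Lemma smooth_of_family (F : nat -> R -> R) :
  (forall j x, is_derive x 1 (F j) (F j.+1 x)) ->
  smooth (F 0%N) /\ forall k, derive1n k (F 0%N) = F k.
Proof.
move=> h.
have h2 k : derive1n k (F 0%N) = F k.
  by elim: k => [//|k IH]; rewrite derive1nS IH; exact: derive1_eq.
by split => // k x; rewrite h2; case: (h k x).
Qed.

Local Opaque smooth derive1.

Lemma times_derivable_step k f df :
  (forall x, is_derive x 1 f (df x)) -> times_derivable k df ->
  times_derivable k.+1 f.
Proof. by move=> h tdf /=; rewrite (derive1_eq h); split. Qed.

Lemma times_derivable_is k f x : times_derivable k.+1 f ->
  is_derive x 1 f ((derive1 f) x).
Proof. by move=> [h _]; apply: is_derive1. Qed.

Lemma times_derivable_cst k (a : R) : times_derivable k (fun=> a).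
Proof.
elim: k a => [//|k IH] a.
by apply: (@times_derivable_step _ _ (fun=> 0)) => // x; exact: is_derive_cst.
Qed.

Lemma times_derivableD k f g : times_derivable k f -> times_derivable k g ->
  times_derivable k (fun x => f x + g x).
Proof.
elim: k f g => [//|k IH] f g tf tg.
apply: (@times_derivable_step _ _ (fun x => (derive1 f) x + (derive1 g) x)).
  by move=> x; have := times_derivable_is x tf; have := times_derivable_is x tg;
    move=> *; exact: is_deriveD.
by apply: IH; [case: tf|case: tg].
Qed.

(** The product rule for pointwise products of real functions, with the value
    of the derivative written in the ring operations rather than as a scaling. *)
Lemma is_deriveM' f g x (df dg : R) : is_derive x 1 f df -> is_derive x 1 g dg ->
  is_derive x 1 (fun x => f x * g x) (df * g x + f x * dg).
Proof.
by move=> hf hg; apply: (is_derive_eq (is_deriveM hf hg));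
  rewrite /GRing.scale/=; ring.
Qed.

Lemma times_derivableM k f g : times_derivable k f -> times_derivable k g ->
  times_derivable k (fun x => f x * g x).
Proof.
elim: k f g => [//|k IH] f g tf tg.
apply: (@times_derivable_step _ _ (fun x => (derive1 f) x * g x + f x * (derive1 g) x)).
  by move=> x; have := times_derivable_is x tf; have := times_derivable_is x tg;
    move=> *; exact: is_deriveM'.
apply: times_derivableD; apply: IH; rewrite ?(times_derivableS) //.
- by case: tf.
- by apply/times_derivableS.
- by apply/times_derivableS.
- by case: tg.
Qed.

(** By induction on k: the derivative - f' / f^2 is a product of functions
    that are differentiable k times. *)
Lemma times_derivableV k f : (forall x, f x != 0) -> times_derivable k f ->
  times_derivable k (fun x => (f x)^-1).
Proof.
move=> f0; elim: k => [//|k IH] tf.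
apply: (@times_derivable_step _ _ (fun x => (-1) * ((f x)^-1 * ((f x)^-1 * (derive1 f) x)))).
  move=> x; have df := times_derivable_is x tf.
  apply: (is_derive_eq (is_deriveV (f0 x) df)).
  by rewrite /GRing.scale/= expr2 invfM; ring.
apply: times_derivableM; first exact: times_derivable_cst.
have := IH (times_derivableS tf) => tV.
by do 2 apply: times_derivableM => //; case: tf.
Qed.

Lemma is_derive_affine f (a b x df : R) : is_derive (a * x + b) 1 f df ->
  is_derive x 1 (fun x => f (a * x + b)) (a * df).
Proof.
move=> h; have hl : is_derive x 1 (fun x : R => a * x + b) a.
  have := is_deriveD (is_deriveM' (is_derive_cst a x 1) (is_derive_id x 1)) (is_derive_cst b x 1).
  by move=> h'; apply: (is_derive_eq h'); rewrite /=; ring.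
by have := @is_derive1_comp _ f (fun x => a * x + b) x _ _ h hl; rewrite mulrC.
Qed.

Lemma times_derivable_affine k f (a b : R) : times_derivable k f ->
  times_derivable k (fun x => f (a * x + b)).
Proof.
elim: k f => [//|k IH] f tf.
apply: (@times_derivable_step _ _ (fun x => a * (derive1 f) (a * x + b))).
  by move=> x; apply: is_derive_affine; exact: times_derivable_is tf.
by apply: times_derivableM; [exact: times_derivable_cst|apply: IH; case: tf].
Qed.

Lemma smooth_cst (a : R) : smooth (fun=> a).
Proof. by apply/smoothP => k; exact: times_derivable_cst. Qed.

Lemma smoothD f g : smooth f -> smooth g -> smooth (fun x => f x + g x).
Proof. by move=> /smoothP sf /smoothP sg; apply/smoothP => k; exact: times_derivableD. Qed.

Lemma smoothM f g : smooth f -> smooth g -> smooth (fun x => f x * g x).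
Proof. by move=> /smoothP sf /smoothP sg; apply/smoothP => k; exact: times_derivableM. Qed.

Lemma smoothZ (a : R) f : smooth f -> smooth (fun x => a * f x).
Proof. by move=> sf; exact: (@smoothM (fun=> a) f (@smooth_cst a) sf). Qed.

Lemma smoothB f g : smooth f -> smooth g -> smooth (fun x => f x - g x).
Proof.
move=> sf sg; have -> : (fun x => f x - g x) = (fun x => f x + (-1) * g x).
  by apply/funext => x; rewrite mulN1r.
exact: (@smoothD f (fun x => (-1) * g x) sf (@smoothZ (-1) g sg)).
Qed.

Lemma smoothV f : (forall x, f x != 0) -> smooth f -> smooth (fun x => (f x)^-1).
Proof. by move=> f0 /smoothP sf; apply/smoothP => k; exact: times_derivableV. Qed.

Lemma smooth_affine f (a b : R) : smooth f -> smooth (fun x => f (a * x + b)).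
Proof. by move=> /smoothP sf; apply/smoothP => k; exact: times_derivable_affine. Qed.

Lemma derive1nZD k (a : R) f g : smooth f -> smooth g ->
  derive1n k (fun x => a * f x + g x) =
  fun x => a * derive1n k f x + derive1n k g x.
Proof.
elim: k f g => [//|k IH] f g sf sg.
rewrite !derive1Sn.
have -> : derive1 (fun x => a * f x + g x) = (fun x => a * (derive1 f) x + (derive1 g) x).
  apply: derive1_eq => x.
  have := is_deriveD (is_deriveM' (is_derive_cst a x 1) (smooth_is_derive x sf))
                     (smooth_is_derive x sg).
  by move=> h'; apply: (is_derive_eq h'); rewrite /=; ring.
by rewrite (IH _ _ (smooth_derive1 sf) (smooth_derive1 sg)).
Qed.

Lemma smooth_continuous f : smooth f -> continuous f.
Proof.
by move=> sf x; exact: (is_derive_continuous (smooth_is_derive x sf)).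
Qed.

End smooth_calculus.

Section quadratic_remainder.
Context {R : realType}.
Implicit Types (f : R -> R).

(** A quadratic bound on the remainder identifies a derivative. This is the
    criterion that passes through functionals and integrals, which are
    controlled by estimates only. *)
Lemma is_derive_quad f (x d C e : R) : 0 < e ->
  (forall h, `|h| < e -> `|f (x + h) - f x - h * d| <= C * h ^+ 2) ->
  is_derive x 1 f d.
Proof.
move=> e0 H.
have lim : h^-1 *: (f (h *: (1 : R) + x) - f x) @[h --> 0^'] --> d.
  have C0 : 0 <= C.
    have := H (e / 2); rewrite gtr0_norm ?divr_gt0//.
    have e2 : e / 2 < e by lra.
    move=> /(_ e2) h1; have := le_trans (normr_ge0 _) h1.
    by rewrite pmulr_lge0// exprn_gt0 // divr_gt0.
  apply/cvgrPdist_le => /= r r0.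
  near=> h.
  have h0 : h != 0 by near: h; exact: nbhs_dnbhs_neq.
  have hs : `|h| < Num.min e (r / (C + 1)).
    near: h; apply: dnbhs0_lt; rewrite lt_min e0 divr_gt0//.
    by rewrite ltr_wpDl.
  move: hs; rewrite lt_min => /andP[he hr].
  have := H h he.
  rewrite /GRing.scale/= mulr1 (addrC h x) => H1.
  have -> : d - h^-1 * (f (x + h) - f x) = - (h^-1 * (f (x + h) - f x - h * d)).
    by field.
  rewrite normrN normrM normfV.
  have nh : 0 < `|h| by rewrite normr_gt0.
  rewrite mulrC ler_pdivrMr//.
  apply: (le_trans H1).
  rewrite -real_normK ?num_real// expr2 mulrA ler_wpM2r//.
  move: hr; rewrite ltr_pdivlMr ?ltr_wpDl// mulrDr mulr1 mulrC => hr.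
  by have := normr_ge0 h; lra.
apply: DeriveDef; first by apply/cvg_ex; exists d.
by apply/cvg_lim.
Unshelve. all: by end_near. Qed.

Lemma expR_ge_pow (n : nat) (y : R) : 0 <= y -> y ^+ n <= n`!%:R * expR y.
Proof.
case: n => [|n] y0.
  by rewrite expr0 fact0 mul1r -[leLHS]expR0 ler_expR.
have := expR_ge1Dxn n y0 => h.
rewrite mulrC -ler_pdivrMr ?ltr0n ?fact_gt0//.
by apply: le_trans h; rewrite lerDr.
Qed.

Lemma poly_le_exp (p : {poly R}) : exists2 C, 0 <= C &
  forall y, `|p.[y]| <= C * expR `|y|.
Proof.
exists (\sum_(i < size p) `|p`_i| * i`!%:R).
  by apply: sumr_ge0 => i _; rewrite mulr_ge0.
move=> y; rewrite horner_coef mulr_suml; apply: (le_trans (ler_norm_sum _ _ _)).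
apply: ler_sum => i _; rewrite normrM -mulrA ler_wpM2l// normrX.
exact: expR_ge_pow.
Qed.

End quadratic_remainder.

(** * Cutoff functions *)

Section bump.
Context {R : realType}.

(** The factor p.[x^-1] makes the family closed under differentiation, whence
    the smoothness of its member p = 1. *)
Definition expinv (p : {poly R}) (x : R) : R :=
  if 0 < x then p.[x^-1] * expR (- x^-1) else 0.

(** Gives the derivative 0 at the origin, through a quadratic remainder: the
    exponential beats the polynomial p * 'X^2. *)
Lemma expinv_le_sqr p : exists2 C, 0 <= C & forall x, `|expinv p x| <= C * x ^+ 2.
Proof.
have [C C0 HC] := poly_le_exp (p * 'X^2); exists C => // x.
rewrite /expinv; case: ifPn => x0; last by rewrite normr0 mulr_ge0// sqr_ge0.
have := HC x^-1; rewrite hornerM hornerXn normrM normrX.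
have vx0 : 0 < x^-1 by rewrite invr_gt0.
rewrite (gtr0_norm vx0) exprVn => h.
rewrite normrM [`|expR _|]ger0_norm ?expR_ge0// expRN.
rewrite ler_pdivrMr ?expR_gt0// mulrAC.
by rewrite -ler_pdivrMr ?exprn_gt0.
Qed.

Lemma is_derive_expinv (p : {poly R}) (x : R) :
  is_derive x 1 (expinv p) (expinv ('X^2 * (p - p^`())) x).
Proof.
have [x0|x0|->] := ltgtP x 0.
- rewrite [X in is_derive _ _ _ X]/expinv ltNge (ltW x0)/=.
  apply: (@near_eq_is_derive _ _ _ (fun=> 0)).
  near=> y; rewrite /expinv ifF//; apply/negbTE; rewrite -leNgt.
  by apply: ltW; near: y; exact: lt_nbhsl.
- rewrite [X in is_derive _ _ _ X]/expinv x0.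
  apply: (@near_eq_is_derive R R R (fun y : R => p.[y^-1] * expR (- y^-1))).
    near=> y; rewrite /expinv ifT//.
    by near: y; exact: lt_nbhsr.
  have xn0 : x != 0 by rewrite gt_eqF.
  have dV : is_derive x 1 (fun y : R => y^-1) (- x ^- 2).
    by apply: (is_derive_eq (@is_deriveV _ id x 1 1 xn0 _)); rewrite /GRing.scale/= mulr1.
  have dp := @is_derive1_comp _ (horner p) (fun y : R => y^-1) x _ _ (is_derive_poly p x^-1) dV.
  have dN : is_derive x 1 (fun y : R => - y^-1) (- - x ^- 2) by exact: is_deriveN.
  have de := @is_derive1_comp _ expR (fun y : R => - y^-1) x _ _ (is_derive_expR _) dN.
  apply: (is_derive_eq (is_deriveM' dp de)); rewrite /=.
  by rewrite !hornerE /= !exprVn; ring.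
- rewrite [X in is_derive _ _ _ X]/expinv ltxx.
  have [C C0 HC] := expinv_le_sqr p.
  apply: (@is_derive_quad _ _ _ _ C 1) => // h _.
  rewrite add0r mulr0 subr0 (_ : expinv p 0 = 0) ?subr0; last by rewrite /expinv ltxx.
  exact: HC.
Unshelve. all: by end_near. Qed.

Lemma smooth_expinv : smooth (expinv 1).
Proof.
pose F := fix F (n : nat) : {poly R} := if n is m.+1 then 'X^2 * (F m - (F m)^`()) else 1.
by have [] := @smooth_of_family _ (fun n => expinv (F n)) (fun j x => is_derive_expinv (F j) x).
Qed.

Lemma expinv1_ge0 x : 0 <= expinv 1 x.
Proof. by rewrite /expinv; case: ifP => // _; rewrite hornerE mul1r expR_ge0. Qed.

Lemma expinv1_gt0 x : 0 < x -> 0 < expinv 1 x.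
Proof. by move=> x0; rewrite /expinv x0 hornerE mul1r expR_gt0. Qed.

Lemma expinv1_le0 x : x <= 0 -> expinv 1 x = 0.
Proof. by move=> x0; rewrite /expinv ltNge x0. Qed.

Lemma smooth_step (p q : R) : p < q -> exists s : R -> R, [/\ smooth s,
  forall x, x <= p -> s x = 0 & forall x, q <= x -> s x = 1].
Proof.
move=> pq.
have sE (a b : R) := @smooth_affine R (expinv 1) a b smooth_expinv.
pose u (x : R) := expinv 1 (1 * x + (- p)).
pose v (x : R) := expinv 1 ((-1) * x + q).
have uv0 x : u x + v x != 0.
  rewrite gt_eqF//; have [xp|px] := leP x p.
    by rewrite ltr_wpDl ?expinv1_ge0// expinv1_gt0//; lra.
  by rewrite ltr_pwDl ?expinv1_ge0// expinv1_gt0//; lra.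
(* u vanishes to the left of p, v to the right of q, never both *)
exists (fun x => u x * (u x + v x)^-1); split.
- apply: (@smoothM _ u _); first exact: sE.
  by apply: (@smoothV _ (fun x => u x + v x) uv0); exact: (@smoothD _ u v (sE _ _) (sE _ _)).
- by move=> x xp; rewrite /u expinv1_le0 ?mul0r//; lra.
- move=> x xq; have v0 : v x = 0 by rewrite /v expinv1_le0//; lra.
  by have := uv0 x; rewrite v0 addr0 => u0; rewrite mulfV.
Qed.

Lemma closure_support_le (f : R -> R) (c : R) (hf : forall x, c < x -> f x = 0) x :
  fun_support f x -> x <= c.
Proof.
move=> sx; have : closure [set x | x <= c] x.
  apply: closure_subset sx => y /= fy0; rewrite leNgt; apply/negP => /hf h.
  by rewrite h eqxx in fy0.
by rewrite -(closure_id [set x | x <= c]).1//; exact: closed_le.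
Qed.

Lemma closure_support_ge (f : R -> R) (c : R) (hf : forall x, x < c -> f x = 0) x :
  fun_support f x -> c <= x.
Proof.
move=> sx; have : closure [set x | x >= c] x.
  apply: closure_subset sx => y /= fy0; rewrite leNgt; apply/negP => /hf h.
  by rewrite h eqxx in fy0.
by rewrite -(closure_id [set x | x >= c]).1//; exact: closed_ge.
Qed.

Lemma test_function_itv (f : R -> R) (a b : R) : smooth f ->
  (forall x, x < a -> f x = 0) -> (forall x, b < x -> f x = 0) ->
  test_function f /\ fun_support f `<=` `[a, b].
Proof.
move=> sf fa fb.
have sub : fun_support f `<=` `[a, b].
  move=> x sx /=; rewrite in_itv/=; apply/andP; split.
    exact: (closure_support_ge fa sx).
  exact: (closure_support_le fb sx).
split=> //; split => //.
by apply: (subclosed_compact _ (@segment_compact _ a b)) => //; exact: closed_closure.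
Qed.

Lemma exists_cutoff (a b e : R) : 0 < e -> exists chi : R -> R,
  [/\ test_function chi, fun_support chi `<=` `[a - e, b + e] &
     forall x, a <= x <= b -> \forall y \near x, chi y = 1].
Proof.
move=> e0.
have h1 : a - e < a - e / 2 by lra.
have h2 : b + e / 2 < b + e by lra.
have [s [ss s0 s1]] := smooth_step h1.
have [t [st t0 t1]] := smooth_step h2.
pose chi x := s x * (1 - t x).
have schi : smooth chi.
  exact: (@smoothM _ s _ ss (@smoothB _ (fun=> 1) t (@smooth_cst _ 1) st)).
have [tf sub] : test_function chi /\ fun_support chi `<=` `[a - e, b + e].
  apply: test_function_itv => [|x xa|x xb]; first exact: schi.
    by rewrite /chi s0 ?mul0r// ltW.
  by rewrite /chi t1 ?subrr ?mulr0// ltW.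
exists chi; split => // x /andP[ax xb].
near=> y; rewrite /chi s1; last first.
  by apply: ltW; near: y; apply: lt_nbhsr; lra.
rewrite t0 ?subr0 ?mulr1//.
by apply: ltW; near: y; apply: lt_nbhsl; lra.
Unshelve. all: by end_near. Qed.

End bump.

(** * Compactly supported distributions *)

Section test_functions.
Context {R : realType}.
Implicit Types (f g phi psi chi theta : R -> R) (x y : R).

Lemma compact_le_norm (K : set R) : compact K ->
  exists2 M, 0 < M & forall x, K x -> `|x| <= M.
Proof.
move=> /compact_bounded[N [Nr H]]; exists (`|N| + 1); first by rewrite ltr_wpDl.
by move=> x Kx; apply: (H (`|N| + 1)) => //; have := ler_norm N; lra.
Qed.

Lemma fun_supportN f x : ~ fun_support f x -> \forall y \near x, f y = 0.
Proof.
rewrite /fun_support => /existsNP[B /not_implyP[nB hB]].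
apply: filterS nB => y By; apply/eqP/negPn/negP => fy0.
by apply: hB; exists y.
Qed.

Lemma fun_support0 f x : ~ fun_support f x -> f x = 0.
Proof. by move=> /fun_supportN; exact: nbhs_singleton. Qed.

Lemma near_ball (P : R -> Prop) x : (\forall y \near x, P y) ->
  exists2 e, 0 < e & forall y, `|y - x| < e -> P y.
Proof.
move=> /nbhs_ballP[e /= e0 H]; exists e => // y ye; apply: H.
by rewrite /ball/= distrC.
Qed.

Lemma fun_support_mull chi f : fun_support (fun x => chi x * f x) `<=` fun_support chi.
Proof.
by apply: closure_subset => y /=; apply: contra_neq => ->; rewrite mul0r.
Qed.

Lemma test_functionMl chi f : test_function chi -> smooth f ->
  test_function (fun x => chi x * f x).
Proof.
move=> [sc cc] sf; split; first exact: (@smoothM _ chi f sc sf).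
apply: (subclosed_compact _ cc); first exact: closed_closure.
exact: fun_support_mull.
Qed.

Lemma test_functionMr chi f : smooth chi -> test_function f ->
  test_function (fun x => chi x * f x).
Proof.
move=> sc tf; have -> : (fun x => chi x * f x) = (fun x => f x * chi x).
  by apply/funext => x; rewrite mulrC.
exact: test_functionMl.
Qed.

Lemma near_cst_derive1 f (c : R) x : (\forall y \near x, f y = c) -> derive1 f x = 0.
Proof.
move=> h; rewrite derive1E (@near_eq_derive _ _ _ f (fun=> c)) ?derive_cst//.
Qed.

Lemma fun_support_derive1 f : fun_support (derive1 f) `<=` fun_support f.
Proof.
move=> x sx; apply: contrapT => nx.
have [e e0 H] := near_ball (fun_supportN nx).
have /sx[y [/= dy0 yx]] : nbhs x [set y | `|y - x| < e].
  by apply/nbhs_ballP; exists e => //= z; rewrite /ball/= distrC.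
move: dy0; rewrite (@near_cst_derive1 _ 0) ?eqxx//.
apply/nbhs_ballP; exists (e - `|y - x|); first by rewrite /= subr_gt0.
move=> z; rewrite /ball/= => zy; apply: H.
have -> : z - x = (y - x) - (y - z) by ring.
by apply: (le_lt_trans (ler_normB _ _)); lra.
Qed.

Lemma test_function_derive1 f : test_function f -> test_function (derive1 f).
Proof.
move=> [sf cf]; split; first exact: (smooth_derive1 sf).
apply: (subclosed_compact _ cf); first exact: closed_closure.
exact: fun_support_derive1.
Qed.

Lemma test_function_bounded f : test_function f ->
  exists2 C, 0 <= C & forall x, `|f x| <= C.
Proof.
move=> [sf cf]; have [M M0 HM] := compact_le_norm cf.
have cnt : {within `[-M, M], continuous (fun x => `|f x|)}.
  apply: continuous_subspaceT => x.
  by apply: continuous_comp; [exact: (smooth_continuous sf)|exact: norm_continuous].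
have MM : - M <= M by lra.
have [c _ Hc] := EVT_max MM cnt.
exists `|f c| => // x; have [sx|/fun_support0->] := pselect (fun_support f x); last by rewrite normr0.
by apply: Hc; rewrite in_itv/= -ler_norml HM.
Qed.

Lemma test_functionZD (a : R) phi psi : test_function phi -> test_function psi ->
  test_function (fun x => a * phi x + psi x).
Proof.
move=> [s1 c1] [s2 c2].
have s : smooth (fun x => a * phi x + psi x).
  exact: (@smoothD _ (fun x => a * phi x) psi (@smoothZ _ a phi s1) s2).
split => //.
apply: (@subclosed_compact _ _ (fun_support phi `|` fun_support psi)).
- exact: closed_closure.
- exact: compactU.
- rewrite /fun_support -closureU; apply: closure_subset => y /=.
  have [->|?] := eqVneq (phi y) 0; last by left.
  have [->|?] := eqVneq (psi y) 0; last by right.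
  by rewrite mulr0 addr0 eqxx.
Qed.

End test_functions.

Section localization.
Context {R : realType}.
Implicit Types (phi psi chi theta : R -> R) (x y : R).
Variable mu : (R -> R) -> R.
Hypothesis mu_lin : forall (a : R) phi psi, test_function phi -> test_function psi ->
     mu (fun x => a * phi x + psi x) = a * mu phi + mu psi.

Lemma test_function0 : test_function (fun _ : R => 0 : R).
Proof.
have [|||//] := @test_function_itv R (fun=> 0) 0 0 => //; exact: smooth_cst.
Qed.

Lemma distribution0 : mu (fun=> 0) = 0.
Proof.
have := mu_lin 1 test_function0 test_function0.
rewrite (_ : (fun x : R => 1 * 0 + 0) = (fun=> 0)); last first.
  by apply/funext => x; rewrite mulr0 addr0.
lra.
Qed.

Lemma distributionD phi psi : test_function phi -> test_function psi ->
  mu (fun x => phi x + psi x) = mu phi + mu psi.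
Proof.
move=> tp ts; have := mu_lin 1 tp ts; rewrite mul1r => <-; congr mu.
by apply/funext => x; rewrite mul1r.
Qed.

(** Near a point of the support phi vanishes itself; near any other point
    theta * phi is supported in an open set where mu vanishes. *)
Lemma vanishes_locally phi : test_function phi ->
  (forall x, distribution_support mu x -> \forall y \near x, phi y = 0) ->
  forall x, exists2 e, 0 < e & forall theta, smooth theta ->
    (forall y, theta y != 0 -> `|y - x| < e) -> mu (fun y => theta y * phi y) = 0.
Proof.
move=> tp h x.
have [sx|nsx] := pselect (distribution_support mu x).
  have [e e0 H] := near_ball (h x sx); exists e => // theta st ht.
  rewrite -distribution0; congr mu; apply/funext => y.
  have [->|/ht/H->] := eqVneq (theta y) 0; rewrite ?mul0r ?mulr0//.
move: nsx; rewrite /distribution_support /setC/= => /contrapT.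
move=> [V /= [oV vV] Vx].
have [e e0 H] := near_ball (open_nbhs_nbhs (conj oV Vx)).
exists (e / 2); first by rewrite divr_gt0.
move=> theta st ht; apply: vV; first exact: test_functionMr.
move=> y /(@fun_support_mull _ theta phi) sy; apply: H.
have h1 : y <= x + e / 2.
  apply: (@closure_support_le _ theta _ _ y sy) => z zx; apply/eqP/negPn/negP => /ht.
  by rewrite ltr_distl; lra.
have h2 : x - e / 2 <= y.
  apply: (@closure_support_ge _ theta _ _ y sy) => z zx; apply/eqP/negPn/negP => /ht.
  by rewrite ltr_distl; lra.
by rewrite ltr_distl; lra.
Qed.

(** The local statement is made global by a supremum argument on the line, in
    place of a partition of unity. Let s be the supremum of the points x up to
    M + 1 such that mu kills theta * phi for every theta that vanishes to the
    right of x. A smooth step near s splits any theta into one part of that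
    kind and one that is localized near s, so s can be passed, unless it is
    the end M + 1, beyond the support of phi. *)
Lemma vanishes_off_support phi : test_function phi ->
  (forall x, distribution_support mu x -> \forall y \near x, phi y = 0) -> mu phi = 0.
Proof.
move=> tp h; have loc := vanishes_locally tp h.
have [sp cp] := tp.
have [M M0 HM] := compact_le_norm cp.
have phi0 y : M < `|y| -> phi y = 0.
  by move=> My; apply: fun_support0 => /HM; lra.
pose S := [set x | x <= M + 1 /\ forall theta, smooth theta ->
   (forall y, x < y -> theta y = 0) -> mu (fun y => theta y * phi y) = 0].
have Sm : S (- M - 1).
  split; first by lra.
  move=> theta st ht; rewrite -distribution0; congr mu; apply/funext => y.
  have [/ht->|yx] := ltP (- M - 1) y; first by rewrite mul0r.
  rewrite phi0 ?mulr0// ler0_norm; lra.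
have hS : has_sup S by split; [exists (- M - 1)|exists (M + 1) => x []].
pose s := sup S.
have sM : s <= M + 1 by apply: ge_sup; [exists (- M - 1)|move=> x []].
have [e e0 He] := loc s.
have e2 : 0 < e / 2 by rewrite divr_gt0.
have [x1 [x1M Hx1] sx1] := sup_adherent e2 hS.
have x1s : x1 <= s by apply: sup_upper_bound => //; split.
have [t [st t0 t1]] := smooth_step sx1.
pose x2 := Num.min (s + e / 2) (M + 1).
have Sx2 : S x2.
  split; first by rewrite /x2 ge_min lexx orbT.
  move=> theta sth hth.
  have s1 : smooth (fun y => theta y * (1 - t y)).
    exact: (@smoothM _ theta _ sth (@smoothB _ (fun=> 1) t (@smooth_cst _ 1) st)).
  have s2 : smooth (fun y => theta y * t y).
    exact: (@smoothM _ theta _ sth st).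
  have -> : (fun y => theta y * phi y) =
    (fun y => (theta y * (1 - t y)) * phi y + (theta y * t y) * phi y).
    by apply/funext => y; ring.
  rewrite (distributionD (test_functionMr s1 tp) (test_functionMr s2 tp)).
  rewrite (Hx1 _ s1) ?add0r; last by move=> y xy; rewrite t1 ?subrr ?mulr0// ltW.
  apply: (He _ s2) => y; rewrite mulf_eq0 negb_or => /andP[thy ty].
  have y1 : y <= x2 by rewrite leNgt; apply/negP => /hth /eqP; rewrite (negbTE thy).
  have y2 : s - e / 2 < y by rewrite ltNge; apply/negP => /t0 /eqP; rewrite (negbTE ty).
  move: y1; rewrite /x2 le_min => /andP[y1 _].
  by rewrite ltr_distl; lra.
have x2s : x2 <= s by apply: sup_upper_bound.
have x2E : x2 = M + 1.
  move: x2s; rewrite /x2 ge_min => /orP[|h2]; first by lra.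
  apply/eqP; rewrite eq_le ge_min lexx orbT/= le_min lexx andbT; lra.
have [_ Hx2] := Sx2.
have MM : M + 1 / 2 < M + 1 by lra.
have [r [sr r0 r1]] := smooth_step MM.
rewrite -(Hx2 (fun y => 1 - r y)); last 2 first.
- exact: (@smoothB _ (fun=> 1) r (@smooth_cst _ 1) sr).
- by move=> y; rewrite x2E => /ltW/r1->; rewrite subrr.
congr mu; apply/funext => y.
have [yM|My] := leP y (M + 1 / 2); first by rewrite r0// subr0 mul1r.
by rewrite phi0 ?mulr0// gtr0_norm; lra.
Qed.

(** Two cutoffs differ by a test function that vanishes near the support. *)
Lemma pairing_cutoff chi phi : is_cutoff mu chi -> smooth phi ->
  pairing mu phi = mu (fun x => chi x * phi x).
Proof.
move=> cchi sp; rewrite /pairing.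
have := @xgetPex _ (fun _ : R => 0 : R) (is_cutoff mu) (ex_intro _ chi cchi).
set chi0 := xget _ _; move=> [tchi0 hchi0]; have [tchi hchi] := cchi.
have [s0 _] := tchi0; have [s1 _] := tchi.
pose psi x := (-1) * chi x + chi0 x.
have tpsi : test_function psi by exact: test_functionZD.
have -> : (fun x => chi0 x * phi x) = (fun x => chi x * phi x + psi x * phi x).
  by apply/funext => x; rewrite /psi; ring.
rewrite (distributionD (test_functionMl tchi sp) (test_functionMl tpsi sp)).
rewrite (vanishes_off_support (test_functionMl tpsi sp)) ?addr0//.
move=> x sx; have := hchi x sx; have := hchi0 x sx; apply: filterS2 => y h1 h2.
by rewrite /psi h1 h2; ring.
Qed.

Lemma pairingZD chi (a : R) phi psi : is_cutoff mu chi -> smooth phi -> smooth psi ->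
  pairing mu (fun x => a * phi x + psi x) = a * pairing mu phi + pairing mu psi.
Proof.
move=> cchi sp ss.
have spp : smooth (fun x => a * phi x + psi x).
  exact: (@smoothD _ (fun x => a * phi x) psi (@smoothZ _ a phi sp) ss).
rewrite (pairing_cutoff cchi spp) (pairing_cutoff cchi sp) (pairing_cutoff cchi ss).
have [tchi _] := cchi.
rewrite -(mu_lin a (test_functionMl tchi sp) (test_functionMl tchi ss)).
by congr mu; apply/funext => x; ring.
Qed.

End localization.

Section pairing_estimate.
Context {R : realType}.
Implicit Types (phi psi chi theta : R -> R) (x y : R).

(** Leibniz' rule, with a constant depending on chi and k only. *)
Lemma derive1nM_bound chi k : test_function chi -> exists2 C, 0 <= C &
  forall (S : set R) phi B, smooth phi ->
    (forall j x, (j <= k)%N -> S x -> `|derive1n j phi x| <= B) ->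
    forall x, S x -> `|derive1n k (fun y => chi y * phi y) x| <= C * B.
Proof.
elim: k chi => [|k IH] chi tc.
  have [C C0 HC] := test_function_bounded tc; exists C => // S phi B sp h x Sx.
  by rewrite derive1n0 normrM ler_pM// (h 0%N).
have [C1 C10 H1] := IH _ (test_function_derive1 tc).
have [C2 C20 H2] := IH _ tc.
exists (C1 + C2); first exact: addr_ge0.
move=> S phi B sp h x Sx.
have [sc _] := tc.
rewrite derive1Sn.
have -> : derive1 (fun y => chi y * phi y) =
  (fun y => 1 * (derive1 chi y * phi y) + chi y * derive1 phi y).
  apply: derive1_eq => y; rewrite mul1r.
  exact: (is_deriveM' (smooth_is_derive y sc) (smooth_is_derive y sp)).
have s1 := @smoothM _ (derive1 chi) phi (smooth_derive1 sc) sp.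
have s2 := @smoothM _ chi (derive1 phi) sc (smooth_derive1 sp).
rewrite (derive1nZD k 1 s1 s2) mul1r mulrDl.
apply: (le_trans (ler_normD _ _)); apply: lerD.
  by apply: (H1 S _ _ sp) => // j z jk; apply: h; exact: leqW.
apply: (H2 S _ _ (smooth_derive1 sp)) => // j z jk Sz.
by rewrite -derive1Sn; apply: h.
Qed.

Variable mu : (R -> R) -> R.
Hypothesis hmu : is_distribution mu.
Hypothesis mu_compact : compact (distribution_support mu).

Lemma exists_is_cutoff (a e : R) : 0 < e -> distribution_support mu `<=` `[a, +oo[ ->
  exists b chi, [/\ a <= b, is_cutoff mu chi & fun_support chi `<=` `[a - e, b + e]].
Proof.
move=> e0 sa; have [M M0 HM] := compact_le_norm mu_compact.
have [chi [tc sc hc]] := exists_cutoff a (Num.max a M) e0.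
(* M bounds the support in absolute value, which gives the right end *)
exists (Num.max a M), chi; split=> //; first by rewrite le_max lexx.
split => // x sx; apply: hc.
have := sa _ sx; rewrite /= in_itv/= andbT => ->/=.
by rewrite le_max (le_trans (ler_norm x) (HM _ sx)) orbT.
Qed.

Lemma exists_is_cutoffT : exists chi, is_cutoff mu chi.
Proof.
have [M M0 HM] := compact_le_norm mu_compact.
have [|b [chi [_ ? _]]] := @exists_is_cutoff (- M) 1 ltr01; last by exists chi.
move=> x sx; rewrite /= in_itv/= andbT.
by have := HM _ sx; rewrite ler_norml => /andP[].
Qed.

(** The finite order of mu on a compact neighbourhood of its support, carried
    to all smooth functions by a cutoff that vanishes to the left of a - e. *)
Lemma pairing_estimate (a e : R) : 0 < e -> distribution_support mu `<=` `[a, +oo[ ->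
  exists (C : R) (m : nat), 0 <= C /\ forall phi B, smooth phi ->
    (forall k x, (k <= m)%N -> a - e <= x -> `|derive1n k phi x| <= B) ->
    `|pairing mu phi| <= C * B.
Proof.
move=> e0 sa; have [b [chi [ab cchi schi]]] := exists_is_cutoff e0 sa.
have [tchi _] := cchi.
pose K := [set` `[a - e, b + e]].
have [mlin /(_ K (@segment_compact _ _ _))[C [m HC]]] := hmu.
have /choice[c hc] : forall k, exists C, 0 <= C /\
  forall (S : set R) phi B, smooth phi ->
    (forall j x, (j <= k)%N -> S x -> `|derive1n j phi x| <= B) ->
    forall x, S x -> `|derive1n k (fun y => chi y * phi y) x| <= C * B.
  by move=> k; have [C0 ? ?] := @derive1nM_bound chi k tchi; exists C0.
exists (`|C| * \sum_(k < m.+1) c k), m; split.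
  by rewrite mulr_ge0// sumr_ge0// => i _; case: (hc i).
move=> phi B sp h.
rewrite (pairing_cutoff mlin cchi sp).
have tcp := test_functionMl tchi sp.
have sK : fun_support (fun x => chi x * phi x) `<=` K.
  by move=> x /(@fun_support_mull _ chi phi); exact: schi.
apply: (le_trans (HC _ tcp sK)).
have Ka : K a by rewrite /K/= in_itv/=; apply/andP; split; lra.
have bnd (k : nat) : (k <= m)%N -> forall x, K x ->
    `|derive1n k (fun y => chi y * phi y) x| <= c k * B.
  move=> km; apply: (hc k).2 => // j x jk; rewrite /K/= in_itv/= => /andP[ax _].
  by apply: h => //; exact: leq_trans km.
have B0 : 0 <= B.
  by apply: le_trans (h 0%N a _ _); rewrite // ?normr_ge0//; lra.
have sup0 (k : nat) : (k <= m)%N ->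
    0 <= sup [set `|derive1n k (fun y => chi y * phi y) x| | x in K] <= c k * B.
  move=> km; apply/andP; split.
    apply: le_trans (normr_ge0 (derive1n k (fun y => chi y * phi y) a)) _.
    apply: ub_le_sup; last by exists a.
    by exists (c k * B) => _ [x Kx <-]; exact: bnd.
  apply: ge_sup; first by exists `|derive1n k (fun y => chi y * phi y) a|, a.
  by move=> _ [x Kx <-]; exact: bnd.
rewrite -mulrA; apply: (@le_trans _ _ (`|C| * (\sum_(k < m.+1)
   sup [set `|derive1n k (fun y => chi y * phi y) x| | x in K]))).
  apply: ler_wpM2r; last exact: ler_norm.
  by apply: sumr_ge0 => i _; have /andP[] := sup0 i (ltn_ord i).
rewrite ler_wpM2l// mulr_suml; apply: ler_sum => i _.
by have /andP[] := sup0 i (ltn_ord i).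
Qed.

Lemma distribution_derive_linear (a : R) phi psi : test_function phi -> test_function psi ->
  distribution_derive mu (fun x => a * phi x + psi x) =
  a * distribution_derive mu phi + distribution_derive mu psi.
Proof.
move=> tp ts; rewrite /distribution_derive.
have := hmu.1 a _ _ (test_function_derive1 tp) (test_function_derive1 ts).
have [sp _] := tp; have [ss _] := ts.
have := derive1nZD 1 a sp ss; rewrite !derive1n1 => -> ->; ring.
Qed.

Lemma distribution_support_derive :
  distribution_support (distribution_derive mu) `<=` distribution_support mu.
Proof.
apply: subsetC => x [V /= [oV vV] Vx]; exists V => //=; split => // phi tp sV.
rewrite /distribution_derive vV ?oppr0//; first exact: test_function_derive1.
by move=> y /fun_support_derive1; exact: sV.
Qed.

(** A cutoff for mu is one for its derivative too. Of the two terms of (chi *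
    phi)', the one with chi' vanishes near the support of mu. *)
Lemma pairing_distribution_derive phi : smooth phi ->
  pairing (distribution_derive mu) phi = - pairing mu (derive1 phi).
Proof.
move=> sp; have [chi cchi] := exists_is_cutoffT.
have [tchi hchi] := cchi; have [schi _] := tchi.
have cchi' : is_cutoff (distribution_derive mu) chi.
  by split => // x /distribution_support_derive; exact: hchi.
rewrite (pairing_cutoff distribution_derive_linear cchi' sp).
rewrite (pairing_cutoff hmu.1 cchi (smooth_derive1 sp)).
rewrite /distribution_derive; congr (- _).
have -> : derive1 (fun y => chi y * phi y) =
  (fun y => derive1 chi y * phi y + chi y * derive1 phi y).
  apply: derive1_eq => y.
  exact: (is_deriveM' (smooth_is_derive y schi) (smooth_is_derive y sp)).
rewrite (distributionD hmu.1 (test_functionMl (test_function_derive1 tchi) sp)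
   (test_functionMl tchi (smooth_derive1 sp))).
rewrite (vanishes_off_support hmu.1 (test_functionMl (test_function_derive1 tchi) sp)) ?add0r//.
move=> x /hchi /near_ball[e e0 H].
apply/nbhs_ballP; exists e => // y; rewrite /ball/= => xy.
rewrite (@near_cst_derive1 _ _ 1) ?mul0r//.
apply/nbhs_ballP; exists (e - `|x - y|); first by rewrite /= subr_gt0.
move=> z; rewrite /ball/= => zy; apply: H.
have -> : z - x = - (x - y) - (y - z) by ring.
by apply: (le_lt_trans (ler_normB _ _)); rewrite normrN; lra.
Qed.

End pairing_estimate.

(** * Derivatives of the normal distribution function *)

Section gaussian.
Context {R : realType}.
Implicit Types (x y : R) (j k : nat).
Local Notation leb := (@lebesgue_measure R).

Definition gauss_pdf x : R := (Num.sqrt (2 * pi))^-1 * expR (- x ^+ 2 / 2).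

Lemma gauss_pdfE : gauss_pdf = normal_pdf 0 1.
Proof.
apply/funext => x; rewrite normal_pdfE ?oner_eq0// /gauss_pdf /normal_peak /normal_fun.
by rewrite expr1n mul1r subr0 mulr2n [in 2 * _]mulr_natl mulr2n.
Qed.

Lemma gauss_pdf_ge0 x : 0 <= gauss_pdf x.
Proof. by rewrite gauss_pdfE normal_pdf_ge0. Qed.

Lemma continuous_gauss_pdf : continuous gauss_pdf.
Proof. by rewrite gauss_pdfE; apply: continuous_normal_pdf; rewrite oner_eq0. Qed.

Lemma integrable_gauss_pdf (A : set R) : measurable A ->
  leb.-integrable A (EFin \o gauss_pdf).
Proof.
move=> mA; rewrite gauss_pdfE.
by move: (@integrable_normal_pdf R 0 1); apply: integrableS.
Qed.

Lemma sqrt2pi_gt0 : 0 < Num.sqrt (2 * pi : R).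
Proof. by rewrite sqrtr_gt0 mulr_gt0// pi_gt0. Qed.

Lemma normal_cdf_Rintegral x : normal_cdf x = \int[leb]_(s in `]-oo, x]) gauss_pdf s.
Proof.
rewrite /normal_cdf -RintegralZl//.
have := @integrable_gauss_pdf `]-oo, x] (measurable_itv _).
have -> : EFin \o (fun s : R => expR (- s ^+ 2 / 2)) =
   (fun s => (Num.sqrt (2 * pi))%:E * (EFin \o gauss_pdf) s)%E.
  by apply/funext => s /=; rewrite -EFinM /gauss_pdf mulVKf// gt_eqF// sqrt2pi_gt0.
by move=> h; apply: integrableZl => //.
Qed.

Lemma normal_cdfE x : (normal_cdf x)%:E = normal_prob 0 1 `]-oo, x].
Proof.
rewrite normal_cdf_Rintegral /normal_prob /Rintegral -gauss_pdfE fineK//.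
by apply: integrable_fin_num => //; exact: integrable_gauss_pdf.
Qed.

Lemma normal_cdf_ge0 x : 0 <= normal_cdf x.
Proof. by rewrite -lee_fin normal_cdfE. Qed.

Lemma normal_cdf_le1 x : normal_cdf x <= 1.
Proof. by rewrite -lee_fin normal_cdfE probability_le1. Qed.

(** Exponential tilting: for s <= x one has expR (- s^2/2) <= expR (x + 1/2) *
    expR (- (s+1)^2/2). *)
Lemma normal_cdf_le_exp x : normal_cdf x <= expR (x + 1 / 2).
Proof.
rewrite -lee_fin normal_cdfE.
have mI : measurable [set` `]-oo, x]] by exact: measurable_itv.
apply: (@le_trans _ _ (\int[leb]_(s in `]-oo, x]) ((expR (x + 1 / 2))%:E * (normal_pdf (-1) 1 s)%:E))%E).
  apply: ge0_le_integral => //.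
  - by move=> s _; rewrite lee_fin normal_pdf_ge0.
  - by apply/measurable_EFinP; apply: measurable_funTS; exact: measurable_normal_pdf.
  - apply/measurable_EFinP; apply: measurable_funTS; apply: measurable_funM => //.
    exact: measurable_normal_pdf.
  - move=> s; rewrite /= in_itv/= => sx; rewrite -EFinM lee_fin !normal_pdfE ?oner_eq0//.
    rewrite mulrCA ler_wpM2l ?normal_peak_ge0// /normal_fun -expRD ler_expR.
    by rewrite expr1n; nra.
rewrite ge0_integralZl//.
- rewrite -[leRHS]mule1 lee_wpmul2l ?lee_fin ?expR_ge0//.
  exact: (@probability_le1 _ _ _ (normal_prob (-1 : R) 1)).
- by apply/measurable_EFinP; apply: measurable_funTS; exact: measurable_normal_pdf.
- by move=> s _; rewrite lee_fin normal_pdf_ge0.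
Qed.

Lemma is_derive_normal_cdf x : is_derive x 1 normal_cdf (gauss_pdf x).
Proof.
have -> : normal_cdf = (fun y => \int[leb]_(s in [set` Interval -oo%O (BRight y)]) gauss_pdf s).
  by apply/funext => y; exact: normal_cdf_Rintegral.
have x1 : x < x + 1 by lra.
have [d1 d2] := @continuous_FTC1 R gauss_pdf -oo%O x (x + 1) x1
  (integrable_gauss_pdf (measurable_itv _)) (ltNyr x) (@continuous_gauss_pdf x).
by rewrite -d2; exact: is_derive1.
Qed.

Lemma is_derive_gauss_pdf x : is_derive x 1 gauss_pdf (- x * gauss_pdf x).
Proof.
have h1 : is_derive x 1 (fun y : R => - y ^+ 2 / 2) (- x).
  have h := is_deriveM' (is_deriveN (is_deriveX 2 (is_derive_id x 1))) (is_derive_cst (2^-1 : R) x 1).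
  by apply: (is_derive_eq h); rewrite /= /GRing.scale/= mulr1; field.
have h2 := @is_derive1_comp _ expR (fun y : R => - y ^+ 2 / 2) x _ _ (is_derive_expR _) h1.
have h3 := is_deriveM' (is_derive_cst ((Num.sqrt (2 * pi : R))^-1) x 1) h2.
by apply: (is_derive_eq h3); rewrite /gauss_pdf/=; ring.
Qed.

(** (-1)^j times the probabilists' Hermite polynomial of degree j. *)
Fixpoint hermite j : {poly R} :=
  if j is i.+1 then (hermite i)^`() - 'X * hermite i else 1.

Lemma deriv_hermite j : (hermite j.+1)^`() = - (j.+1)%:R *: hermite j.
Proof.
elim: j => [|j IH].
  by rewrite /= derivC sub0r mulr1 derivN derivX scaleN1r.
rewrite [hermite j.+2]/= derivB derivM derivX mul1r -/(hermite j.+1).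
have -> : (hermite j.+1)^`() = (- (j.+1)%:R) *: hermite j := IH.
rewrite derivZ.
have e : (hermite j)^`() = hermite j.+1 + 'X * hermite j by rewrite /= subrK.
rewrite e -!mul_polyC !polyCN -!natr1 !polyCD; ring.
Qed.

Definition gauss_derive j x : R :=
  if j is i.+1 then (hermite i).[x] * gauss_pdf x else normal_cdf x.

Lemma gauss_deriveS j x : gauss_derive j.+1 x = (hermite j).[x] * gauss_pdf x.
Proof. by []. Qed.

Lemma is_derive_gauss_derive j x : is_derive x 1 (gauss_derive j) (gauss_derive j.+1 x).
Proof.
case: j => [|j].
  apply: (is_derive_eq (is_derive_normal_cdf x)); rewrite gauss_deriveS.
  by rewrite -[hermite 0]/(1%:P) hornerC mul1r.
apply: (is_derive_eq (is_deriveM' (is_derive_poly (hermite j) x) (is_derive_gauss_pdf x))).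
rewrite gauss_deriveS -[hermite j.+1]/((hermite j)^`() - 'X * hermite j).
by rewrite hornerD hornerN hornerM hornerX; ring.
Qed.

(** The three-term recurrence of the Hermite polynomials; it is what makes the
    functions heat j solve the heat equation. *)
Lemma gauss_derive_rec j x :
  gauss_derive j.+2 x = - x * gauss_derive j.+1 x - j%:R * gauss_derive j x.
Proof.
case: j => [|j]; first by rewrite /= derivC !hornerE/=; ring.
have := deriv_hermite j => h.
have hS : hermite j.+2 = (hermite j.+1)^`() - 'X * hermite j.+1 by [].
rewrite !gauss_deriveS hS h; move: (hermite j.+1) (hermite j) => p q.
by rewrite hornerD hornerN hornerM hornerX hornerZ; ring.
Qed.

(** Half of the exponent - x^2/2 absorbs the polynomial factor. *)
Lemma gauss_derive_bound j : exists2 C, 0 <= C &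
  forall x, `|gauss_derive j.+1 x| <= C * expR (- x ^+ 2 / 4).
Proof.
have [C C0 HC] := poly_le_exp (hermite j).
exists (C * (Num.sqrt (2 * pi))^-1 * expR 1).
  by rewrite !mulr_ge0 ?expR_ge0// invr_ge0 ltW// sqrt2pi_gt0.
move=> x; rewrite /gauss_derive normrM (ger0_norm (gauss_pdf_ge0 x)) /gauss_pdf.
rewrite mulrCA.
have s0 : 0 <= (Num.sqrt (2 * pi : R))^-1 by rewrite invr_ge0 ltW// sqrt2pi_gt0.
rewrite (mulrC C) -!mulrA ler_wpM2l//.
apply: (@le_trans _ _ (C * expR `|x| * expR (- x ^+ 2 / 2))).
  by rewrite ler_wpM2r ?expR_ge0.
rewrite -!mulrA ler_wpM2l// -!expRD ler_expR -(real_normK (num_real x)).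
have := sqr_ge0 (`|x| / 2 - 1); rewrite sqrrB; lra.
Qed.

Lemma gauss_derive_bounded j : exists2 C, 0 <= C & forall x, `|gauss_derive j x| <= C.
Proof.
case: j => [|j].
  by exists 1 => // x; rewrite ger0_norm ?normal_cdf_ge0 ?normal_cdf_le1.
have [C C0 HC] := gauss_derive_bound j; exists C => // x.
apply: (le_trans (HC x)); rewrite ler_piMr// expR_le1.
by have := sqr_ge0 x; lra.
Qed.

Lemma gauss_derive_decay j k : exists2 C, 0 <= C &
  forall x, x < 0 -> `|x| ^+ k * `|gauss_derive j x| <= C.
Proof.
case: j => [|j].
  exists (k`!%:R * expR (1 / 2)); first by rewrite mulr_ge0 ?expR_ge0.
  move=> x x0; rewrite /gauss_derive (ger0_norm (normal_cdf_ge0 x)).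
  apply: (@le_trans _ _ (k`!%:R * expR `|x| * expR (x + 1 / 2))).
    by rewrite ler_pM ?exprn_ge0 ?normal_cdf_ge0 ?expR_ge_pow ?normal_cdf_le_exp ?normr_ge0.
  rewrite -mulrA ler_wpM2l// -expRD ler_expR ltr0_norm//; lra.
have [C C0 HC] := gauss_derive_bound j.
exists (C * (k`!%:R * expR 1)); first by rewrite !mulr_ge0 ?expR_ge0.
move=> x x0; apply: (@le_trans _ _ (`|x| ^+ k * (C * expR (- x ^+ 2 / 4)))).
  by rewrite ler_wpM2l ?exprn_ge0.
rewrite mulrCA ler_wpM2l//.
apply: (@le_trans _ _ (k`!%:R * expR `|x| * expR (- x ^+ 2 / 4))).
  by rewrite ler_wpM2r ?expR_ge0// expR_ge_pow.
rewrite -!mulrA ler_wpM2l// -!expRD ler_expR -(real_normK (num_real x)).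
have := sqr_ge0 (`|x| / 2 - 1); rewrite sqrrB; lra.
Qed.

End gaussian.

(** * Mean value bounds *)

Section mean_value_bounds.
Context {R : realType}.
Implicit Types (f : R -> R).

(** The increment h may have any sign, as difference quotients require. *)
Lemma mean_value f (df : R -> R) (x h : R) :
  (forall y, `|y - x| <= `|h| -> is_derive y 1 f (df y)) ->
  exists2 y, `|y - x| <= `|h| & f (x + h) - f x = h * df y.
Proof.
move=> H.
have cnt a b : (forall y, a <= y <= b -> `|y - x| <= `|h|) -> {within `[a, b], continuous f}.
  move=> ab; apply: derivable_within_continuous => y; rewrite in_itv/= => /ab yab.
  by have [] := H _ yab.
have [h0|h0] := leP 0 h.
  have h1 y : x <= y <= x + h -> `|y - x| <= `|h|.
    by move=> /andP[? ?]; rewrite (ger0_norm h0) ler_distl; apply/andP; split; lra.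
  have xh : x <= x + h by lra.
  have [y|y yx e] := @MVT_segment _ f df x (x + h) xh _ (cnt _ _ h1).
    by rewrite in_itv/= => /andP[? ?]; apply: H; apply: h1; rewrite !ltW.
  exists y; first by move: yx; rewrite in_itv/=; exact: h1.
  by rewrite e mulrC; congr (_ * _); ring.
have h1 y : x + h <= y <= x -> `|y - x| <= `|h|.
  by move=> /andP[? ?]; rewrite (ltr0_norm h0) ler_distl; apply/andP; split; lra.
have xh : x + h <= x by lra.
have [y|y yx e] := @MVT_segment _ f df (x + h) x xh _ (cnt _ _ h1).
  by rewrite in_itv/= => /andP[? ?]; apply: H; apply: h1; rewrite !ltW.
exists y; first by move: yx; rewrite in_itv/=; exact: h1.
by rewrite -opprB e; ring.
Qed.

Lemma lipschitz_bound f (df : R -> R) (x h B : R) :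
  (forall y, `|y - x| <= `|h| -> is_derive y 1 f (df y)) ->
  (forall y, `|y - x| <= `|h| -> `|df y| <= B) ->
  `|f (x + h) - f x| <= B * `|h|.
Proof.
move=> H HB; have [y yx ->] := mean_value H.
by rewrite normrM mulrC ler_wpM2r// HB.
Qed.

Lemma taylor1_bound f (f1 f2 : R -> R) (x h B : R) :
  (forall y, `|y - x| <= `|h| -> is_derive y 1 f (f1 y)) ->
  (forall y, `|y - x| <= `|h| -> is_derive y 1 f1 (f2 y)) ->
  (forall y, `|y - x| <= `|h| -> `|f2 y| <= B) ->
  `|f (x + h) - f x - h * f1 x| <= B * h ^+ 2.
Proof.
move=> H1 H2 HB; have [y yx ->] := mean_value H1.
have B0 : 0 <= B.
  by apply: (le_trans (normr_ge0 (f2 x))); apply: HB; rewrite subrr normr0.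
rewrite -mulrBr normrM -(real_normK (num_real h)) expr2 mulrCA ler_wpM2l//.
have -> : f1 y = f1 (x + (y - x)) by congr f1; ring.
apply: (le_trans (@lipschitz_bound _ f2 _ _ B _ _)).
- by move=> z zx; apply: H2; exact: le_trans yx.
- by move=> z zx; apply: HB; exact: le_trans yx.
- by rewrite ler_wpM2l.
Qed.

End mean_value_bounds.

(** * The heat kernel and its primitive *)

Section heat.
Context {R : realType}.

Lemma is_deriveX' (f : R -> R) (n : nat) (x df : R) : is_derive x 1 f df ->
  is_derive x 1 (fun y => f y ^+ n) (n%:R * f x ^+ n.-1 * df).
Proof.
move=> hf; elim: n => [|n IH].
  by rewrite !mul0r; exact: is_derive_cst.
have -> : (fun y => f y ^+ n.+1) = (fun y => f y * f y ^+ n).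
  by apply/funext => y; rewrite exprS.
apply: (is_derive_eq (is_deriveM' hf IH)).
case: n {IH} => [|n]; first by rewrite /= expr0; ring.
by rewrite /= -!natr1 exprS; ring.
Qed.

Implicit Types (x y t : R) (j k : nat).

(** The j-th space derivative of the distribution function of the centred
    normal law of variance t: heat 0 is that function and heat 1 is the heat
    kernel. *)
Definition heat j x t : R := (Num.sqrt t)^-1 ^+ j * gauss_derive j (x / Num.sqrt t).

Lemma heat0 x t : heat 0 x t = normal_cdf (x / Num.sqrt t).
Proof. by rewrite /heat expr0 mul1r. Qed.

Lemma heat1 x t : heat 1 x t = (Num.sqrt t)^-1 * gauss_pdf (x / Num.sqrt t).
Proof. by rewrite /heat expr1 gauss_deriveS -[hermite 0]/(1%:P) hornerC mul1r. Qed.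

Lemma is_derive_heat j x t : is_derive x 1 (heat j ^~ t) (heat j.+1 x t).
Proof.
have h := is_derive_gauss_derive j ((Num.sqrt t)^-1 * x + 0).
have h1 := is_deriveM' (is_derive_cst ((Num.sqrt t)^-1 ^+ j) x 1) (is_derive_affine h).
have -> : heat j ^~ t = (fun y => (Num.sqrt t)^-1 ^+ j * gauss_derive j ((Num.sqrt t)^-1 * y + 0)).
  by apply/funext => y; rewrite /heat addr0 (mulrC y).
by apply: (is_derive_eq h1); rewrite /heat/= mul0r add0r addr0 mulrA -exprSr (mulrC x).
Qed.

Lemma is_derive_heat_time j x t : 0 < t ->
  is_derive t 1 (heat j x) (2^-1 * heat j.+2 x t).
Proof.
move=> t0.
have s0 : 0 < Num.sqrt t by rewrite sqrtr_gt0.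
have sn : Num.sqrt t != 0 by rewrite gt_eqF.
pose s (r : R) := (Num.sqrt r)^-1.
have ds : is_derive t 1 s (- 2^-1 * s t ^+ 3).
  apply: (is_derive_eq (is_deriveV sn (is_derive1_sqrt t0))).
  by rewrite /s /GRing.scale/=; field.
have dx : is_derive t 1 (fun r => x * s r) (x * (- 2^-1 * s t ^+ 3)).
  by apply: (is_derive_eq (is_deriveM' (is_derive_cst x t 1) ds)); rewrite mul0r add0r.
have dN := @is_derive1_comp _ (gauss_derive j) (fun r => x * s r) t _ _
   (is_derive_gauss_derive j _) dx.
have dp : is_derive t 1 (fun r => s r ^+ j) (- 2^-1 * j%:R * s t ^+ j.+2).
  apply: (is_derive_eq (is_deriveX' j ds)).
  case: j {dN} => [|j]; first by rewrite !mul0r mulr0 mul0r.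
  by rewrite /= !exprSr; ring.
apply: (is_derive_eq (is_deriveM' dp dN)).
rewrite /heat gauss_derive_rec -/(s t) /= !exprSr; ring.
Qed.

Lemma heat_bounded j (t0 : R) : 0 < t0 -> exists2 C, 0 <= C &
  forall x t, t0 <= t -> `|heat j x t| <= C.
Proof.
move=> t00; have [C C0 HC] := @gauss_derive_bounded R j.
exists ((Num.sqrt t0)^-1 ^+ j * C); first by rewrite mulr_ge0 ?exprn_ge0 ?invr_ge0 ?sqrtr_ge0.
move=> x t tt; rewrite /heat normrM ler_pM//.
have st0 : 0 < Num.sqrt t0 by rewrite sqrtr_gt0.
have st : Num.sqrt t0 <= Num.sqrt t by rewrite ler_wsqrtr.
rewrite normrX ger0_norm ?invr_ge0 ?sqrtr_ge0// lerXn2r ?nnegrE ?invr_ge0 ?sqrtr_ge0//.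
by rewrite lef_pV2 ?posrE//; exact: lt_le_trans st.
Qed.

(** For x <= - e the quotient |x| / sqrt t is at least e / sqrt t, so the
    decay of the Gaussian beats the blow-up of the prefactor as t tends to 0. *)
Lemma heat_small j (e : R) : 0 < e -> exists2 C, 0 <= C &
  forall x t, 0 < t -> x <= - e -> `|heat j x t| <= C * Num.sqrt t.
Proof.
move=> e0; have [C C0 HC] := @gauss_derive_decay R j j.+1.
have ei0 : 0 <= e^-1 by rewrite invr_ge0 ltW.
exists (e^-1 ^+ j.+1 * C); first by rewrite mulr_ge0 ?exprn_ge0.
move=> x t t0 xe.
have st : 0 < Num.sqrt t by rewrite sqrtr_gt0.
have x0 : x / Num.sqrt t < 0 by rewrite pmulr_llt0 ?invr_gt0//; lra.
rewrite -ler_pdivrMr// /heat normrM normrX (ger0_norm (_ : 0 <= (Num.sqrt t)^-1)) ?invr_ge0 ?(ltW st)//.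
rewrite mulrC mulrA -exprS.
apply: (@le_trans _ _ ((e^-1 * `|x / Num.sqrt t|) ^+ j.+1 * `|gauss_derive j (x / Num.sqrt t)|)).
  rewrite ler_wpM2r// lerXn2r ?nnegrE ?mulr_ge0 ?invr_ge0 ?(ltW st) ?(ltW e0)//.
  rewrite normrM [X in _ * (_ * X)]gtr0_norm ?invr_gt0// mulrA ler_peMl ?invr_ge0 ?(ltW st)//.
  rewrite ler_pdivlMl// mulr1 ler0_norm; lra.
by rewrite exprMn -mulrA ler_wpM2l ?exprn_ge0 ?HC.
Qed.

Lemma heat_gauss_bound j (t0 t1 : R) : 0 < t0 -> exists2 C, 0 <= C &
  forall x t, t0 <= t <= t1 -> `|heat j.+1 x t| <= C * expR (- x ^+ 2 / (4 * t1)).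
Proof.
move=> t00; have [C C0 HC] := @gauss_derive_bound R j.
exists ((Num.sqrt t0)^-1 ^+ j.+1 * C); first by rewrite mulr_ge0 ?exprn_ge0 ?invr_ge0 ?sqrtr_ge0.
move=> x t /andP[tt tt1]; rewrite /heat normrM -mulrA ler_pM//.
  have st0 : 0 < Num.sqrt t0 by rewrite sqrtr_gt0.
  have st : Num.sqrt t0 <= Num.sqrt t by rewrite ler_wsqrtr.
  rewrite normrX ger0_norm ?invr_ge0 ?sqrtr_ge0// lerXn2r ?nnegrE ?invr_ge0 ?sqrtr_ge0//.
  by rewrite lef_pV2 ?posrE//; exact: lt_le_trans st.
apply: (le_trans (HC _)); rewrite ler_wpM2l// ler_expR.
have t0' : 0 < t by lra.
rewrite expr_div_n sqr_sqrtr ?(ltW t0')// mulNr [leRHS]mulNr lerN2.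
have -> : x ^+ 2 / t / 4 = x ^+ 2 / (4 * t) by field; lra.
by rewrite ler_wpM2l ?sqr_ge0// lef_pV2 ?posrE; lra.
Qed.

Lemma smooth_heat j t : smooth (heat j ^~ t) /\
  forall k, derive1n k (heat j ^~ t) = heat (j + k) ^~ t.
Proof.
have := @smooth_of_family R (fun k => heat (j + k) ^~ t) => /(_ _)[].
  by move=> k x; rewrite addnS; exact: is_derive_heat.
by rewrite addn0.
Qed.

Lemma smooth_reflect (f : R -> R) (c : R) : smooth f ->
  smooth (fun v => f (c - v)) /\
  forall k, derive1n k (fun v => f (c - v)) = (fun v => (-1) ^+ k * derive1n k f (c - v)).
Proof.
move=> sf.
have h := @smooth_of_family R (fun k v => (-1) ^+ k * derive1n k f ((-1) * v + c)).
have e k : (fun v => (-1) ^+ k * derive1n k f (c - v)) =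
   (fun v => (-1) ^+ k * derive1n k f ((-1) * v + c)).
  by apply/funext => v; rewrite mulN1r addrC.
have -> : (fun v => f (c - v)) = (fun v => (-1) ^+ 0 * derive1n 0 f ((-1) * v + c)).
  by apply/funext => v; rewrite expr0 mul1r mulN1r addrC.
case: h => [k v|s1 s2]; last by split => // k; rewrite s2 e.
have d := smooth_is_derive ((-1) * v + c) (@smooth_derive1n R k f sf).
have := is_deriveM' (is_derive_cst ((-1) ^+ k : R) v 1) (is_derive_affine d).
by move=> h; apply: (is_derive_eq h); rewrite derive1nS exprS /=; ring.
Qed.

End heat.

(** * Functionals that act like compactly supported distributions *)

Section tame_functionals.
Context {R : realType}.
Implicit Types (phi psi f : R -> R) (L : (R -> R) -> R) (j k : nat).

(** All that is kept of the pairing with a compactly supported distribution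
    whose support lies in [a, +oo[. The margin e lets the functional see a
    neighbourhood of the support, as a distribution of positive order does. *)
Definition tame L (a : R) :=
  (forall (c : R) phi psi, smooth phi -> smooth psi ->
     L (fun x => c * phi x + psi x) = c * L phi + L psi) /\
  (forall e, 0 < e -> exists (C : R) (m : nat), 0 <= C /\
     forall phi B, smooth phi ->
       (forall k x, (k <= m)%N -> a - e <= x -> `|derive1n k phi x| <= B) ->
       `|L phi| <= C * B).

Lemma tame_pairing (mu : (R -> R) -> R) (a : R) : is_distribution mu ->
  compact (distribution_support mu) -> distribution_support mu `<=` `[a, +oo[ ->
  tame (pairing mu) a.
Proof.
move=> hmu hc ha; split; last by move=> e e0; exact: pairing_estimate.
move=> c phi psi sp ss; have [chi cchi] := exists_is_cutoffT hc.
exact: (pairingZD hmu.1 c cchi sp ss).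
Qed.

Variables (L : (R -> R) -> R) (a : R).
Hypothesis Lt : tame L a.

Lemma tameB phi psi : smooth phi -> smooth psi ->
  L (fun x => phi x - psi x) = L phi - L psi.
Proof.
move=> sp ss; have := Lt.1 (-1) _ _ ss sp.
by rewrite mulN1r addrC => <-; congr L; apply/funext => x; ring.
Qed.

Lemma tameZ (c : R) phi : smooth phi -> L (fun x => c * phi x) = c * L phi.
Proof.
move=> sp; have h0 : L (fun=> 0) = 0.
  have := tameB (@smooth_cst _ 0) (@smooth_cst _ 0).
  rewrite [RHS]subrr => h; rewrite -[RHS]h; congr L; apply/funext => x.
  by rewrite subrr.
have := Lt.1 c _ _ sp (@smooth_cst _ 0); rewrite h0 addr0 => <-.
by congr L; apply/funext => x; rewrite addr0.
Qed.

Lemma tame_estimate : exists (C : R) (m : nat), 0 <= C /\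
  forall phi (B : nat -> R), smooth phi ->
    (forall k x, `|derive1n k phi x| <= B k) -> `|L phi| <= C * \sum_(k < m.+1) B k.
Proof.
have [C [m [C0 H]]] := Lt.2 1 ltr01; exists C, m; split => // phi B sp h.
apply: H => // k x km _; apply: (le_trans (h k x)).
have B0 i : 0 <= B i by exact: le_trans (normr_ge0 _) (h i 0).
have km' : (k < m.+1)%N by [].
by rewrite (bigD1 (Ordinal km'))//= lerDl sumr_ge0.
Qed.

Lemma derive1nB k phi psi : smooth phi -> smooth psi ->
  derive1n k (fun x => phi x - psi x) = fun x => derive1n k phi x - derive1n k psi x.
Proof.
move=> sp ss; have := derive1nZD k (-1) ss sp.
have -> : (fun x => -1 * psi x + phi x) = (fun x => phi x - psi x).
  by apply/funext => x; ring.
by move=> ->; apply/funext => x; ring.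
Qed.

Lemma derive1nZ k (c : R) phi : smooth phi ->
  derive1n k (fun x => c * phi x) = fun x => c * derive1n k phi x.
Proof.
move=> sp; elim: k => [//|k IH]; rewrite derive1nS IH; apply: derive1_eq => x.
have := is_deriveM' (is_derive_cst c x 1) (smooth_is_derive x (@smooth_derive1n R k phi sp)).
by move=> h; apply: (is_derive_eq h); rewrite derive1nS /=; ring.
Qed.

(** Quadratic remainders, uniform in each order of differentiation, pass
    through the estimate of L. *)
Lemma tame_is_derive (F : R -> R -> R) (G : R -> R) (x e : R) (M : nat -> R) : 0 < e ->
  (forall h, `|h| < e -> smooth (F (x + h))) -> smooth G ->
  (forall k h v, `|h| < e ->
     `|derive1n k (F (x + h)) v - derive1n k (F x) v - h * derive1n k G v| <= M k * h ^+ 2) ->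
  is_derive x 1 (fun y => L (F y)) (L G).
Proof.
move=> e0 sF sG H; have [C [m [C0 est]]] := tame_estimate.
apply: (@is_derive_quad _ _ _ _ (C * \sum_(k < m.+1) M k) e) => // h he.
have s1 := sF h he.
have s0 : smooth (F x) by have := sF 0; rewrite addr0; apply; rewrite normr0.
have sB := @smoothB _ _ _ s1 s0.
have sZ := @smoothZ _ h _ sG.
rewrite -(tameB s1 s0) -(tameZ h sG) -(tameB sB sZ).
rewrite -mulrA mulr_suml; apply: (est _ (fun k => M k * h ^+ 2)).
  exact: (@smoothB _ _ _ sB sZ).
move=> k v; rewrite (derive1nB k sB sZ) (derive1nB k s1 s0) (derive1nZ k h sG).
exact: H.
Qed.

(** The functions whose translates can be paired uniformly. *)
Definition bsmooth f := smooth f /\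
  forall k, exists2 C, 0 <= C & forall x, `|derive1n k f x| <= C.

Lemma bsmooth_derive1 f : bsmooth f -> bsmooth (derive1 f).
Proof.
move=> [sf bf]; split; first exact: (smooth_derive1 sf).
by move=> k; have [C C0 HC] := bf k.+1; exists C => // x; rewrite -derive1Sn.
Qed.

Lemma bsmooth_bounds f : bsmooth f -> exists C : nat -> R,
  forall k, 0 <= C k /\ forall x, `|derive1n k f x| <= C k.
Proof.
move=> [_ bf]; suff /choice[C HC] : forall k, exists C, 0 <= C /\
   forall x, `|derive1n k f x| <= C by exists C.
by move=> k; have [C ? ?] := bf k; exists C.
Qed.

Lemma is_derive_tame_conv f (x : R) : bsmooth f ->
  is_derive x 1 (fun x => L (fun v => f (x - v))) (L (fun v => derive1 f (x - v))).
Proof.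
move=> bf; have [sf _] := bf; have [C HC] := bsmooth_bounds bf.
have R1 y := @smooth_reflect R f y sf.
have R2 := @smooth_reflect R (derive1 f) x (smooth_derive1 sf).
apply: (@tame_is_derive (fun x v => f (x - v)) _ x 1 (fun k => C k.+2)) => //.
- by move=> h _; case: (R1 (x + h)).
- by case: R2.
- move=> k h v _.
  rewrite (R1 _).2 (R1 _).2 R2.2 -derive1Sn.
  have -> : (-1) ^+ k * derive1n k f (x + h - v) - (-1) ^+ k * derive1n k f (x - v) -
     h * ((-1) ^+ k * derive1n k.+1 f (x - v)) =
     (-1) ^+ k * (derive1n k f ((x - v) + h) - derive1n k f (x - v) -
        h * derive1n k.+1 f (x - v)).
    by rewrite (_ : x + h - v = x - v + h); ring.
  rewrite normrMsign.
  apply: (@taylor1_bound _ (derive1n k f) (derive1n k.+1 f) (derive1n k.+2 f)) => y _.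
  + by have := smooth_is_derive y (@smooth_derive1n R k f sf); rewrite -derive1nS.
  + by have := smooth_is_derive y (@smooth_derive1n R k.+1 f sf); rewrite -derive1nS.
  + exact: (HC _).2.
Qed.

Lemma tame_conv_bounded f : bsmooth f ->
  exists2 C, 0 <= C & forall x, `|L (fun v => f (x - v))| <= C.
Proof.
move=> bf; have [sf _] := bf; have [C HC] := bsmooth_bounds bf.
have [K [m [K0 est]]] := tame_estimate.
exists (K * \sum_(k < m.+1) C k).
  by rewrite mulr_ge0// sumr_ge0// => i _; case: (HC i).
move=> x; have [s1 s2] := @smooth_reflect R f x sf.
by apply: est => // k y; rewrite s2 normrMsign; exact: (HC k).2.
Qed.

End tame_functionals.

(** * Heat potentials *)

Section heat_potential.
Context {R : realType}.
Variables (L : (R -> R) -> R) (a : R).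
Hypothesis Lt : tame L a.
Implicit Types (w t : R) (j k : nat).

(** For L the pairing with mu, potential 0 w (T - t) is U T mu w t; the index
    j counts derivatives in w. *)
Definition potential j w t : R := L (fun v => heat j (w - v) t).

Lemma smooth_heat_reflect j w t : smooth (fun v => heat j (w - v) t) /\
  forall k, derive1n k (fun v => heat j (w - v) t) =
            (fun v => (-1) ^+ k * heat (j + k) (w - v) t).
Proof.
have [sh dh] := @smooth_heat R j t.
have [s d] := @smooth_reflect R (heat j ^~ t) w sh.
by split => // k; rewrite d dh.
Qed.

Lemma heat_bounds (t0 : R) : 0 < t0 -> exists C : nat -> R,
  forall j, 0 <= C j /\ forall x t, t0 <= t -> `|heat j x t| <= C j.
Proof.
move=> t00; suff /choice[C HC] : forall j, exists C, 0 <= C /\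
   forall x t, t0 <= t -> `|heat j x t| <= C by exists C.
by move=> j; have [C ? ?] := @heat_bounded R j _ t00; exists C.
Qed.

Lemma bsmooth_heat j t : 0 < t -> bsmooth (heat j ^~ t).
Proof.
move=> t0; have [s d] := @smooth_heat R j t; split => // k; rewrite d.
by have [C C0 HC] := @heat_bounded R (j + k) t t0; exists C => // x; exact: HC.
Qed.

Lemma is_derive_potential j w t : 0 < t ->
  is_derive w 1 (potential j ^~ t) (potential j.+1 w t).
Proof.
move=> t0; have := is_derive_tame_conv Lt w (bsmooth_heat j t0).
by rewrite (derive1_eq (is_derive_heat j ^~ t)).
Qed.

Lemma is_derive_potential_time j w t : 0 < t ->
  is_derive t 1 (potential j w) (2^-1 * potential j.+2 w t).
Proof.
move=> t0; have t20 : 0 < t / 2 by rewrite divr_gt0.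
have [C HC] := heat_bounds t20.
have sG := (smooth_heat_reflect j.+2 w t).1.
rewrite /potential -(tameZ Lt _ sG).
apply: (@tame_is_derive _ L a Lt (fun r v => heat j (w - v) r) _ t (t / 2)
   (fun k => C (j + k).+4)) => //.
- by move=> h _; case: (smooth_heat_reflect j w (t + h)).
- exact: (@smoothZ _ _ _ sG).
- move=> k h v ht.
  rewrite (smooth_heat_reflect j _ _).2 (smooth_heat_reflect j _ _).2 (derive1nZ k _ sG).
  rewrite (smooth_heat_reflect j.+2 _ t).2.
  have -> : (-1) ^+ k * heat (j + k) (w - v) (t + h) - (-1) ^+ k * heat (j + k) (w - v) t -
     h * (2^-1 * ((-1) ^+ k * heat (j.+2 + k) (w - v) t)) =
     (-1) ^+ k * (heat (j + k) (w - v) (t + h) - heat (j + k) (w - v) t -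
        h * (2^-1 * heat (j + k).+2 (w - v) t)).
    by rewrite !addSn; ring.
  have near_t y : `|y - t| <= `|h| -> t / 2 <= y.
    by move=> yt; have := le_lt_trans yt ht; rewrite ltr_distl => /andP[]; lra.
  rewrite normrMsign.
  apply: (@taylor1_bound _ (fun r => heat (j + k) (w - v) r)
     (fun r => 2^-1 * heat (j + k).+2 (w - v) r)
     (fun r => 2^-1 * (2^-1 * heat (j + k).+4 (w - v) r))) => y /near_t yt.
  + by apply: is_derive_heat_time; lra.
  + have y0 : 0 < y by lra.
    have := is_deriveM' (is_derive_cst (2^-1 : R) y 1) (is_derive_heat_time (j + k).+2 (w - v) y0).
    by move=> h'; apply: (is_derive_eq h'); rewrite /= mul0r add0r.
  + have [C0 /(_ (w - v) y yt) h1] := HC (j + k).+4.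
    move: (heat _ _ _) h1 => z h1; rewrite mulrA normrM ger0_norm ?mulr_ge0 ?invr_ge0//.
    by have := normr_ge0 z; lra.
Qed.

Lemma potential_bounded j (t0 : R) : 0 < t0 -> exists2 C, 0 <= C &
  forall w t, t0 <= t -> `|potential j w t| <= C.
Proof.
move=> t00; have [C HC] := heat_bounds t00.
have [K [m [K0 est]]] := tame_estimate Lt.
exists (K * \sum_(k < m.+1) C (j + k)%N).
  by rewrite mulr_ge0// sumr_ge0// => i _; case: (HC (j + i)%N).
move=> w t tt; apply: (est _ (fun k => C (j + k)%N)).
  by case: (smooth_heat_reflect j w t).
by move=> k x; rewrite (smooth_heat_reflect j w t).2 normrMsign; apply: (HC _).2.
Qed.

Lemma potential_continuous j w t : 0 < t ->
  {for (w, t), continuous (fun z : R * R => potential j z.1 z.2)}.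
Proof.
move=> t0; have t20 : 0 < t / 2 by rewrite divr_gt0.
have [C C0 HC] := potential_bounded j.+1 t20.
have ct : {for t, continuous (potential j w)}.
  exact: (is_derive_continuous (is_derive_potential_time j w t0)).
apply/cvgrPdist_le => /= r r0.
have r2 : 0 < r / 2 by rewrite divr_gt0.
have rC : 0 < r / (2 * (C + 1)) by rewrite divr_gt0// mulr_gt0// ltr_wpDl.
have n1 : \forall y \near t, t / 2 < y by apply: lt_nbhsr; lra.
have n2 : \forall y \near t, `|potential j w t - potential j w y| <= r / 2.
  by move: ct => /cvgrPdist_le; apply.
have n3 : \forall y \near w, `|w - y| <= r / (2 * (C + 1)).
  by have /cvgrPdist_le := @cvg_id _ (nbhs w); apply.
near=> z.
have h1 : t / 2 <= z.2 by apply/ltW; near: z; exact: (@cvg_snd R R (nbhs w) (nbhs t) _ _ n1).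
have h2 : `|potential j w t - potential j w z.2| <= r / 2.
  by near: z; exact: (@cvg_snd R R (nbhs w) (nbhs t) _ _ n2).
have h3 : `|w - z.1| <= r / (2 * (C + 1)).
  by near: z; exact: (@cvg_fst R R (nbhs w) (nbhs t) _ _ n3).
have h4 : `|potential j w z.2 - potential j z.1 z.2| <= C * `|w - z.1|.
  have -> : w = z.1 + (w - z.1) by ring.
  rewrite [X in _ <= C * `|X|](_ : _ = w - z.1); last by ring.
  apply: (@lipschitz_bound _ (fun w => potential j w z.2) (fun w => potential j.+1 w z.2)).
    by move=> y _; apply: is_derive_potential; lra.
  by move=> y _; exact: HC.
have -> : potential j w t - potential j z.1 z.2 =
  (potential j w t - potential j w z.2) + (potential j w z.2 - potential j z.1 z.2) by ring.
apply: (le_trans (ler_normD _ _)).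
have h5 : C * `|w - z.1| <= r / 2.
  apply: (@le_trans _ _ ((C + 1) * (r / (2 * (C + 1))))).
    by rewrite ler_pM//; lra.
  by rewrite le_eqVlt; apply/orP; left; apply/eqP; field; lra.
lra.
Unshelve. all: by end_near. Qed.

(** To the left of the support of L the argument of heat 0 is at most - e. *)
Lemma potential_small (e : R) : 0 < e -> exists2 C, 0 <= C &
  forall w t, 0 < t -> w <= a - 2 * e -> `|potential 0 w t| <= C * Num.sqrt t.
Proof.
move=> e0.
have /choice[c hc] : forall k, exists C, 0 <= C /\
   forall x t, 0 < t -> x <= - e -> `|heat k x t| <= C * Num.sqrt t.
  by move=> k; have [C ? ?] := @heat_small R k e e0; exists C.
have [K [m [K0 est]]] := Lt.2 e e0.
exists (K * \sum_(k < m.+1) c k).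
  by rewrite mulr_ge0// sumr_ge0// => i _; case: (hc i).
move=> w t t0 wa; rewrite -mulrA mulr_suml.
apply: est; first by case: (smooth_heat_reflect 0 w t).
move=> k v km av; rewrite (smooth_heat_reflect 0 w t).2 normrMsign add0n.
have wv : w - v <= - e by lra.
apply: (le_trans ((hc k).2 _ _ t0 wv)).
have km' : (k < m.+1)%N by [].
rewrite (bigD1 (Ordinal km'))//= lerDl sumr_ge0// => i _.
by rewrite mulr_ge0 ?sqrtr_ge0//; case: (hc i).
Qed.

End heat_potential.

(** * Exchanging a functional with an integral *)

Section bounded_integrals.
Context {R : realType} d {Y : measurableType d}.
Variable nu : {finite_measure set Y -> \bar R}.
Implicit Types (D : set Y) (h : Y -> R).

Lemma integrable_bounded D h (B : R) : measurable D -> measurable_fun D h ->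
  (forall y, D y -> `|h y| <= B) -> nu.-integrable D (EFin \o h).
Proof.
move=> mD mh hB; apply: measurable_bounded_integrable => //.
  by rewrite ltey_eq fin_num_measure.
exists B; split; first exact: num_real.
by move=> M BM y Dy; apply: (le_trans (hB y Dy)); exact: ltW.
Qed.

Lemma Rintegral_bound D h (B : R) : measurable D -> measurable_fun D h ->
  (forall y, D y -> `|h y| <= B) ->
  `|\int[nu]_(y in D) h y| <= B * fine (nu D).
Proof.
move=> mD mh hB; have ih := integrable_bounded mD mh hB.
apply: (le_trans (le_normr_Rintegral mD ih)).
rewrite -Rintegral_cst//; apply: le_Rintegral => //.
  by apply: (@integrable_bounded _ _ B) => // [|y Dy]; [exact: measurableT_comp|rewrite normr_id hB].
by apply: (@integrable_bounded _ _ `|B|) => // y _.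
Qed.

End bounded_integrals.

Section exchange.
Context {R : realType} d {Y : measurableType d}.
Variable nu : {finite_measure set Y -> \bar R}.
Variables (L : (R -> R) -> R) (a : R).
Hypothesis Lt : tame L a.
Variables (X : Y -> R) (f : R -> R).
Hypothesis mX : measurable_fun setT X.
Hypothesis bf : bsmooth f.
Implicit Types (D : set Y) (k : nat).

Let sf : smooth f := bf.1.

Lemma measurable_smooth (g : R -> R) : smooth g -> measurable_fun setT g.
Proof. by move=> sg; apply: continuous_measurable_fun; exact: (smooth_continuous sg). Qed.

Lemma measurable_smooth_shift (g : R -> R) D (v : R) : measurable_fun setT g ->
  measurable_fun D (fun y => g (X y - v)).
Proof.
move=> mg; apply: measurable_funTS; apply: (measurableT_comp mg).
exact: measurable_funB.
Qed.

Let mconv k D (v : R) : measurable_fun D (fun y => derive1n k f (X y - v)).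
Proof.
by apply: measurable_smooth_shift; apply: measurable_smooth; exact: (@smooth_derive1n R k f sf).
Qed.

Let iconv k D (v : R) : measurable D ->
  nu.-integrable D (EFin \o (fun y => derive1n k f (X y - v))).
Proof.
move=> mD; have [C _ HC] := bf.2 k.
by apply: (@integrable_bounded _ _ _ _ _ _ C) => //; exact: mconv.
Qed.

Definition mean_conv k D (v : R) : R := \int[nu]_(y in D) derive1n k f (X y - v).

Lemma is_derive_mean_conv k D (v : R) : measurable D ->
  is_derive v 1 (mean_conv k D) (- mean_conv k.+1 D v).
Proof.
move=> mD; have [C C0 HC] := bf.2 k.+2.
apply: (@is_derive_quad _ _ _ _ (C * fine (nu D)) 1) => // h _.
rewrite mulrN opprK -mulrA (mulrC (fine _)) mulrA /mean_conv.
rewrite -RintegralB ?iconv// -RintegralZl ?iconv//.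
have i1 := iconv k (v + h) mD; have i2 := iconv k v mD; have i3 := iconv k.+1 v mD.
rewrite -RintegralD//; last 2 first.
- by have := integrableB mD i1 i2; apply: eq_integrable.
- by have := integrableZl mD h i3; apply: eq_integrable.
apply: Rintegral_bound => //.
  apply: measurable_funD; first by apply: measurable_funB; exact: mconv.
  by apply: measurable_funM => //; exact: mconv.
move=> y _.
have -> : X y - (v + h) = (X y - v) + (- h) by ring.
have := @taylor1_bound R (derive1n k f) (derive1n k.+1 f) (derive1n k.+2 f) (X y - v) (- h) C.
rewrite sqrrN mulNr opprK; apply => z _.
+ by have := smooth_is_derive z (@smooth_derive1n R k f sf); rewrite -derive1nS.
+ by have := smooth_is_derive z (@smooth_derive1n R k.+1 f sf); rewrite -derive1nS.
+ exact: HC.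
Qed.

Lemma smooth_mean_conv D : measurable D -> smooth (mean_conv 0 D) /\
  forall k, derive1n k (mean_conv 0 D) = (fun v => (-1) ^+ k * mean_conv k D v).
Proof.
move=> mD; have h0 : mean_conv 0 D = (fun v => (-1) ^+ 0 * mean_conv 0 D v).
  by apply/funext => v; rewrite mul1r.
have hd k (v : R) : is_derive v 1 (fun v => (-1) ^+ k * mean_conv k D v)
    ((-1) ^+ k.+1 * mean_conv k.+1 D v).
  have := is_deriveM' (is_derive_cst ((-1) ^+ k : R) v 1) (is_derive_mean_conv k v mD).
  by move=> h; apply: (is_derive_eq h); rewrite exprS /=; ring.
have [s1 s2] := @smooth_of_family R (fun k v => (-1) ^+ k * mean_conv k D v) hd.
by rewrite h0.
Qed.

Let Lf (x : R) := L (fun v => f (x - v)).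

Lemma continuous_tame_conv : continuous Lf.
Proof.
by move=> x; exact: (is_derive_continuous (is_derive_tame_conv Lt x bf)).
Qed.

Let mLf D : measurable_fun D (fun y => Lf (X y)).
Proof.
apply: measurable_funTS; apply: measurableT_comp => //.
exact: (continuous_measurable_fun continuous_tame_conv).
Qed.

Let iLf D : measurable D -> nu.-integrable D (EFin \o (fun y => Lf (X y))).
Proof.
move=> mD; have [C _ HC] := tame_conv_bounded Lt bf.
by apply: (@integrable_bounded _ _ _ _ _ _ C) => // y _; exact: HC.
Qed.

(** The failure of L to commute with the integral over D. *)
Definition exchange_defect D : R :=
  L (mean_conv 0 D) - \int[nu]_(y in D) Lf (X y).

Lemma exchange_defectU D1 D2 : measurable D1 -> measurable D2 -> [disjoint D1 & D2] ->
  exchange_defect (D1 `|` D2) = exchange_defect D1 + exchange_defect D2.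
Proof.
move=> m1 m2 dj; rewrite /exchange_defect.
have m12 := measurableU _ _ m1 m2.
have -> : mean_conv 0 (D1 `|` D2) = (fun v => 1 * mean_conv 0 D1 v + mean_conv 0 D2 v).
  by apply/funext => v; rewrite mul1r /mean_conv Rintegral_setU//; exact: iconv.
rewrite Rintegral_setU//; last exact: iLf.
rewrite (Lt.1 1 _ _ (smooth_mean_conv m1).1 (smooth_mean_conv m2).1); ring.
Qed.

Lemma exchange_defect_bound : exists2 C, 0 <= C &
  forall D, measurable D -> `|exchange_defect D| <= C * fine (nu D).
Proof.
have [B HB] := bsmooth_bounds bf.
have [K [m [K0 est]]] := tame_estimate Lt.
have [C C0 HC] := tame_conv_bounded Lt bf.
exists (K * (\sum_(k < m.+1) B k) + C).
  by rewrite addr_ge0// mulr_ge0// sumr_ge0// => i _; case: (HB i).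
move=> D mD; have [s dm] := smooth_mean_conv mD.
apply: (le_trans (ler_normB _ _)); rewrite mulrDl; apply: lerD; last first.
  by apply: Rintegral_bound => // y _; exact: HC.
rewrite -mulrA mulr_suml; apply: (est _ (fun k => B k * fine (nu D))) => // k v.
rewrite dm normrMsign; apply: Rintegral_bound => // y _; exact: (HB k).2.
Qed.

(** As long as X stays within l of x, both terms of the defect differ from
    nu(D) * L (f (x - v)) by at most a constant times l * nu(D). *)
Lemma exchange_defect_small : exists2 C, 0 <= C &
  forall D (x l : R), measurable D -> (forall y, D y -> `|X y - x| <= l) ->
    `|exchange_defect D| <= C * l * fine (nu D).
Proof.
have [B HB] := bsmooth_bounds bf.
have [K [m [K0 est]]] := tame_estimate Lt.
have [C C0 HC] := tame_conv_bounded Lt (bsmooth_derive1 bf).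
exists (K * (\sum_(k < m.+1) B k.+1) + C).
  by rewrite addr_ge0// mulr_ge0// sumr_ge0// => i _; case: (HB i.+1).
move=> D x l mD xl; have [s dm] := smooth_mean_conv mD.
have [s' d'] := @smooth_reflect R f x sf.
pose q := fine (nu D).
have sq := @smoothZ _ q _ s'.
have -> : exchange_defect D = L (fun v => mean_conv 0 D v - q * f (x - v)) -
     \int[nu]_(y in D) (Lf (X y) - Lf x).
  rewrite (tameB Lt s sq) (tameZ Lt q s') RintegralB ?iLf//; last first.
    by apply: (@integrable_bounded _ _ _ _ _ _ `|Lf x|).
  by rewrite Rintegral_cst// /exchange_defect -/q /Lf; ring.
apply: (le_trans (ler_normB _ _)); rewrite 2!mulrDl; apply: lerD; last first.
  apply: Rintegral_bound => //.
    by apply: measurable_funB => //; exact: mLf.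
  move=> y Dy; have -> : X y = x + (X y - x) by ring.
  apply: (@le_trans _ _ (C * `|X y - x|)); last by rewrite ler_wpM2l// xl.
  apply: (@lipschitz_bound _ Lf (fun x => L (fun v => derive1 f (x - v)))) => z _.
    exact: (is_derive_tame_conv Lt z bf).
  exact: HC.
have -> : K * (\sum_(k < m.+1) B k.+1) * l * fine (nu D) =
   K * \sum_(k < m.+1) (B k.+1 * l * fine (nu D)).
  by rewrite -!mulrA; congr (K * _); rewrite !mulr_suml; apply: eq_bigr => i _; ring.
apply: (est _ (fun k => B k.+1 * l * fine (nu D))); first exact: (@smoothB _ _ _ s sq).
move=> k v; rewrite (derive1nB k s sq) (derive1nZ k q s') dm d'.
have -> : (-1) ^+ k * mean_conv k D v - q * ((-1) ^+ k * derive1n k f (x - v)) =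
  (-1) ^+ k * (\int[nu]_(y in D) (derive1n k f (X y - v) - derive1n k f (x - v))).
  rewrite RintegralB ?iconv//; last first.
    by apply: (@integrable_bounded _ _ _ _ _ _ `|derive1n k f (x - v)|).
  by rewrite Rintegral_cst// -/q /mean_conv; ring.
rewrite normrMsign; apply: Rintegral_bound => //.
  by apply: measurable_funB => //; exact: mconv.
move=> y Dy; have -> : X y - v = (x - v) + (X y - x) by ring.
apply: (@le_trans _ _ (B k.+1 * `|X y - x|)); last first.
  by rewrite ler_wpM2l ?xl//; exact: (HB _).1.
apply: (@lipschitz_bound _ (derive1n k f) (derive1n k.+1 f)) => z _.
  by have := smooth_is_derive z (@smooth_derive1n R k f sf); rewrite -derive1nS.
exact: (HB _).2.
Qed.

Let slab D (p q : R) := D `&` X @^-1` `[p, q[.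

Let mslab D p q : measurable D -> measurable (slab D p q).
Proof.
move=> mD; apply: measurableI => //; rewrite -[X in measurable X]setTI.
by apply: mX => //; exact: measurable_itv.
Qed.

Let slabU D p q r : p <= q -> q <= r ->
  slab D p r = slab D p q `|` slab D q r /\ [disjoint slab D p q & slab D q r].
Proof.
move=> pq qr; split.
  apply/seteqP; split => [y [Dy]|y [[Dy]|[Dy]]]; rewrite /= !in_itv/= => /andP[h1 h2].
  - have [h|h] := ltP (X y) q; [left|right]; split => //=; rewrite in_itv/= ?h ?h1 ?h2//.
  - by split => //=; rewrite in_itv/= h1 (lt_le_trans h2).
  - by split => //=; rewrite in_itv/= h2 (le_trans pq).
apply/disj_set2P/seteqP; split => // y [[_ /=]]; rewrite in_itv/= => /andP[_ h1] [_ /=].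
by rewrite in_itv/= leNgt h1.
Qed.

(** Cut into n slabs of width (q - p) / n: the bounds of order nu / n on the
    pieces add up to a total of order 1 / n. *)
Lemma exchange_defect_slab D (p q : R) : measurable D -> p <= q ->
  exchange_defect (slab D p q) = 0.
Proof.
move=> mD pq; have [C C0 HC] := exchange_defect_small.
have nuU (A B : set Y) : measurable A -> measurable B -> [disjoint A & B] ->
    fine (nu (A `|` B)) = fine (nu A) + fine (nu B).
  move=> mA mB /disj_set2P AB; rewrite measureU// fineD//; exact: fin_num_measure.
have main (n : nat) (l : R) : 0 <= l ->
    `|exchange_defect (slab D p (p + n%:R * l))| <= C * l * fine (nu (slab D p (p + n%:R * l))).
  move=> l0; elim: n => [|n IH].
    rewrite mul0r addr0; apply: (HC _ p); first exact: mslab.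
    by move=> y [_ /=]; rewrite in_itv/= => /andP[h1 h2]; move: (le_lt_trans h1 h2); rewrite ltxx.
  have h1 : p <= p + n%:R * l by rewrite lerDl mulr_ge0.
  have h2 : p + n%:R * l <= p + n.+1%:R * l by rewrite -natr1 mulrDl mul1r; lra.
  have [-> dj] := slabU D h1 h2.
  rewrite (exchange_defectU (mslab _ _ mD) (mslab _ _ mD) dj).
  rewrite (nuU _ _ (mslab _ _ mD) (mslab _ _ mD) dj) mulrDr.
  apply: (le_trans (ler_normD _ _)); apply: lerD => //.
  apply: (HC _ (p + n%:R * l)); first exact: mslab.
  move=> y [_ /=]; rewrite in_itv/= -natr1 mulrDl mul1r => /andP[h3 h4].
  by rewrite ger0_norm; lra.
apply/eqP; rewrite -normr_le0.
pose A := C * (q - p) * fine (nu (slab D p q)).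
have A0 : 0 <= A by rewrite /A !mulr_ge0 ?subr_ge0// fine_ge0.
have key (n : nat) : `|exchange_defect (slab D p q)| <= A / n.+1%:R.
  have := main n.+1 ((q - p) / n.+1%:R).
  rewrite (_ : p + n.+1%:R * ((q - p) / n.+1%:R) = q); last first.
    by rewrite mulrC divfK ?pnatr_eq0//; ring.
  rewrite divr_ge0 ?subr_ge0// => /(_ isT) h; apply: (le_trans h).
  by rewrite /A le_eqVlt; apply/orP; left; apply/eqP; ring.
rewrite leNgt; apply/negP => e0.
have := archi_boundP (divr_ge0 A0 (ltW e0)); set n := Num.bound _ => An.
have := key n; rewrite ler_pdivlMr// -natr1 => h.
by move: An; rewrite ltr_pdivrMr//; lra.
Qed.

(** Fubini's theorem for a functional and a finite measure. The defect of
    exchange is additive in D, vanishes on the part of D where X lies in a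
    bounded interval, and is at most a constant times the mass of the rest,
    which tends to 0. *)
Lemma tame_integral D : measurable D ->
  L (fun v => \int[nu]_(y in D) f (X y - v)) =
  \int[nu]_(y in D) L (fun v => f (X y - v)).
Proof.
move=> mD; apply/eqP; rewrite -subr_eq0 -normr_le0.
have [C C0 HC] := exchange_defect_bound.
pose F (n : nat) := D `\` slab D (- n%:R) n%:R.
have mF n : measurable (F n) by apply: measurableD => //; exact: mslab.
have defF n : exchange_defect D = exchange_defect (F n).
  have DE : D = slab D (- n%:R) n%:R `|` F n.
    by rewrite /F setDUK//; exact: subIsetl.
  have dj : [disjoint slab D (- n%:R) n%:R & F n].
    by apply/disj_set2P/seteqP; split => // y [h1 [_]]; exact.
  rewrite {1}DE (exchange_defectU (mslab _ _ mD) (mF n) dj).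
  by rewrite exchange_defect_slab ?add0r// -subr_ge0 opprK addr_ge0.
have F0 : \bigcap_n F n = set0.
  apply/seteqP; split => // y Fy.
  have := archi_boundP (normr_ge0 (X y)); set n := Num.bound _ => Xn.
  have [Dy] := Fy n I; apply; split => //=; rewrite in_itv/=.
  by move: Xn; rewrite ltr_norml => /andP[/ltW -> ->].
have Fcvg : fine (nu (F n)) @[n --> \oo] --> (0 : R).
  have := @nonincreasing_cvg_mu _ _ _ nu F.
  rewrite F0 measure0 => h; apply/fine_cvg/h => //.
  - by rewrite ltey_eq fin_num_measure.
  - move=> m n mn; apply/subsetPset => y [Dy nS]; split => // -[_ /=].
    rewrite in_itv/= => /andP[h1 h2]; apply: nS; split => //=; rewrite in_itv/=.
    have mnR : (m%:R <= n%:R :> R) by rewrite ler_nat.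
    by apply/andP; split; lra.
rewrite -/(exchange_defect D).
have : C * fine (nu (F n)) @[n --> \oo] --> C * 0 by apply: cvgMl_tmp.
rewrite mulr0 => h; rewrite -(cvg_lim _ h)//; apply: limr_ge; first by apply/cvg_ex; exists 0.
by near=> n; rewrite (defF n); exact: HC.
Unshelve. all: by end_near. Qed.

End exchange.

(** * Independence and laws of random variables *)

Section independence.
Context {R : realType} {d : measure_display} {Omega : measurableType d}.
Variable P : probability Omega R.

Definition indep_sets (E H : set Omega) := (P (E `&` H) = P E * P H)%E.

Section generated.
Variables (n : nat) (xi : nat -> Omega -> R).
Hypothesis mxi : forall i, measurable_fun setT (xi i).
Hypothesis ind : mutually_independent P (fun i : 'I_n.+1 => xi i).

Let G := [set E : set Omega | exists A : nat -> set R,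
  (forall i, measurable (A i)) /\ E = [set w | forall i, (i < n)%N -> A i (xi i w)]].

Let mG : G `<=` measurable.
Proof.
move=> E [A [mA ->]].
have -> : [set w | forall i, (i < n)%N -> A i (xi i w)] =
   \bigcap_(i in [set i | (i < n)%N]) (xi i @^-1` A i) by [].
apply: bigcap_measurableType => i _; rewrite -[X in measurable X]setTI; exact: mxi.
Qed.

(** In E, both sides are finite measures; by mutual independence they agree on
    the cylinders of the first n variables, which are stable under
    intersection and generate the sigma-algebra. *)
Lemma indep_generated (E : set Omega) (C : set R) : <<s G >> E -> measurable C ->
  indep_sets E (xi n @^-1` C).
Proof.
move=> sE mC; rewrite /indep_sets.
have mH : measurable (xi n @^-1` C) by rewrite -[X in measurable X]setTI; exact: mxi.
have PH := fin_num_measure P _ mH.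
pose m1 : {measure set Omega -> \bar R} := mrestr P mH.
have pH : 0 <= fine (P (xi n @^-1` C)) by rewrite fine_ge0.
pose m2 : {measure set Omega -> \bar R} := mscale (NngNum pH) P.
have -> : (P (E `&` xi n @^-1` C))%E = m1 E by [].
have m2E D : m2 D = (P D * P (xi n @^-1` C))%E.
  by rewrite /m2 /= /mscale /= fineK ?PH// muleC.
rewrite -m2E.
apply: (@g_sigma_algebra_measure_unique _ R _ G mG (fun=> setT)) => //.
- move=> _; exists (fun=> setT); split => //.
  by apply/seteqP; split.
- by rewrite bigcup_const.
- move=> _ _ [A [mA ->]] [B [mB ->]]; exists (fun i => A i `&` B i); split.
    by move=> i; exact: measurableI.
  apply/seteqP; split => w /=; first by move=> [h1 h2] i iN; split; [exact: h1|exact: h2].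
  by move=> h; split => i iN; have [] := h i iN.
- move=> _ [A [mA ->]].
  rewrite m2E -[m1 _]/(P (_ `&` _)).
  pose A1 (Z : set R) (i : 'I_n.+1) := if (i < n)%N then A i else Z.
  have mA1 Z i : measurable Z -> measurable (A1 Z i) by rewrite /A1; case: ifP.
  have key (Z : set R) : measurable Z ->
     P ([set w | forall i, (i < n)%N -> A i (xi i w)] `&` xi n @^-1` Z) =
     ((\prod_(i < n) fine (P (xi i @^-1` A i)))%:E * P (xi n @^-1` Z))%E.
    move=> mZ; have := ind (fun i => mA1 Z i mZ).
    rewrite big_ord_recr/= EFinM => h.
    have -> : [set w | forall i, (i < n)%N -> A i (xi i w)] `&` xi n @^-1` Z =
       \bigcap_(i in [set: 'I_n.+1]) (xi i @^-1` A1 Z i).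
      apply/seteqP; split => w /=.
        move=> [h1 h2] i _; rewrite /= /A1; case: ifPn => [|ni]; first exact: h1.
        suff -> : nat_of_ord i = n by [].
        by apply/eqP; rewrite eqn_leq -ltnS ltn_ord leqNgt.
      move=> h1; split => [i iN|].
        by have := h1 (Ordinal (ltnW iN : (i < n.+1)%N)) I; rewrite /= /A1 /= iN.
      by have := h1 ord_max I; rewrite /= /A1 /= ltnn.
    rewrite h; congr (_ * _)%E.
      congr EFin; apply: eq_bigr => i _.
      by rewrite /A1/= ltn_ord.
    rewrite /A1/= ltnn fineK// fin_num_measure//.
    by rewrite -[X in measurable X]setTI; exact: mxi.
  rewrite key//; congr (_ * _)%E.
  have := key setT measurableT; rewrite preimage_setT setIT => ->.
  by rewrite probability_setT mule1.
- by move=> _; rewrite -[m1 _]/(P (_ `&` _)) setTI ltey_eq PH.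
Qed.

End generated.

Lemma indep_sets_capN (F : nat -> set Omega) (H : set Omega) :
  (forall n, measurable (F n)) -> measurable H ->
  (forall n, F n.+1 `<=` F n) -> (forall n, indep_sets (F n) H) ->
  indep_sets (\bigcap_n F n) H.
Proof.
move=> mF mH dF iF.
have niF : nonincreasing_seq F.
  by apply/nonincreasing_seqP => n; apply/subsetPset; exact: dF.
have mcap : measurable (\bigcap_n F n) by exact: bigcap_measurable.
have c1 : P (F n) @[n --> \oo] --> P (\bigcap_n F n).
  by apply: nonincreasing_cvg_mu => //; rewrite ltey_eq fin_num_measure.
have c2 : P (F n `&` H) @[n --> \oo] --> P ((\bigcap_n F n) `&` H).
  rewrite -bigcapIl; last by exists 0%N.
  apply: (@nonincreasing_cvg_mu _ _ _ P (fun n => F n `&` H)).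
  - by rewrite ltey_eq fin_num_measure//; exact: measurableI.
  - by move=> n; exact: measurableI.
  - by apply: bigcap_measurableType => n _; exact: measurableI.
  - by move=> n m nm; apply/subsetPset; apply: setSI; apply/subsetPset/niF.
have c3 : P (F n `&` H) @[n --> \oo] --> (P (\bigcap_n F n) * P H)%E.
  under eq_fun do rewrite iF.
  by apply: cvgeMr => //; exact: fin_num_measure.
by rewrite /indep_sets -(cvg_lim _ c2)// (cvg_lim _ c3).
Qed.

Lemma indep_sets_cupN (F : nat -> set Omega) (H : set Omega) :
  (forall n, measurable (F n)) -> measurable H ->
  (forall n, F n `<=` F n.+1) -> (forall n, indep_sets (F n) H) ->
  indep_sets (\bigcup_n F n) H.
Proof.
move=> mF mH dF iF.
have niF : nondecreasing_seq F.
  by apply/nondecreasing_seqP => n; apply/subsetPset; exact: dF.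
have mcap : measurable (\bigcup_n F n) by exact: bigcup_measurable.
have c1 : P (F n) @[n --> \oo] --> P (\bigcup_n F n).
  exact: nondecreasing_cvg_mu.
have c2 : P (F n `&` H) @[n --> \oo] --> P ((\bigcup_n F n) `&` H).
  rewrite setI_bigcupl.
  apply: (@nondecreasing_cvg_mu _ _ _ P (fun n => F n `&` H)).
  - by move=> n; exact: measurableI.
  - by apply: bigcup_measurable => n _; exact: measurableI.
  - by move=> n m nm; apply/subsetPset; apply: setSI; apply/subsetPset/niF.
have c3 : P (F n `&` H) @[n --> \oo] --> (P (\bigcup_n F n) * P H)%E.
  under eq_fun do rewrite iF.
  by apply: cvgeMr => //; exact: fin_num_measure.
by rewrite /indep_sets -(cvg_lim _ c2)// (cvg_lim _ c3).
Qed.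

End independence.

(** The law of X under the restriction of P to the event A; the proofs of
    measurability are arguments so that the measure structure can be inferred. *)
Definition restricted_law {R : realType} {d d' : measure_display}
  {Omega : measurableType d} {T : measurableType d'} (P : probability Omega R)
  (A : set Omega) (X : Omega -> T) (mA : measurable A) (mX : measurable_fun setT X)
  : set T -> \bar R := fun B => P (X @^-1` B `&` A).

Section restricted_law.
Context {R : realType} {d d' : measure_display} {Omega : measurableType d}
  {T : measurableType d'} (P : probability Omega R).
Variables (A : set Omega) (X : Omega -> T).
Hypotheses (mA : measurable A) (mX : measurable_fun setT X).
Local Notation law := (restricted_law P mA mX).

Let mpre (B : set T) : measurable B -> measurable (X @^-1` B).
Proof. by move=> mB; rewrite -[X in measurable X]setTI; exact: mX. Qed.

Let law0 : law set0 = 0%E.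
Proof. by rewrite /restricted_law preimage_set0 set0I measure0. Qed.

Let law_ge0 B : (0 <= law B)%E.
Proof. exact: measure_ge0. Qed.

Let law_sigma_additive : semi_sigma_additive law.
Proof.
move=> F mF tF mUF; rewrite /restricted_law preimage_bigcup setI_bigcupl.
apply: (measure_semi_sigma_additive (fun n => X @^-1` F n `&` A)).
- by move=> n; apply: measurableI => //; exact: mpre.
- apply/trivIsetP => /= i j _ _ ij.
  move/trivIsetP : tF => /(_ _ _ I I ij) Fij.
  apply/seteqP; split => // w [[/= h1 _] [h2 _]].
  by have : (F i `&` F j) (X w) by []; rewrite Fij.
- apply: bigcup_measurable => n _; apply: measurableI => //; exact: mpre.
Qed.

HB.instance Definition _ := isMeasure.Build _ _ _ law law0 law_ge0 law_sigma_additive.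

Let law_fin : fin_num_fun law.
Proof.
by move=> B mB; apply: fin_num_measure; apply: measurableI => //; exact: mpre.
Qed.

HB.instance Definition _ := Measure_isFinite.Build _ _ _ law law_fin.

Lemma ge0_integral_restricted_law (f : T -> \bar R) : measurable_fun setT f ->
  (forall x, 0 <= f x)%E ->
  (\int[law]_x f x = \int[P]_(w in A) f (X w))%E.
Proof.
move=> mf f0.
pose PA : {measure set Omega -> \bar R} := mrestr P mA.
have mfX : measurable_fun setT (f \o X) by exact: measurableT_comp.
transitivity (\int[pushforward PA X]_x f x)%E.
  by apply: eq_measure_integral.
rewrite ge0_integral_pushforward// preimage_setT.
rewrite (@ge0_negligible_integral _ _ _ PA _ (~` A)) ?setTD ?setCK//.
- apply: eq_measure_integral => B mB BA.
  by rewrite /PA /= /mrestr setIidl.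
- exact: measurableC.
- by move=> w _; exact: f0.
- by change (P (~` A `&` A) = 0%E); rewrite setICl measure0.
Qed.

End restricted_law.

Section sum_of_independent.
Context {R : realType} {d : measure_display} {Omega : measurableType d}.
Variable P : probability Omega R.

(** Integrating out a variable Y independent of (A, X): the joint law is a
    product measure, whose value on a half plane is an iterated integral. *)
Lemma indep_sum_ge (A : set Omega) (X Y : Omega -> R) (v : R) :
  measurable A -> measurable_fun setT X -> measurable_fun setT Y ->
  (forall B C, measurable B -> measurable C ->
     indep_sets P (A `&` X @^-1` B) (Y @^-1` C)) ->
  P (A `&` [set w | v <= X w + Y w]) =
  (\int[P]_(w in A) P (Y @^-1` [set y | (v <= X w + y)%R]))%E.
Proof.
move=> mA mX mY ind.
have mXY : measurable_fun setT (fun w => (X w, Y w)) by exact: measurable_fun_pair.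
have mS : measurable [set z : R * R | v <= z.1 + z.2].
  have mf : measurable_fun setT (fun z : R * R => z.1 + z.2) by exact: measurable_funD.
  rewrite (_ : [set z | _] = setT `&` (fun z : R * R => z.1 + z.2) @^-1` `[v, +oo[); last first.
    by apply/seteqP; split => z; rewrite /= in_itv/= andbT => //; case.
  by apply: mf => //; exact: measurable_itv.
set S := [set z : R * R | v <= z.1 + z.2] in mS *.
pose mT := @measurableT _ Omega.
have -> : P (A `&` [set w | v <= X w + Y w]) = restricted_law P mA mXY S.
  by rewrite /restricted_law setIC.
rewrite -(@product_measure_unique _ _ _ _ R (restricted_law P mA mX)
  (restricted_law P mT mY) (restricted_law P mA mXY)) //.
  rewrite /product_measure1 ge0_integral_restricted_law//.
    apply: eq_integral => w _ /=; rewrite /restricted_law setIT; congr (P _).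
    by apply/seteqP; split => y; rewrite /xsection /= inE.
  exact: measurable_fun_xsection.
move=> B C mB mC.
have := ind B C mB mC; rewrite /indep_sets => h.
have h2 : restricted_law P mT mY C = P (Y @^-1` C) by rewrite /restricted_law setIT.
transitivity (P (X @^-1` B `&` A) * P (Y @^-1` C))%E; last by congr (_ * _)%E; exact/esym/h2.
rewrite [X in (P X * _)%E]setIC -h /restricted_law; congr (P _).
by apply/seteqP; split => w /=; tauto.
Qed.

End sum_of_independent.

(** * Univariate and bivariate normal laws *)

Section normal_law.
Context {R : realType}.
Local Notation leb := (@lebesgue_measure R).
Implicit Types (G : R -> R) (s m b x v t : R).

Lemma ge0_integral_affine G s m b : 0 < s -> continuous G -> (forall x, 0 <= G x) ->
  (\int[leb]_(x in `]-oo, (s * b + m)%R]) (G x)%:E =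
   \int[leb]_(x in `]-oo, b]) (G (s * x + m)%R * s)%:E)%E.
Proof.
move=> s0 cG G0; pose F (x : R) := s * x + m.
have dF x : is_derive x 1 F s.
  have := @is_derive_affine R id s m x 1 (is_derive_id _ _).
  by rewrite mulr1.
have F'E : derive1 F = (fun=> s) by exact: derive1_eq.
have cF : continuous F.
  by move=> x; exact: (is_derive_continuous (dF x)).
have := @increasing_ge0_integration_by_substitutionNy R F G b.
rewrite -[s * b + m]/(F b) => ->.
- by apply: eq_integral => x _; rewrite F'E.
- by move=> x y _ _ xy; rewrite /F ltrD2r ltr_pM2l.
- by rewrite F'E => x _; exact: cst_continuous.
- by rewrite F'E; exact: is_cvg_cst.
- by rewrite F'E; exact: cvg_cst.
- split; first by move=> x _; case: (dF x).
  by apply: cvg_at_left_filter; exact: cF.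
- apply/cvgrNyPle => A; near=> x.
  rewrite /F -lerBrDr mulrC -ler_pdivlMr; last exact: s0.
  by near: x; apply: nbhs_ninfty_le; exact: num_real.
- exact: continuous_subspaceT.
- by move=> x _; exact: G0.
Unshelve. all: by end_near. Qed.

Lemma normal_pdf_scale s x : 0 < s -> normal_pdf 0 s (s * x) * s = gauss_pdf x.
Proof.
move=> s0; rewrite gauss_pdfE !normal_pdfE ?oner_eq0 ?gt_eqF// /normal_peak /normal_fun.
rewrite !subr0 !expr1n !mul1r -mulrnAr sqrtrM ?sqr_ge0// sqrtr_sqr gtr0_norm// invfM.
rewrite (_ : - (s * x) ^+ 2 / (s ^+ 2 *+ 2) = - x ^+ 2 / (1 *+ 2)).
  by set Z := (Num.sqrt (pi *+ 2))^-1; field; rewrite gt_eqF.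
by rewrite -(mulr_natr (s ^+ 2)); field; rewrite gt_eqF.
Qed.

Lemma normal_pdf_heat t x : 0 < t -> normal_pdf 0 (Num.sqrt t) x = heat 1 x t.
Proof.
move=> t0; have s0 : 0 < Num.sqrt t by rewrite sqrtr_gt0.
rewrite heat1 -(normal_pdf_scale (x / Num.sqrt t) s0).
by rewrite [_ * (x / _)]mulrC divfK ?gt_eqF// mulrC mulfK// gt_eqF.
Qed.

Lemma normal_prob_itv_ninfty t x : 0 < t ->
  normal_prob 0 (Num.sqrt t) `]-oo, x] = (heat 0 x t)%:E.
Proof.
move=> t0; have s0 : 0 < Num.sqrt t by rewrite sqrtr_gt0.
rewrite heat0 normal_cdfE /normal_prob.
have -> : x = Num.sqrt t * (x / Num.sqrt t) + 0.
  by rewrite addr0 mulrC divfK// gt_eqF.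
rewrite ge0_integral_affine//.
- rewrite (_ : (Num.sqrt t * (x / Num.sqrt t) + 0) / Num.sqrt t = x / Num.sqrt t).
    apply: eq_integral => y _; congr EFin.
    by rewrite addr0 normal_pdf_scale// gauss_pdfE.
  by rewrite addr0 [_ * (x / _)]mulrC divfK// gt_eqF.
- by apply: continuous_normal_pdf; rewrite gt_eqF.
- by move=> y; exact: normal_pdf_ge0.
Qed.

Lemma normal_prob_itv_pinfty t x v : 0 < t ->
  normal_prob 0 (Num.sqrt t) [set y | v <= x + y] = (heat 0 (x - v) t)%:E.
Proof.
move=> t0; have s0 : 0 < Num.sqrt t by rewrite sqrtr_gt0.
have sn : Num.sqrt t != 0 by rewrite gt_eqF.
rewrite -normal_prob_itv_ninfty// /normal_prob.
have -> : [set y | v <= x + y] = `[v - x, +oo[%classic.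
  by apply/seteqP; split => y; rewrite /= in_itv/= andbT; lra.
rewrite -(opprB v x) ge0_integration_by_substitutionNy//.
- apply: eq_integral => y _; congr EFin.
  by rewrite /= !normal_pdfE// /normal_fun !subr0 sqrrN.
- by apply: continuous_subspaceT; exact: continuous_normal_pdf.
- by move=> y _; exact: normal_pdf_ge0.
Qed.

Lemma integral_normal_prob m s f (U : set R) : measurable U -> measurable_fun U f ->
  (\int[normal_prob m s]_(x in U) `|f x| < +oo)%E ->
  (\int[normal_prob m s]_(x in U) f x =
   \int[leb]_(x in U) (f x * (normal_pdf m s x)%:E))%E.
Proof.
move=> mU mf finf; have dom := normal_prob_dominates m s.
rewrite -(Radon_Nikodym_change_of_variables dom)//=; last by apply/integrableP; split.
apply: ae_eq_integral => //.
- apply: emeasurable_funM => //; apply: (measurable_int leb).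
  apply: (integrableS _ _ (@subsetT _ _)) => //=.
  exact: Radon_Nikodym_integrable.
- apply: emeasurable_funM => //=; apply/measurable_EFinP.
  by apply/measurable_funTS; exact: measurable_normal_pdf.
- apply: ae_eqe_mul2l => /=.
  rewrite Radon_NikodymE//=; case: cid => /= h [h1 h2 h3].
  apply: integral_ae_eq => //=.
  + exact: integrableS h2.
  + by apply/measurable_EFinP/measurable_funTS; exact: measurable_normal_pdf.
  + by move=> E E01 mE; rewrite -h3.
Qed.

End normal_law.

Section bivariate.
Context {R : realType}.
Local Notation leb := (@lebesgue_measure R).
Implicit Types (x y z v t T rho : R).

(** Conditionally on the second variable v, the first one is normal with mean
    rho * v and variance 1 - rho^2. *)
Lemma bivariate_normal_inner rho y v : rho ^+ 2 < 1 ->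
  \int[leb]_(u in `]-oo, y]) bivariate_normal_pdf rho u v =
  gauss_pdf v * normal_cdf ((y - rho * v) / Num.sqrt (1 - rho ^+ 2)).
Proof.
move=> r1; set k := Num.sqrt (1 - rho ^+ 2).
have k0 : 0 < k by rewrite sqrtr_gt0 subr_gt0.
have kn : k != 0 by rewrite gt_eqF.
have k2 : k ^+ 2 = 1 - rho ^+ 2 by rewrite sqr_sqrtr// subr_ge0 ltW.
have kn2 : 1 - rho ^+ 2 != 0 by rewrite -k2 expf_neq0.
have pdfE u : bivariate_normal_pdf rho u v =
    gauss_pdf v * (k^-1 * gauss_pdf (k^-1 * (u - rho * v))).
  have p2 : Num.sqrt (2 * pi : R) ^+ 2 = 2 * pi by rewrite sqr_sqrtr// mulr_ge0// pi_ge0.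
  have pn : Num.sqrt (2 * pi : R) != 0 by rewrite gt_eqF// sqrt2pi_gt0.
  rewrite /bivariate_normal_pdf /gauss_pdf -/k.
  transitivity ((Num.sqrt (2 * pi))^-1 ^+ 2 * k^-1 *
     (expR (- v ^+ 2 / 2) * expR (- (k^-1 * (u - rho * v)) ^+ 2 / 2))); last by ring.
  rewrite -expRD invfM exprVn p2; congr (_ * expR _).
  by rewrite exprMn exprVn k2; field; rewrite kn2.
have -> : \int[leb]_(u in `]-oo, y]) bivariate_normal_pdf rho u v =
   \int[leb]_(u in `]-oo, y]) (gauss_pdf v * (k^-1 * gauss_pdf (k^-1 * (u - rho * v)))).
  by apply: eq_Rintegral => u _; rewrite pdfE.
pose G u := gauss_pdf v * (k^-1 * gauss_pdf (k^-1 * (u - rho * v))).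
have yE : y = k * ((y - rho * v) / k) + rho * v by rewrite mulrC divfK// subrK.
have cG : continuous G.
  move=> u; apply: differentiable_continuous; apply/derivable1_diffP.
  have h1 := is_derive_affine (is_derive_gauss_pdf (k^-1 * u + (- (k^-1 * (rho * v))))).
  have h2 := is_deriveM' (is_derive_cst (k^-1) u 1) h1.
  have := is_deriveM' (is_derive_cst (gauss_pdf v) u 1) h2.
  rewrite (_ : (fun _ => _) = G); first by case.
  by apply/funext => x; rewrite /G mulrBr.
have G0 u : 0 <= G u by rewrite /G !mulr_ge0 ?gauss_pdf_ge0 ?invr_ge0 ?(ltW k0).
rewrite -[LHS]/(fine (\int[leb]_(u in `]-oo, y]) (G u)%:E)%E) {1}yE.
rewrite (@ge0_integral_affine R G k (rho * v) ((y - rho * v) / k) k0 cG G0).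
rewrite normal_cdf_Rintegral -RintegralZl//; last exact: integrable_gauss_pdf.
rewrite /Rintegral; congr fine; apply: eq_integral => u _; congr EFin.
rewrite /G addrK (mulrA k^-1 k) mulVf// mul1r; field.
by rewrite kn.
Qed.

(** For a Brownian motion both sides are P (W_t <= z, W_T >= v). On the left,
    W_t / sqrt t and - W_T / sqrt T have correlation - sqrt (t / T); on the
    right, one conditions on W_t = x. *)
Lemma bivariate_normal_heat t T z v : 0 < t < T ->
  bivariate_normal_cdf (z / Num.sqrt t) (- v / Num.sqrt T) (- Num.sqrt (t / T)) =
  \int[leb]_(x in `]-oo, z]) (heat 0 (x - v) (T - t) * heat 1 x t).
Proof.
move=> /andP[t0 tT]; have T0 : 0 < T by lra.
have st : 0 < Num.sqrt t by rewrite sqrtr_gt0.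
have sT : 0 < Num.sqrt T by rewrite sqrtr_gt0.
have sTt : 0 < Num.sqrt (T - t) by rewrite sqrtr_gt0 subr_gt0.
have rho2 : (- Num.sqrt (t / T)) ^+ 2 = t / T.
  by rewrite sqrrN sqr_sqrtr// divr_ge0 ?ltW.
have r1 : (- Num.sqrt (t / T)) ^+ 2 < 1 by rewrite rho2 ltr_pdivrMr// mul1r.
rewrite /bivariate_normal_cdf.
have -> : \int[leb]_(y in `]-oo, z / Num.sqrt t]) (\int[leb]_(u in `]-oo, - v / Num.sqrt T])
    bivariate_normal_pdf (- Num.sqrt (t / T)) u y) =
  \int[leb]_(y in `]-oo, z / Num.sqrt t]) (heat 0 (Num.sqrt t * y - v) (T - t) * gauss_pdf y).
  apply: eq_Rintegral => y _; rewrite bivariate_normal_inner// mulrC heat0; congr (normal_cdf _ * _).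
  rewrite rho2 (_ : 1 - t / T = (T - t) / T); last by field; lra.
  rewrite !sqrtrM ?sqrtrV ?(ltW t0) ?subr_ge0 ?(ltW tT) ?(ltW T0)//.
  by field; rewrite !gt_eqF.
pose G x := heat 0 (x - v) (T - t) * heat 1 x t.
have cG : continuous G.
  move=> x; apply: differentiable_continuous; apply/derivable1_diffP.
  have h1 := is_derive_heat 0 (1 * x + (- v)) (T - t).
  have h2 := is_deriveM' (is_derive_affine h1) (is_derive_heat 1 x t).
  have -> : G = (fun x => heat 0 (1 * x + - v) (T - t) * heat 1 x t).
    by apply/funext => y; rewrite mul1r.
  by case: h2.
have G0 x : 0 <= G x.
  by rewrite /G mulr_ge0// ?heat0 ?normal_cdf_ge0// -normal_pdf_heat// normal_pdf_ge0.
rewrite /Rintegral {2}(_ : z = Num.sqrt t * (z / Num.sqrt t) + 0); last first.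
  by rewrite addr0 mulrC divfK// gt_eqF.
rewrite (@ge0_integral_affine R G (Num.sqrt t) 0 (z / Num.sqrt t) st cG G0).
congr fine; apply: eq_integral => y _; congr EFin.
by rewrite /G addr0 -mulrA -(normal_pdf_heat _ t0) normal_pdf_scale.
Qed.

End bivariate.

(** * Brownian motion below a continuous boundary *)

Section within_continuity.
Context {R : realType}.

Lemma within_continuousP (A : set R) (f : R -> R) (x : R) : {within A, continuous f} -> A x ->
  forall e, 0 < e -> exists2 dl, 0 < dl & forall y, A y -> `|y - x| < dl -> `|f y - f x| < e.
Proof.
move=> /subspace_continuousP/(_ x)/[swap] Ax /(_ Ax) /cvgrPdist_lt cf e e0.
have [dl dl0 H] := near_ball (cf e e0).
by exists dl => // y Ay yx; rewrite distrC; exact: H.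
Qed.

End within_continuity.

Section brownian.
Context {R : realType} {d : measure_display} {Omega : measurableType d}.
Variables (P : probability Omega R) (W : R -> {RV P >-> R}).
Hypothesis hW : standard_brownian_motion W.
Implicit Types (s t r T : R).

Lemma brownian0 w : W 0 w = 0.
Proof. by case: hW. Qed.

Lemma brownian_path w : {within `[0, +oo[, continuous (fun t => W t w)}.
Proof. by case: hW. Qed.

Lemma brownian_increment_law s t (C : set R) : 0 <= s < t -> measurable C ->
  P ((fun w => W t w - W s w) @^-1` C) = normal_prob 0 (Num.sqrt (t - s)) C.
Proof. by case: hW => _ _ _ h st mC; exact: h. Qed.

Lemma brownian_law t (C : set R) : 0 < t -> measurable C ->
  P (W t @^-1` C) = normal_prob 0 (Num.sqrt t) C.
Proof.
move=> t0 mC; have := @brownian_increment_law 0 t C.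
rewrite lexx t0 subr0 => /(_ isT mC) <-; congr (P _).
by apply/seteqP; split => w; rewrite /= brownian0 subr0.
Qed.

Lemma measurable_brownian t : measurable_fun setT (W t).
Proof. exact: measurable_funPT. Qed.

Lemma measurable_brownian_preimage t (A : set R) : measurable A -> measurable (W t @^-1` A).
Proof. by move=> mA; rewrite -[X in measurable X]setTI; exact: measurable_brownian. Qed.

(** Since the grid starts at 0, the value at a grid time is a sum of the
    increments before it. *)
Lemma brownian_indep_grid (n : nat) (s : nat -> R) (A : nat -> set R) (C : set R) :
  s 0%N = 0 -> (forall i, (i < n.+1)%N -> s i <= s i.+1) ->
  (forall i, measurable (A i)) -> measurable C ->
  indep_sets P [set w | forall j, (j < n)%N -> A j (W (s j.+1) w)]
    ((fun w => W (s n.+1) w - W (s n) w) @^-1` C).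
Proof.
move=> s0 sle mA mC.
pose xi (i : nat) (w : Omega) : R := W (s i.+1) w - W (s i) w.
have mxi i : measurable_fun setT (xi i).
  by apply: measurable_funB; exact: measurable_brownian.
have ind : mutually_independent P (fun i : 'I_n.+1 => xi i).
  by case: hW => _ _ h _; apply: h => //; rewrite s0.
apply: (indep_generated mxi ind) => //.
set G := [set E | _].
pose GT := g_sigma_algebraType G.
have mG i : (i < n)%N -> measurable_fun (setT : set GT) (xi i : GT -> R).
  move=> iN _ B mB; rewrite setTI; apply: sub_sigma_algebra.
  exists (fun j => if j == i then B else setT); split.
    by move=> j; case: ifP.
  apply/seteqP; split => w /=.
    by move=> h j _; case: eqP => // ->.
  by move=> /(_ i iN); rewrite eqxx.
have mS j : (j < n)%N -> measurable_fun (setT : set GT) (fun w : GT => W (s j.+1) w).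
  elim: j => [|j IH] jn.
    apply: eq_measurable_fun (mG 0%N jn) => w _.
    by rewrite /xi s0 brownian0 subr0.
  apply: (@eq_measurable_fun _ _ _ _ _ (fun w : GT => W (s j.+1) w + xi j.+1 w)).
    by move=> w _; rewrite /xi addrC subrK.
  by apply: measurable_funD; [exact: IH (ltnW jn)|exact: mG].
have -> : [set w | forall j, (j < n)%N -> A j (W (s j.+1) w)] =
  \bigcap_(j in [set j | (j < n)%N]) ((fun w : GT => W (s j.+1) w) @^-1` A j) by [].
apply: (@bigcap_measurableType _ GT) => j jn.
by rewrite -[X in measurable X]setTI; exact: mS.
Qed.

End brownian.

Section survival.
Context {R : realType} {d : measure_display} {Omega : measurableType d}.
Variables (P : probability Omega R) (W : R -> {RV P >-> R}).
Hypothesis hW : standard_brownian_motion W.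
Variables (T : R) (g : R -> R).
Hypothesis hg : {within `[0, T], continuous g}.
Implicit Types (s t r v : R).

Definition below t r : set Omega := [set w | forall s, t <= s <= r -> W s w < g s].

Lemma brownian_boundary_continuous w t r : 0 <= t -> r <= T ->
  {within `[t, r], continuous (fun s => W s w - g s)}.
Proof.
move=> t0 rT.
have c1 : {within `[t, r], continuous (fun s => W s w)}.
  apply: (continuous_subspaceW _ (@brownian_path _ _ _ P W hW w)).
  by move=> y; rewrite /= !in_itv/= andbT => /andP[+ _]; exact: le_trans.
have c2 : {within `[t, r], continuous g}.
  apply: (continuous_subspaceW _ hg).
  move=> y; rewrite /= !in_itv/= => /andP[h1 h2].
  by rewrite (le_trans t0 h1) (le_trans h2 rT).
by move=> x; apply: continuousB; [exact: c1|exact: c2].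
Qed.

Let node t r (N j : nat) : R := t + (r - t) * (j%:R / (2 ^ N)%:R).

Let node_in t r N j : t <= r -> (j <= 2 ^ N)%N -> t <= node t r N j <= r.
Proof.
move=> tr jN; have p : 0 < (2 ^ N)%:R :> R by rewrite ltr0n expn_gt0.
have h0 : 0 <= j%:R / (2 ^ N)%:R :> R by rewrite divr_ge0.
have h1 : j%:R / (2 ^ N)%:R <= 1 :> R by rewrite ler_pdivrMr// mul1r ler_nat.
by rewrite /node; apply/andP; split; nra.
Qed.

Let node_le t r N j : t <= r -> node t r N j <= node t r N j.+1.
Proof.
move=> tr; rewrite /node lerD2l ler_wpM2l ?subr_ge0// ler_wpM2r ?invr_ge0//.
by rewrite ler_nat.
Qed.

Let nodeS t r N j : node t r N j = node t r N.+1 (2 * j).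
Proof.
rewrite /node; congr (_ + _ * _); rewrite expnS !natrM; field.
by rewrite pnatr_eq0 expn_eq0.
Qed.

Let below_nodes t r (k N : nat) : set Omega :=
  [set w | forall j, (j <= 2 ^ N)%N -> W (node t r N j) w <= g (node t r N j) - k.+1%:R^-1].

(** A continuous path below the boundary on a compact interval is so by a
    margin 1 / (k + 1), and by continuity this can be tested on the dyadic
    nodes. Both unions and intersections are monotone, so independence passes
    to the limit as measurability does. *)
Lemma below_bigcup t r : 0 <= t -> t <= r -> r <= T ->
  below t r = \bigcup_k \bigcap_N below_nodes t r k N.
Proof.
move=> t0 tr rT; apply/seteqP; split => w.
  move=> bw; have cf := @brownian_boundary_continuous w t r t0 rT.
  have [c] := EVT_max tr cf; rewrite in_itv/= => ctr cmax.
  have fc : 0 < g c - W c w by rewrite subr_gt0 bw.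
  have := archi_boundP (ltW (divr_gt0 ltr01 fc)); set k := Num.bound _ => hk.
  exists k => // N _ j jN; have := cmax (node t r N j).
  rewrite in_itv/= node_in// => /(_ isT) h.
  have : k.+1%:R^-1 <= g c - W c w.
    rewrite -[leRHS]invrK lef_pV2 ?posrE ?invr_gt0// -div1r.
    by apply: ltW; apply: (lt_le_trans hk); rewrite ler_nat.
  move=> h2; rewrite -lerBlDl; apply: (le_trans h).
  by rewrite -opprB lerN2.
move=> [k _ bk] s sI.
have cf := @brownian_boundary_continuous w t r t0 rT.
have kp : 0 < k.+1%:R^-1 :> R by rewrite invr_gt0.
have [e e0 He] := within_continuousP cf (sI : `[t, r]%classic s) kp.
suff [N [j [jN js]]] : exists N j, (j <= 2 ^ N)%N /\ `|node t r N j - s| < e.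
  have := He _ _ js; rewrite /= in_itv/= node_in// => /(_ isT).
  have := bk N I j jN; rewrite ltr_distl => h1 /andP[h2 _].
  have h3 : W (node t r N j) w - g (node t r N j) <= - k.+1%:R^-1 by rewrite lerBlDl.
  by have := lt_le_trans h2 h3; rewrite ltrBlDr addNr subr_lt0.
have [tr'|rt] := ltP t r; last first.
  exists 0%N, 0%N; split => //; rewrite /node mul0r mulr0 addr0.
  by rewrite (_ : t - s = 0) ?normr0//; lra.
have rt0 : 0 < r - t by rewrite subr_gt0.
have := archi_boundP (ltW (divr_gt0 rt0 e0)); set N := Num.bound _ => hN.
have hN2 : (r - t) / e < (2 ^ N)%:R.
  by apply: (lt_trans hN); rewrite ltr_nat ltn_expl.
have p : 0 < (2 ^ N)%:R :> R by rewrite ltr0n expn_gt0.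
pose x := (s - t) / (r - t) * (2 ^ N)%:R.
have x0 : 0 <= x by rewrite mulr_ge0// divr_ge0; lra.
have xN : x <= (2 ^ N)%:R.
  by rewrite /x ler_piMl// ler_pdivrMr; lra.
exists N, (Num.truncn x).
have /andP[j1 j2] := truncn_itv x0.
split; first by rewrite -(ler_nat R); exact: le_trans j1 xN.
have sE : s = t + (r - t) * (x / (2 ^ N)%:R).
  by rewrite /x mulfK ?gt_eqF// mulrC divfK ?gt_eqF//; ring.
rewrite [X in _ - X]sE /node opprD addrACA subrr add0r -mulrBr -mulrBl normrM (gtr0_norm rt0).
rewrite normrM [X in _ * (_ * X)]gtr0_norm ?invr_gt0//.
have h1 : `|(Num.truncn x)%:R - x| <= 1.
  by rewrite ler_distl; move: j2; rewrite -natr1; lra.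
rewrite mulrA ltr_pdivrMr//.
have h2 : (r - t) * `|(Num.truncn x)%:R - x| <= r - t by rewrite ler_piMr// ltW.
by apply: (le_lt_trans h2); rewrite mulrC -ltr_pdivrMr.
Qed.

Let measurable_below_nodes t r k N : measurable (below_nodes t r k N).
Proof.
have -> : below_nodes t r k N = \bigcap_(j in [set j | (j <= 2 ^ N)%N])
  (W (node t r N j) @^-1` `]-oo, g (node t r N j) - k.+1%:R^-1]).
  by apply/seteqP; split => w h j jN; have := h j jN; rewrite /= in_itv.
apply: bigcap_measurableType => j _.
by apply: measurable_brownian_preimage; exact: measurable_itv.
Qed.

Lemma measurable_below t r : 0 <= t -> t <= r -> r <= T -> measurable (below t r).
Proof.
move=> t0 tr rT; rewrite below_bigcup//; apply: bigcup_measurable => k _.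
by apply: bigcap_measurableType => N _; exact: measurable_below_nodes.
Qed.

(** Along the time grid 0, t, ..., r0, r, T the increments are independent. *)
Let below_nodes_indep t r0 r (k N : nat) (B C : set R) :
  0 <= t -> t <= r0 -> r0 <= r -> r <= T -> measurable B -> measurable C ->
  indep_sets P (below_nodes t r0 k N `&` W r @^-1` B)
    ((fun w => W T w - W r w) @^-1` C).
Proof.
move=> t0 tr0 r0r rT mB mC.
pose s (i : nat) : R := if i is j.+1 then
  if (j <= 2 ^ N)%N then node t r0 N j else if (j == (2 ^ N).+1)%N then r else T else 0.
pose A (j : nat) : set R := if (j <= 2 ^ N)%N then
  [set` `]-oo, g (node t r0 N j) - k.+1%:R^-1]] else B.
have sn : s (2 ^ N).+2 = r by rewrite /s ltnn eqxx.
have sn1 : s (2 ^ N).+3 = T.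
  by rewrite /s ifF ?ifF//; [apply/negbTE; rewrite gtn_eqF|apply/negbTE; rewrite -ltnNge].
have := @brownian_indep_grid _ _ _ P W hW (2 ^ N).+2 s A C.
rewrite sn sn1 => /(_ erefl) h; rewrite (_ : _ `&` _ =
   [set w | forall j, (j < (2 ^ N).+2)%N -> A j (W (s j.+1) w)]).
  apply: h => //; last by move=> j; rewrite /A; case: ifP => // _; exact: measurable_itv.
  move=> [|i] iN.
    by rewrite /s leq0n; have /andP[+ _] := node_in tr0 (leq0n (2 ^ N)); exact: le_trans.
  rewrite /s; have [iN'|iN'] := leqP i.+1 (2 ^ N).
    by rewrite (ltnW iN')  node_le.
  have [->|/negbTE ni] := eqVneq i (2 ^ N)%N.
    by rewrite leqnn eqxx; apply: (le_trans _ r0r); have /andP[_] := node_in tr0 (leqnn (2 ^ N)).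
  have -> : i = (2 ^ N).+1.
    by move: iN iN' ni; rewrite !ltnS => h1 h2 h3; apply/eqP; rewrite eqn_leq h1 ltn_neqAle eq_sym h3 h2.
  by rewrite ltnn eqxx gtn_eqF.
apply/seteqP; split => w.
  move=> [h1 h2] j jn; rewrite /s /A; case: ifPn => jN; first by rewrite /= in_itv/= h1.
  move: (jN); rewrite -ltnNge => jN'.
  have -> : j = (2 ^ N).+1 by apply/eqP; rewrite eqn_leq jN' andbT -ltnS.
  by rewrite eqxx.
move=> hw; split => [j jN|].
  by have := hw j (leq_trans jN (leqnSn _)); rewrite /A /s jN /= in_itv.
by have := hw (2 ^ N).+1 (leqnn _); rewrite /A /s ltnn eqxx.
Qed.

Lemma below_indep t r0 r (B C : set R) :
  0 <= t -> t <= r0 -> r0 <= r -> r <= T -> measurable B -> measurable C ->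
  indep_sets P (below t r0 `&` W r @^-1` B) ((fun w => W T w - W r w) @^-1` C).
Proof.
move=> t0 tr0 r0r rT mB mC.
have mD : measurable (W r @^-1` B).
  exact: measurable_brownian_preimage.
have mH : measurable ((fun w => W T w - W r w) @^-1` C).
  rewrite -[X in measurable X]setTI; apply: measurable_funB => //; exact: measurable_brownian.
rewrite below_bigcup ?(le_trans r0r)// setI_bigcupl.
apply: indep_sets_cupN => //.
- move=> k; apply: measurableI => //.
  by apply: bigcap_measurableType => N _; exact: measurable_below_nodes.
- move=> k; apply: setSI => w h N _ j jN; apply: (le_trans (h N I j jN)).
  by rewrite lerD2l lerN2 lef_pV2 ?posrE// ler_nat.
move=> k; rewrite -bigcapIl; last by exists 0%N.
apply: indep_sets_capN => //.
- by move=> N; apply: measurableI => //; exact: measurable_below_nodes.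
- move=> N; apply: setSI => w h j jN; rewrite nodeS; apply: h.
  by rewrite expnS leq_mul2l.
- by move=> N; exact: below_nodes_indep.
Qed.

(** The Markov property at time r: given W r, the tail of W T is that of a
    normal law of variance T - r. *)
Lemma below_heat t r0 r v : 0 <= t -> t <= r0 -> r0 <= r -> r < T ->
  P (below t r0 `&` [set w | v <= W T w]) =
  (\int[P]_(w in below t r0) (heat 0 (W r w - v) (T - r))%:E)%E.
Proof.
move=> t0 tr0 r0r rT.
have mA : measurable (below t r0) by apply: measurable_below => //; lra.
have -> : [set w | v <= W T w] = [set w | v <= W r w + (W T w - W r w)].
  by apply/seteqP; split => w /=; rewrite addrC subrK.
rewrite (@indep_sum_ge _ _ _ P (below t r0) (W r) (fun w => W T w - W r w) v mA).
- apply: eq_integral => w _; rewrite (brownian_increment_law hW).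
  + by rewrite normal_prob_itv_pinfty// subr_gt0.
  + by rewrite rT andbT; lra.
  + rewrite (_ : [set y | _] = `[v - W r w, +oo[%classic); first exact: measurable_itv.
    by apply/seteqP; split => y; rewrite /= in_itv/= andbT lerBlDl.
- exact: measurable_brownian.
- by apply: measurable_funB; exact: measurable_brownian.
- by move=> B C mB mC; apply: below_indep => //; exact: ltW.
Qed.

Variables (L : (R -> R) -> R) (a : R).
Hypothesis Lt : tame L a.

(** The martingale property of the potential along the path, integrated over
    an event that is known at time r0: the right-hand side is the same for all
    later times r. *)
Lemma tame_below t r0 r : 0 <= t -> t <= r0 -> r0 <= r -> r < T ->
  \int[P]_(w in below t r0) potential L 0 (W r w) (T - r) =
  L (fun v => fine (P (below t r0 `&` [set w | v <= W T w]))).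
Proof.
move=> t0 tr0 r0r rT.
have mA : measurable (below t r0) by apply: measurable_below => //; lra.
have Tr : 0 < T - r by rewrite subr_gt0.
rewrite -(@tame_integral _ _ _ P L a Lt (W r) (heat 0 ^~ (T - r))
   (@measurable_brownian _ _ _ P W r) (bsmooth_heat 0 Tr) (below t r0) mA).
by congr L; apply/funext => v; rewrite (below_heat v t0 tr0 r0r rT).
Qed.

End survival.

(** * The martingale stopped at the boundary *)

Section bounded_convergence.
Context {R : realType} d {Y : measurableType d}.
Variable nu : {measure set Y -> \bar R}.

Lemma bounded_convergence (D : set Y) (f_ : nat -> Y -> R) (f : Y -> R) (C : R) :
  measurable D -> (nu D < +oo)%E ->
  (forall n, measurable_fun D (f_ n)) ->
  (forall n y, D y -> `|f_ n y| <= C) ->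
  (forall y, D y -> f_ n y @[n --> \oo] --> f y) ->
  measurable_fun D f /\
  \int[nu]_(y in D) f_ n y @[n --> \oo] --> \int[nu]_(y in D) f y.
Proof.
move=> mD nuD mf fC fcvg.
have mlim : measurable_fun D f by exact: (measurable_fun_cvg mf fcvg).
split => //.
have intC : nu.-integrable D (EFin \o (fun=> C)).
  by apply: measurable_bounded_integrable => //; exact: bounded_cst.
have [|||//||H1 _ H2] := @dominated_convergence _ _ _ nu D mD (fun n y => (f_ n y)%:E)
   (fun y => (f y)%:E) (EFin \o (fun=> C)).
- by move=> n; apply/measurable_EFinP.
- exact/measurable_EFinP.
- by apply: aeW => y Dy; apply: cvg_EFin; [exact: nearW|exact: fcvg].
- by apply: aeW => y n Dy; rewrite lee_fin; exact: fC.
rewrite /Rintegral; apply/fine_cvg.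
rewrite fineK; last exact: integrable_fin_num.
exact: H2.
Qed.

End bounded_convergence.

Section hitting_time.
Context {R : realType}.
Variables (T : R) (x g : R -> R).
Implicit Types (s t r : R).

Definition hitting_time t : R := inf [set s | t <= s <= T /\ g s <= x s].

Hypothesis cxg : {within `[0, T], continuous (fun s => x s - g s)}.

(** By continuity the set of times at or above the boundary is closed, so its
    infimum is attained. *)
Lemma hitting_timeP t r : 0 <= t -> r <= T ->
  ~ (forall s, t <= s <= r -> x s < g s) ->
  [/\ t <= hitting_time t <= r, g (hitting_time t) <= x (hitting_time t) &
     forall s, t <= s < hitting_time t -> x s < g s].
Proof.
move=> t0 rT /existsNP[s /not_implyP[sI /negP]]; rewrite -leNgt => gs.
have /andP[ts sr] := sI.
set S := [set s | t <= s <= T /\ g s <= x s].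
have Ss : S s by rewrite /S /= ts (le_trans sr rT).
have iS : has_inf S by split; [exists s|exists t => y [/andP[]]].
have tS : t <= hitting_time t by apply: lb_le_inf; [exists s|move=> y [/andP[]]].
have Sr : hitting_time t <= s by apply: ge_inf => //; case: iS.
have tauT : hitting_time t <= T by exact: le_trans Sr (le_trans sr rT).
split.
- by rewrite tS (le_trans Sr sr).
- rewrite leNgt; apply/negP => xg.
  have e0 : 0 < g (hitting_time t) - x (hitting_time t) by rewrite subr_gt0.
  have tI : `[0, T]%classic (hitting_time t) by rewrite /= in_itv/= (le_trans t0 tS).
  have [dl dl0 H] := within_continuousP cxg tI e0.
  have [y [/andP[ty yT] gy] ydl] := inf_adherent dl0 iS.
  have tauy : hitting_time t <= y.
    by apply: ge_inf; [case: iS|split => //; rewrite ty].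
  have yI : `[0, T]%classic y by rewrite /= in_itv/= (le_trans t0 ty).
  have := H y yI; rewrite ger0_norm ?subr_ge0// ltrBlDl => /(_ ydl).
  by rewrite ltr_distl => /andP[_]; lra.
- move=> y /andP[ty yS]; rewrite ltNge; apply/negP => gy.
  have : hitting_time t <= y.
    apply: ge_inf; [by case: iS|split => //].
    by rewrite ty (le_trans (ltW yS)).
  by rewrite leNgt yS.
Qed.

Lemma hitting_time_eq t r : 0 <= t -> r <= T -> x t < g t ->
  ~ (forall s, t <= s <= r -> x s < g s) ->
  t < hitting_time t /\ x (hitting_time t) = g (hitting_time t).
Proof.
move=> t0 rT xt nb; have [/andP[ttau taur] gtau bel] := hitting_timeP t0 rT nb.
have tt : t < hitting_time t.
  rewrite lt_neqAle ttau andbT; apply/eqP => e.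
  by move: gtau; rewrite -e leNgt xt.
split => //; apply/eqP; rewrite eq_le gtau andbT leNgt; apply/negP => xg.
have e0 : 0 < x (hitting_time t) - g (hitting_time t) by rewrite subr_gt0.
have tI : `[0, T]%classic (hitting_time t).
  by rewrite /= in_itv/= (le_trans t0 ttau) (le_trans taur).
have [dl dl0 H] := within_continuousP cxg tI e0.
pose y := Num.max t (hitting_time t - dl / 2).
have yt : t <= y by rewrite /y le_max lexx.
have yt2 : hitting_time t - dl / 2 <= y by rewrite /y le_max lexx orbT.
have ytau : y < hitting_time t by rewrite /y gt_max tt; lra.
have yI : `[0, T]%classic y.
  by rewrite /= in_itv/= (le_trans t0 yt) (le_trans (ltW ytau) (le_trans taur rT)).
have yd : `|y - hitting_time t| < dl by rewrite ltr_distl; apply/andP; split; lra.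
have := H y yI yd; rewrite ltr_distl => /andP[h1 _].
by have := bel y; rewrite yt ytau => /(_ isT) h; lra.
Qed.

Lemma below_hitting_time t r s : 0 <= t -> r <= T -> t <= s ->
  ~ (forall s, t <= s <= r -> x s < g s) ->
  (forall y, t <= y <= s -> x y < g y) <-> s < hitting_time t.
Proof.
move=> t0 rT ts nb; have [/andP[ttau taur] gtau bel] := hitting_timeP t0 rT nb.
split => [h|stau y /andP[ty ys]].
  rewrite ltNge; apply/negP => taus.
  by have := h (hitting_time t); rewrite ttau taus => /(_ isT); rewrite ltNge gtau.
by apply: bel; rewrite ty (le_lt_trans ys).
Qed.

End hitting_time.

Section stopping.
Context {R : realType} {d : measure_display} {Omega : measurableType d}.
Variables (P : probability Omega R) (W : R -> {RV P >-> R}).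
Hypothesis hW : standard_brownian_motion W.
Variables (T : R) (g : R -> R).
Hypothesis hg : {within `[0, T], continuous g}.
Variables (L : (R -> R) -> R) (a : R).
Hypothesis Lt : tame L a.
Variable t : R.
Hypothesis t0 : 0 <= t.
Implicit Types (s r : R) (w : Omega).

Lemma Rintegral_indic_mul (D : set Omega) (h : Omega -> R) : measurable D ->
  \int[P]_w (\1_D w * h w) = \int[P]_(w in D) h w.
Proof.
move=> mD; rewrite [RHS]Rintegral_mkcond; apply: eq_Rintegral => w _.
by rewrite patchE indicE; case: ifP => _; rewrite ?mul1r ?mul0r.
Qed.

Let value s w : R := potential L 0 (W s w) (T - s).

Lemma measurable_value s : s < T -> measurable_fun setT (value s).
Proof.
move=> sT; apply: (@measurableT_comp _ _ _ _ _ _ (fun x => potential L 0 x (T - s))).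
  apply: continuous_measurable_fun => x.
  apply: differentiable_continuous; apply/derivable1_diffP.
  by have [] := is_derive_potential Lt 0 x (_ : 0 < T - s); rewrite ?subr_gt0.
exact: measurable_brownian.
Qed.

Lemma value_bounded r : r < T -> exists2 C, 0 <= C &
  forall s w, s <= r -> `|value s w| <= C.
Proof.
move=> rT; have Tr : 0 < T - r by rewrite subr_gt0.
have [C C0 HC] := potential_bounded Lt 0 Tr; exists C => // s w sr.
by apply: HC; rewrite lerD2l lerN2.
Qed.

Lemma value_continuous w s : 0 <= s < T -> forall e, 0 < e ->
  exists2 dl, 0 < dl & forall s', 0 <= s' -> `|s' - s| < dl ->
    `|value s' w - value s w| < e.
Proof.
move=> /andP[s0 sT] e e0; have Ts : 0 < T - s by rewrite subr_gt0.
have := @potential_continuous _ L a Lt 0 (W s w) (T - s) Ts => /cvgrPdist_lt/(_ e e0).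
move=> [[A B] /= [nA nB] AB].
have [e1 e10 H1] := near_ball nA; have [e2 e20 H2] := near_ball nB.
have sI : `[0, +oo[%classic s by rewrite /= in_itv/= s0.
have [dl dl0 H] := within_continuousP (@brownian_path _ _ _ P W hW w) sI e10.
exists (Num.min dl e2); first by rewrite lt_min dl0.
move=> s' s'0; rewrite lt_min => /andP[h1 h2]; rewrite distrC.
apply: (AB (W s' w, T - s')); split => /=.
  by apply: H1; apply: H => //; rewrite /= in_itv/= s'0.
apply: H2; rewrite (_ : T - s' - (T - s) = s - s') 1?distrC//; ring.
Qed.

Let grid r (N i : nat) : R := t + (r - t) * (i%:R / N.+1%:R).

Let grid_in r N i : t <= r -> (i <= N.+1)%N -> t <= grid r N i <= r.
Proof.
move=> tr iN; have h0 : 0 <= i%:R / N.+1%:R :> R by rewrite divr_ge0.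
have h1 : i%:R / N.+1%:R <= 1 :> R by rewrite ler_pdivrMr// mul1r ler_nat.
have rt : 0 <= r - t by rewrite subr_ge0.
have h2 := mulr_ge0 rt h0; have h3 := ler_piMr rt h1.
by rewrite /grid; move: (_ * _) h2 h3 => z h2 h3; apply/andP; split; lra.
Qed.

Let grid0 r N : grid r N 0 = t.
Proof. by rewrite /grid mul0r mulr0 addr0. Qed.

Let gridN r N : grid r N N.+1 = r.
Proof. by rewrite /grid divff ?pnatr_eq0// mulr1 addrC subrK. Qed.

Let grid_step r N i : grid r N i.+1 - grid r N i = (r - t) / N.+1%:R.
Proof. by rewrite /grid -[i.+1%:R]natr1; ring. Qed.

Let alive s w : R := \1_(below W g t s) w.

Let aliveE s w : alive s w = if `[< below W g t s w >] then 1 else 0.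
Proof. by rewrite /alive indicE; case: asboolP => h; [rewrite mem_set|rewrite memNset]. Qed.

Let alive_le s s' w : s <= s' -> alive s' w <= alive s w.
Proof.
move=> ss; rewrite !aliveE; case: asboolP => [h|_]; last by case: ifP.
rewrite ifT//; apply/asboolP => y /andP[ty ys]; apply: h.
by rewrite ty (le_trans ys).
Qed.

Let alive01 s w : 0 <= alive s w <= 1.
Proof. by rewrite aliveE; case: ifP; rewrite lexx ler01. Qed.

(** The value at the first grid time that follows the hitting time: the
    difference of the two factors alive is 1 on the grid step in which the
    boundary is reached and 0 on the others. *)
Let stopped r (N : nat) w : R :=
  \sum_(i < N.+1) (alive (grid r N i) w - alive (grid r N i.+1) w) * value (grid r N i.+1) w
  + alive r w * value r w.

Let measurable_alive s : t <= s -> s <= T -> measurable_fun setT (alive s).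
Proof. by move=> ts sT; apply: measurable_indic; apply: (measurable_below hW hg). Qed.

Let integrable_alive_value s s' : t <= s -> s <= s' -> s' < T ->
  P.-integrable setT (EFin \o (fun w => alive s w * value s' w)).
Proof.
move=> ts ss sT; have [C C0 HC] := value_bounded sT.
apply: (@integrable_bounded _ _ _ P _ _ C) => //.
  by apply: measurable_funM; [apply: measurable_alive => //; lra|exact: measurable_value].
move=> w _; rewrite normrM; have /andP[h1 h2] := alive01 s w.
by rewrite (ger0_norm h1) -[leRHS]mul1r ler_pM// HC.
Qed.

Let alive_value_int s s' : t <= s -> s <= s' -> s' < T ->
  \int[P]_w (alive s w * value s' w) =
  L (fun v => fine (P (below W g t s `&` [set w | v <= W T w]))).
Proof.
move=> ts ss sT; rewrite Rintegral_indic_mul; last first.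
  by apply: (measurable_below hW hg) => //; lra.
exact: (tame_below hW hg Lt).
Qed.

Let grid_le r N i : t <= r -> grid r N i <= grid r N i.+1.
Proof. by move=> tr; rewrite -subr_ge0 grid_step divr_ge0// subr_ge0. Qed.

Let grid_lt r N i : t <= r -> r < T -> (i <= N.+1)%N -> grid r N i < T.
Proof.
by move=> tr rT iN; apply: le_lt_trans rT; have /andP[] := grid_in tr iN.
Qed.

Let grid_ge r N i : t <= r -> (i <= N.+1)%N -> t <= grid r N i.
Proof. by move=> tr iN; have /andP[] := grid_in tr iN. Qed.

Let step r N i w : R := (alive (grid r N i) w - alive (grid r N i.+1) w) * value (grid r N i.+1) w.

Let step_integral r N i : t <= r -> r < T -> (i < N.+1)%N ->
  P.-integrable setT (EFin \o step r N i) /\ \int[P]_w step r N i w =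
  L (fun v => fine (P (below W g t (grid r N i) `&` [set w | v <= W T w]))) -
  L (fun v => fine (P (below W g t (grid r N i.+1) `&` [set w | v <= W T w]))).
Proof.
move=> tr rT iN.
have h1 := grid_ge tr (ltnW iN); have h2 := grid_le N i tr.
have h3 := grid_ge tr iN; have h4 := grid_lt tr rT iN.
have i1 := integrable_alive_value h1 h2 h4.
have i2 := integrable_alive_value h3 (lexx _) h4.
have e : step r N i = (fun w => alive (grid r N i) w * value (grid r N i.+1) w -
   alive (grid r N i.+1) w * value (grid r N i.+1) w).
  by apply/funext => w; rewrite /step mulrBl.
rewrite e; split; first exact: (integrableB measurableT i1 i2).
by rewrite RintegralB// alive_value_int// alive_value_int.
Qed.

(** Optional stopping: on each grid step the martingale property turns the
    integral into a difference, and the sum telescopes. *)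
Lemma stopped_integral r N : t <= r -> r < T ->
  \int[P]_w stopped r N w = \int[P]_(w in below W g t t) value t w.
Proof.
move=> tr rT.
have sum_int m : (m <= N.+1)%N ->
    P.-integrable setT (EFin \o (fun w => \sum_(i < m) step r N i w)) /\
    \int[P]_w (\sum_(i < m) step r N i w) =
    L (fun v => fine (P (below W g t t `&` [set w | v <= W T w]))) -
    L (fun v => fine (P (below W g t (grid r N m) `&` [set w | v <= W T w]))).
  elim: m => [_|m IH mN].
    rewrite grid0 subrr.
    have -> : (fun w => \sum_(i < 0) step r N i w) = (fun=> 0).
      by apply/funext => w; rewrite big_ord0.
    split; last by rewrite Rintegral_cst// mul0r.
    by apply: (@integrable_bounded _ _ _ P _ _ 0) => // w _; rewrite normr0.
  have [i1 e1] := IH (ltnW mN); have [i2 e2] := step_integral tr rT mN.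
  have -> : (fun w => \sum_(i < m.+1) step r N i w) =
    (fun w => \sum_(i < m) step r N i w + step r N m w).
    by apply/funext => w; rewrite big_ord_recr.
  split; first exact: (integrableD measurableT i1 i2).
  by rewrite RintegralD// e1 e2; ring.
have [i1 e1] := sum_int N.+1 (leqnn _).
rewrite /stopped RintegralD//; last exact: integrable_alive_value.
rewrite e1 gridN alive_value_int// subrK.
by rewrite (tame_below hW hg Lt t0 (lexx t) (lexx t) (le_lt_trans tr rT)).
Qed.

Lemma measurable_stopped r N : t <= r -> r < T -> measurable_fun setT (stopped r N).
Proof.
move=> tr rT; apply: measurable_funD.
  apply: measurable_sum => i; have iN := ltn_ord i.
  apply: measurable_funM; last by apply: measurable_value; exact: grid_lt.
  have h1 := grid_lt tr rT (ltnW iN); have h2 := grid_lt tr rT iN.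
  by apply: measurable_funB; apply: measurable_alive; rewrite ?(ltW h1) ?(ltW h2) ?grid_ge// ltnW.
by apply: measurable_funM; [apply: measurable_alive => //; exact: ltW|exact: measurable_value].
Qed.

Let alive_telescope r N w : \sum_(i < N.+1) (alive (grid r N i) w - alive (grid r N i.+1) w) =
  alive t w - alive r w.
Proof.
rewrite -(big_mkord xpredT (fun i => alive (grid r N i) w - alive (grid r N i.+1) w)).
have := telescope_sumr (fun i => - alive (grid r N i) w) (leq0n N.+1).
rewrite gridN grid0 opprK addrC => <-.
by apply: eq_bigr => i _; rewrite opprK addrC.
Qed.

Let alive_step_ge0 r N i w : t <= r -> 0 <= alive (grid r N i) w - alive (grid r N i.+1) w.
Proof. by move=> tr; rewrite subr_ge0 alive_le// grid_le. Qed.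

Lemma stopped_bounded r : t <= r -> r < T -> exists C, forall N w, `|stopped r N w| <= C.
Proof.
move=> tr rT; have [C C0 HC] := value_bounded rT; exists (C + C) => N w.
apply: (le_trans (ler_normD _ _)); apply: lerD.
  apply: (le_trans (ler_norm_sum _ _ _)).
  apply: (@le_trans _ _ (\sum_(i < N.+1) (alive (grid r N i) w - alive (grid r N i.+1) w) * C)).
    apply: ler_sum => i _; rewrite normrM ger0_norm ?alive_step_ge0// ler_wpM2l ?alive_step_ge0//.
    by apply: HC; have /andP[] := grid_in tr (ltn_ord i).
  rewrite -mulr_suml alive_telescope -[leRHS]mul1r ler_wpM2r//.
  by have := alive01 t w; have := alive01 r w; lra.
rewrite normrM -[leRHS]mul1r; have /andP[h1 h2] := alive01 r w.
by rewrite (ger0_norm h1) ler_pM// HC.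
Qed.

(** The martingale stopped at the boundary or at time r, on the paths that
    start below the boundary. *)
Definition hitting_value r w : R :=
  if `[< below W g t r w >] then value r w
  else if W t w < g t then value (hitting_time T (W ^~ w) g t) w else 0.

(** The grid time that follows the hitting time tends to it as the mesh does
    to 0, and the value is continuous along the path. *)
Lemma stopped_cvg r w : t <= r -> r < T -> stopped r N w @[N --> \oo] --> hitting_value r w.
Proof.
move=> tr rT; rewrite /hitting_value; case: asboolP => [br|nbr].
  have al s : t <= s <= r -> alive s w = 1.
    move=> /andP[ts sr]; rewrite aliveE ifT//; apply/asboolP => y /andP[ty ys].
    by apply: br; rewrite ty (le_trans ys).
  rewrite (_ : (fun N => stopped r N w) = (fun=> value r w)); first exact: cvg_cst.
  apply/funext => N; rewrite /stopped al ?lexx ?tr// mul1r big1 ?add0r// => i _.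
  by rewrite !al ?subrr ?mul0r//; apply: grid_in => //; exact: ltnW.
case: ifPn => [Wt|]; last first.
  rewrite -leNgt => Wt.
  have al s : t <= s -> alive s w = 0.
    move=> ts; rewrite aliveE ifF//; apply/negbTE/asboolPn => /(_ t).
    by rewrite lexx ts ltNge Wt => /(_ isT).
  rewrite (_ : (fun N => stopped r N w) = (fun=> 0)); first exact: cvg_cst.
  apply/funext => N; rewrite /stopped al// mul0r addr0 big1// => i _.
  by rewrite !al ?subrr ?mul0r//; [exact: grid_ge|apply: grid_ge => //; exact: ltnW].
set tau := hitting_time _ _ _ _.
have cxg : {within `[0, T], continuous (fun s => W s w - g s)}.
  exact: (@brownian_boundary_continuous _ _ _ P W hW T g hg w 0 T (lexx 0) (lexx T)).
have [/andP[ttau taur] _ _] := hitting_timeP cxg t0 (ltW rT) nbr.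
have al s : t <= s -> alive s w = if s < tau then 1 else 0.
  move=> ts; rewrite aliveE; have [h1 h2] := below_hitting_time cxg t0 (ltW rT) ts nbr.
  by case: asboolP => [/h1 ->//|h]; case: ifPn => // /h2.
have ar : alive r w = 0 by rewrite al// ltNge taur.
have at1 : alive t w = 1.
  have [tt _] := hitting_time_eq cxg t0 (ltW rT) Wt nbr.
  by rewrite al ?tt.
apply/cvgrPdist_le => /= e e0.
have tauT : 0 <= tau < T by rewrite (le_trans t0 ttau) (le_lt_trans taur).
have [dl dl0 H] := value_continuous w tauT e0.
near=> N.
have mesh : (r - t) / N.+1%:R < dl.
  rewrite ltr_pdivrMr// mulrC -ltr_pdivrMr//.
  have := archi_boundP (divr_ge0 (_ : 0 <= r - t) (ltW dl0)); rewrite subr_ge0 => /(_ tr) hb.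
  apply: (lt_le_trans hb); rewrite ler_nat; apply: leqW.
  by near: N; exact: nbhs_infty_ge.
have -> : value tau w - stopped r N w =
   - \sum_(i < N.+1) (alive (grid r N i) w - alive (grid r N i.+1) w) *
      (value (grid r N i.+1) w - value tau w).
  rewrite /stopped ar mul0r addr0.
  under [in RHS]eq_bigr do rewrite mulrBr.
  by rewrite sumrB -mulr_suml alive_telescope ar at1 subr0 mul1r opprB.
rewrite normrN; apply: (le_trans (ler_norm_sum _ _ _)).
apply: (@le_trans _ _ (\sum_(i < N.+1) (alive (grid r N i) w - alive (grid r N i.+1) w) * e)).
  apply: ler_sum => i _; rewrite normrM ger0_norm ?alive_step_ge0//.
  have g1 := grid_ge tr (ltnW (ltn_ord i)); have g2 := grid_ge tr (ltn_ord i).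
  rewrite (al _ g1) (al _ g2).
  have st := grid_step r N i.
  have [i1|i1] := ltP (grid r N i) tau; have [i2|i2] := ltP (grid r N i.+1) tau;
    rewrite ?subrr ?sub0r ?subr0 ?mul0r ?mul1r//.
  - apply/ltW/H; first exact: le_trans g2.
    have mesh' : grid r N i.+1 - grid r N i < dl by rewrite st.
    by rewrite ger0_norm ?subr_ge0//; lra.
  - by have := grid_le N i tr; lra.
by rewrite -mulr_suml alive_telescope ar at1 subr0 mul1r.
Unshelve. all: by end_near. Qed.

Lemma hitting_value_integral r : t <= r -> r < T ->
  measurable_fun setT (hitting_value r) /\
  \int[P]_w hitting_value r w = \int[P]_(w in below W g t t) value t w.
Proof.
move=> tr rT; have [C HC] := stopped_bounded tr rT.
have PT : (P setT < +oo)%E by rewrite probability_setT ltry.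
have [m c] := @bounded_convergence _ _ _ P setT (stopped r) (hitting_value r) C measurableT PT
   (fun N => measurable_stopped N tr rT) (fun N w _ => HC N w)
   (fun w _ => @stopped_cvg r w tr rT).
split => //; apply: (cvg_unique _ c) => //.
rewrite /= (_ : (fun n => _) = (fun=> \int[P]_(w in below W g t t) value t w)).
  exact: cvg_cst.
by apply/funext => N; exact: stopped_integral.
Qed.

End stopping.

(** * Passage to the terminal time and to the limit functional *)

Section boundary_limit.
Context {R : realType} {d : measure_display} {Omega : measurableType d}.
Variables (P : probability Omega R) (W : R -> {RV P >-> R}).
Hypothesis hW : standard_brownian_motion W.
Variables (T : R) (g : R -> R).
Hypothesis hg : {within `[0, T], continuous g}.
Variable t : R.
Hypothesis t0 : 0 <= t.
Hypothesis tT : t < T.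
Implicit Types (s r : R) (w : Omega).

Lemma brownian_point_null s x : 0 < s -> P (W s @^-1` [set x]) = 0%E.
Proof.
move=> s0; rewrite (brownian_law hW s0)//.
have /null_content_dominatesP := @normal_prob_dominates R 0 (Num.sqrt s).
by apply => //; exact: lebesgue_measure_set1.
Qed.

Let offT : set Omega := ~` (W T @^-1` [set g T]).

Let mN : measurable (W T @^-1` [set g T]).
Proof. by rewrite -[X in measurable X]setTI; exact: measurable_brownian. Qed.

Let moffT : measurable offT.
Proof. exact: measurableC. Qed.

Let T0 : 0 < T.
Proof. by apply: le_lt_trans tT. Qed.

Let Rintegral_offT (h : Omega -> R) (C : R) : measurable_fun setT h ->
  (forall w, `|h w| <= C) -> \int[P]_(w in offT) h w = \int[P]_w h w.
Proof.
move=> mh hC; have ih : P.-integrable setT (EFin \o h).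
  by apply: (@integrable_bounded _ _ _ P _ _ C).
rewrite /Rintegral [in RHS](negligible_integral mN measurableT ih); last exact: brownian_point_null.
by rewrite setTD.
Qed.

Let time (m : nat) : R := T - (T - t) * harmonic m.

Let time_lt m : time m < T.
Proof.
by rewrite /time ltrBlDr ltrDl mulr_gt0 ?subr_gt0// /harmonic/= invr_gt0.
Qed.

Let time_ge m : t <= time m.
Proof.
have h1 : harmonic m <= 1 :> R by rewrite /harmonic/= invf_le1 ?ler1n.
have h2 : 0 <= T - t by rewrite subr_ge0 ltW.
have := ler_piMr h2 h1; rewrite /time; move: (_ * _) => z; lra.
Qed.

Let time_cvg : time m @[m --> \oo] --> T.
Proof.
rewrite -[X in _ --> X]subr0; apply: cvgB; first exact: cvg_cst.
by rewrite -[X in _ --> X](mulr0 (T - t)); apply: cvgMl_tmp; exact: cvg_harmonic.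
Qed.

Section one_functional.
Variables (L : (R -> R) -> R) (c : R).
Hypothesis Lt : tame L (g T).
Hypothesis Lc : forall r x, t <= r < T -> x <= g r -> `|potential L 0 x (T - r)| <= c.

Let cxg w : {within `[0, T], continuous (fun s => W s w - g s)}.
Proof.
exact: (@brownian_boundary_continuous _ _ _ P W hW T g hg w 0 T (lexx 0) (lexx T)).
Qed.

Let hit w : R := hitting_time T (W ^~ w) g t.

Let c0 : 0 <= c.
Proof.
by apply: (le_trans (normr_ge0 _) (Lc (r := t) (x := g t) _ (lexx _))); rewrite lexx.
Qed.

Let hitting_value_bounded r w : t <= r -> r < T ->
  `|hitting_value W T g L t r w| <= c.
Proof.
move=> tr rT; rewrite /hitting_value; case: asboolP => [br|nbr].
  by apply: Lc; rewrite ?tr//; apply/ltW/br; rewrite tr lexx.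
case: ifPn => [Wt|_]; last by rewrite normr0.
have [/andP[h1 h2] _ _] := hitting_timeP (@cxg w) t0 (ltW rT) nbr.
have [_ e] := hitting_time_eq (@cxg w) t0 (ltW rT) Wt nbr.
by apply: Lc; [rewrite h1 (le_lt_trans h2)|rewrite e].
Qed.

(** The limit of hitting_value as r tends to T, for a path that does not end
    on the boundary. *)
Definition boundary_value w : R :=
  if `[< below W g t T w >] then 0
  else if W t w < g t then potential L 0 (g (hit w)) (T - hit w) else 0.

(** A path that ends below g T keeps, near the time T, to the left of the
    support of L, and there the potential tends to 0 as the remaining time
    does. *)
Lemma boundary_value_cvg w : W T w != g T ->
  hitting_value W T g L t (time m) w @[m --> \oo] --> boundary_value w.
Proof.
move=> WT; rewrite /boundary_value; case: asboolP => [bT|nbT].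
  have b m : below W g t (time m) w.
    by move=> s /andP[ts sm]; apply: bT; rewrite ts (le_trans sm)// ltW.
  have WTg : W T w < g T by apply: bT; rewrite (ltW tT) lexx.
  (* with this e one has W T w = g T - 4 e, and by continuity W s w <= g T - 2 e near T *)
  pose e := (g T - W T w) / 4.
  have e0 : 0 < e by rewrite divr_gt0// subr_gt0.
  have [C C0 HC] := potential_small Lt e0.
  have TI : `[0, +oo[%classic T by rewrite /= in_itv/= ltW.
  have e20 : 0 < 2 * e by lra.
  have [dl dl0 H] := within_continuousP (@brownian_path _ _ _ P W hW w) TI e20.
  have sq0 : C * Num.sqrt (T - time m) @[m --> \oo] --> 0.
    rewrite -[X in _ --> X](mulr0 C); apply: cvgMl_tmp.
    rewrite -[X in _ --> X]sqrtr0 -[X in Num.sqrt X](subrr T).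
    apply: (@cvg_comp _ _ _ (fun m => T - time m) Num.sqrt _ _ _ _ (@sqrt_continuous R (T - T))).
    by apply: cvgB; [exact: cvg_cst|exact: time_cvg].
  apply: norm_cvg0; apply: (squeeze_cvgr _ (cvg_cst 0) sq0).
  near=> m; rewrite normr_ge0 /=.
  rewrite /hitting_value ifT; last exact/asboolP/b.
  apply: HC; first by rewrite subr_gt0 time_lt.
  have tm : `|time m - T| < dl.
    by rewrite distrC; near: m; move: time_cvg => /cvgrPdist_lt; apply.
  have tm0 : `[0, +oo[%classic (time m) by rewrite /= in_itv/= andbT (le_trans t0 (time_ge m)).
  have := H _ tm0 tm; rewrite ltr_distl => /andP[_ h].
  by apply: ltW; apply: (lt_le_trans h); rewrite /e; lra.
case: ifPn => [Wt|Wt].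
  have [/andP[h1 h2] _ _] := hitting_timeP (@cxg w) t0 (lexx T) nbT.
  have [h3 h4] := hitting_time_eq (@cxg w) t0 (lexx T) Wt nbT.
  have hT : hit w < T.
    rewrite lt_neqAle h2 andbT; apply/eqP => e; move: h4; rewrite -/(hit w) e => h4.
    by rewrite h4 eqxx in WT.
  apply: cvg_near_cst; near=> m.
  rewrite /hitting_value ifF; last first.
    apply/negbTE/asboolPn => bm.
    have hm : hit w <= time m by near: m; move: time_cvg => /cvgr_ge; apply.
    by have := bm (hit w); rewrite h1 hm h4 ltxx => /(_ isT).
  by rewrite Wt -/(hit w) h4.
apply: cvg_near_cst; near=> m.
rewrite /hitting_value (negbTE Wt) ifF//; apply/negbTE/asboolPn => /(_ t).
by rewrite lexx time_ge (negbTE Wt) => /(_ isT).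
Unshelve. all: by end_near. Qed.

Lemma boundary_value_bounded w : W T w != g T -> `|boundary_value w| <= c.
Proof.
move=> WT; rewrite /boundary_value; case: asboolP => [_|nbT]; first by rewrite normr0.
case: ifPn => [Wt|_]; last by rewrite normr0.
have [/andP[h1 h2] _ _] := hitting_timeP (@cxg w) t0 (lexx T) nbT.
have [h3 h4] := hitting_time_eq (@cxg w) t0 (lexx T) Wt nbT.
apply: Lc => //; rewrite h1 lt_neqAle h2 andbT; apply/eqP => e.
by move: h4; rewrite -/(hit w) e => h4; rewrite h4 eqxx in WT.
Qed.

Lemma boundary_value_integral : measurable_fun offT boundary_value /\
  \int[P]_(w in offT) boundary_value w =
  \int[P]_(w in below W g t t) potential L 0 (W t w) (T - t).
Proof.
have hv m := hitting_value_integral hW hg Lt t0 (time_ge m) (time_lt m).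
have Poff : (P offT < +oo)%E by rewrite ltey_eq fin_num_measure.
have [m cv] := @bounded_convergence _ _ _ P offT (fun m => hitting_value W T g L t (time m))
  boundary_value c moffT Poff
  (fun m => measurable_funTS (hv m).1)
  (fun m w _ => @hitting_value_bounded (time m) w (time_ge m) (time_lt m))
  (fun w (ow : offT w) => boundary_value_cvg (introN eqP ow)).
split => //; apply: (cvg_unique _ cv) => //.
rewrite /= (_ : (fun n => _) = (fun=> \int[P]_(w in below W g t t) potential L 0 (W t w) (T - t))).
  exact: cvg_cst.
apply/funext => n; rewrite -(hv n).2; apply: (Rintegral_offT (hv n).1) => w.
exact: hitting_value_bounded.
Qed.

End one_functional.

Variables (L : nat -> (R -> R) -> R) (c : R).
Hypothesis Lt : forall n, tame (L n) (g T).
Hypothesis Lc : forall n r x, t <= r < T -> x <= g r -> `|potential (L n) 0 x (T - r)| <= c.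
Hypothesis L1 : forall r, t <= r < T ->
  potential (L n) 0 (g r) (T - r) @[n --> \oo] --> (1 : R).

(** On the boundary the potential tends to 1 with n, so the stopped martingale
    tends to the indicator of the paths that start below the boundary and
    reach it before T. *)
Lemma potential_integral_cvg :
  \int[P]_(w in below W g t t) potential (L n) 0 (W t w) (T - t) @[n --> \oo] -->
  fine (P (below W g t t)) - fine (P (below W g t T)).
Proof.
have mT : measurable (below W g t T) by apply: (measurable_below hW hg) => //; exact: ltW.
have mt : measurable (below W g t t) by apply: (measurable_below hW hg) => //; exact: ltW.
have cxg w : {within `[0, T], continuous (fun s => W s w - g s)}.
  exact: (@brownian_boundary_continuous _ _ _ P W hW T g hg w 0 T (lexx 0) (lexx T)).
have sub : below W g t T `<=` below W g t t.
  by move=> w b s /andP[ts st]; apply: b; rewrite ts (le_trans st)// ltW.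
pose D := below W g t t `\` below W g t T.
have mD : measurable D by exact: measurableD.
have bv n := boundary_value_integral (Lt n) (Lc n).
have Poff : (P offT < +oo)%E by rewrite ltey_eq fin_num_measure.
have [|m cv] := @bounded_convergence _ _ _ P offT (fun n => boundary_value (L n)) (\1_D) c
  moffT Poff (fun n => (bv n).1)
  (fun n w (ow : offT w) => boundary_value_bounded (Lc n) (introN eqP ow)).
  move=> w ow; rewrite /boundary_value indicE; case: asboolP => [bT|nbT].
    by rewrite memNset//; [exact: cvg_cst|case].
  case: (boolP (W t w < g t)) => Wt.
    rewrite mem_set; last first.
      by split => // s /andP[ts st]; rewrite (_ : s = t)//; apply/eqP; rewrite eq_le ts st.
    have [/andP[h1 h2] _ _] := hitting_timeP (@cxg w) t0 (lexx T) nbT.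
    have [h3 h4] := hitting_time_eq (@cxg w) t0 (lexx T) Wt nbT.
    apply: L1; rewrite h1 lt_neqAle h2 andbT; apply/eqP => e.
    by apply: ow; move: h4; rewrite e.
  rewrite memNset; first exact: cvg_cst.
  by move=> [/(_ t) + _]; rewrite lexx (negbTE Wt) => /(_ isT).
have e : \int[P]_(w in offT) \1_D w = fine (P (below W g t t)) - fine (P (below W g t T)).
  rewrite (@Rintegral_offT _ 1)//; last by move=> w; rewrite indicE; case: (_ \in _); rewrite ?normr1 ?normr0 ?ler01.
  rewrite /Rintegral integral_indic// setIT measureD//; last by rewrite ltey_eq fin_num_measure.
  by rewrite setIidr// fineB//; exact: fin_num_measure.
rewrite -e; move: cv; rewrite (_ : (fun n => \int[P]_(y in offT) boundary_value (L n) y) =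
  (fun n => \int[P]_(w in below W g t t) potential (L n) 0 (W t w) (T - t)))//.
by apply/funext => n; exact: (bv n).2.
Qed.

End boundary_limit.

(** * The law of the last passage time *)

Section brownian_marginal.
Context {R : realType} {d : measure_display} {Omega : measurableType d}.
Variables (P : probability Omega R) (W : R -> {RV P >-> R}).
Hypothesis hW : standard_brownian_motion W.
Local Notation leb := (@lebesgue_measure R).
Implicit Types (t z : R).

Lemma brownian_lt t z : 0 < t -> P [set w | W t w < z] = (heat 0 z t)%:E.
Proof.
move=> t0; rewrite -normal_prob_itv_ninfty// -(brownian_law hW)//.
have mz : measurable (W t @^-1` [set z]).
  exact: measurable_brownian_preimage.
have ml : measurable [set w | W t w < z].
  rewrite (_ : [set w | _] = W t @^-1` `]-oo, z[); last first.
    by apply/seteqP; split => w; rewrite /= in_itv.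
  by rewrite -[X in measurable X]setTI; apply: measurable_brownian.
rewrite (_ : W t @^-1` _ = [set w | W t w < z] `|` W t @^-1` [set z]).
  by rewrite measureU0//; exact: brownian_point_null.
apply/seteqP; split => w; rewrite /= in_itv/= le_eqVlt.
  by case/orP => [/eqP|]; [right|left].
by case=> [->|->]; rewrite ?orbT ?eqxx.
Qed.

Lemma brownian_integral t z (f : R -> R) (C : R) : 0 < t -> continuous f ->
  (forall x, `|f x| <= C) ->
  \int[P]_(w in [set w | W t w < z]) f (W t w) =
  \int[leb]_(x in `]-oo, z]) (f x * heat 1 x t).
Proof.
move=> t0 cf fC; have mf : measurable_fun setT f by exact: continuous_measurable_fun.
have mW := @measurable_brownian _ _ _ P W t.
have mI : measurable [set` `]-oo, z[] by exact: measurable_itv.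
have preE : [set w | W t w < z] = W t @^-1` `]-oo, z[.
  by apply/seteqP; split => w; rewrite /= in_itv.
have mpre : measurable (W t @^-1` `]-oo, z[).
  exact: measurable_brownian_preimage.
rewrite preE /Rintegral -[in LHS](@integral_pushforward _ _ _ (measurableTypeR R) _ _ mW P _ (EFin \o f))//; last 2 first.
- exact/measurable_EFinP.
- apply: (@integrable_bounded _ _ _ P _ _ C) => //.
  by apply: measurable_funTS; exact: measurableT_comp.
congr fine.
transitivity (\int[normal_prob 0 (Num.sqrt t)]_(x in `]-oo, z[) (EFin \o f) x)%E.
  by apply: eq_measure_integral => A mA _; exact: brownian_law.
rewrite integral_normal_prob//.
- rewrite integral_itv_bndo_bndc; last first.
    apply: emeasurable_funM; first by apply/measurable_EFinP; exact: measurable_funTS.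
    by apply/measurable_EFinP/measurable_funTS; exact: measurable_normal_pdf.
  by apply: eq_integral => x _; rewrite /= normal_pdf_heat.
- by apply/measurable_EFinP; exact: measurable_funTS.
- have := @integrable_bounded _ _ _ (normal_prob 0 (Num.sqrt t)) [set` `]-oo, z[] f C mI.
  move=> /(_ (measurable_funTS mf) (fun x _ => fC x)) /integrableP[_].
  by [].
Qed.

End brownian_marginal.

Section last_passage_law.
Context {R : realType} {d : measure_display} {Omega : measurableType d}.
Variables (P : probability Omega R) (W : R -> {RV P >-> R}).
Hypothesis hW : standard_brownian_motion W.
Variables (T : R) (g : R -> R).
Hypothesis T0 : 0 < T.
Hypothesis hg : {within `[0, T], continuous g}.
Implicit Types (t s : R) (w : Omega).

Let cxg w : {within `[0, T], continuous (fun s => W s w - g s)}.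
Proof.
exact: (@brownian_boundary_continuous _ _ _ P W hW T g hg w 0 T (lexx 0) (lexx T)).
Qed.

Lemma last_passage_leP t w : 0 < t ->
  last_passage W g T w <= t <-> forall s, t < s <= T -> W s w < g s.
Proof.
move=> t0; rewrite /last_passage; set S := [set s | _]; split => [h s /andP[ts sT]|h].
  rewrite ltNge; apply/negP => gW.
  have Ss : S s by split => //; rewrite (lt_trans t0 ts).
  have : s <= sup S.
    by apply: ub_le_sup => //; exists T => x [/andP[]].
  by move=> /le_trans/(_ h); rewrite leNgt ts.
have [->|/set0P S0] := eqVneq S set0; first by rewrite sup0 ltW.
apply: ge_sup => // s [/andP[s0 sT] gW].
by rewrite leNgt; apply/negP => ts; have := h s; rewrite ts sT ltNge gW => /(_ isT).
Qed.

Lemma last_passage_ltP w : last_passage W g T w < T <-> W T w < g T.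
Proof.
rewrite /last_passage; set S := [set s | _]; split => [h|WT].
  rewrite ltNge; apply/negP => gW.
  have : T <= sup S.
    by apply: ub_le_sup; [exists T => x [/andP[]]|split => //; rewrite T0 lexx].
  by rewrite leNgt h.
have e0 : 0 < g T - W T w by rewrite subr_gt0.
have TI : `[0, T]%classic T by rewrite /= in_itv/= (ltW T0) lexx.
have [dl dl0 H] := within_continuousP (@cxg w) TI e0.
have [->|/set0P S0] := eqVneq S set0; first by rewrite sup0.
apply: (@le_lt_trans _ _ (T - dl)); last by rewrite ltrBlDr ltrDl.
apply: ge_sup => // s [/andP[s0 sT] gW]; rewrite leNgt; apply/negP => sdl.
have sI : `[0, T]%classic s by rewrite /= in_itv/= (ltW s0).
have := H s sI; rewrite !ltr_distl => h.
have /h/andP[_] : T - dl < s < T + dl by apply/andP; split; lra.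
lra.
Qed.

Lemma last_passage_lt_law : P [set w | last_passage W g T w < T] = (heat 0 (g T) T)%:E.
Proof.
rewrite -(brownian_lt hW)//; congr (P _).
by apply/seteqP; split => w /last_passage_ltP.
Qed.

(** By continuity a path that is below the boundary at all times after t is at
    most at the boundary at time t, so the two events differ by a part of the
    null event W_t = g t. *)
Lemma last_passage_le_law t : 0 < t < T ->
  P [set w | last_passage W g T w <= t] = P (below W g t T).
Proof.
move=> /andP[t0 tT]; set E := [set w | _].
have mb s : t <= s -> s <= T -> measurable (below W g s T).
  by move=> ts sT; apply: (measurable_below hW hg) => //; lra.
pose time (m : nat) := t + (T - t) * harmonic m.
have hb m : 0 < (T - t) * harmonic m <= T - t.
  have h1 : harmonic m <= 1 :> R by rewrite /harmonic/= invf_le1 ?ler1n.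
  have h2 : 0 < harmonic m :> R by rewrite /harmonic/= invr_gt0.
  have h3 : 0 < T - t by rewrite subr_gt0.
  by rewrite mulr_gt0//= ler_piMr// ltW.
have EE : E = \bigcap_m below W g (time m) T.
  apply/seteqP; split => w.
    move=> /(last_passage_leP w t0) h m _ s /andP[ms sT]; apply: h.
    by rewrite sT andbT (lt_le_trans _ ms)// /time; have := hb m; lra.
  move=> h; apply/(last_passage_leP w t0) => s /andP[ts sT].
  have st : 0 < s - t by rewrite subr_gt0.
  have : (T - t) * harmonic m @[m --> \oo] --> (0 : R).
    by rewrite -[X in _ --> X](mulr0 (T - t)); apply: cvgMl_tmp; exact: cvg_harmonic.
  move=> /cvgr_lt/(_ _ st)[m _ /(_ m (leqnn m)) /= hm].
  apply: (h m I s); rewrite sT andbT /time; move: (_ * _) hm => z; lra.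
have mE : measurable E.
  rewrite EE; apply: bigcap_measurableType => m _; apply: mb; have := hb m; rewrite /time;
  move: (_ * _) => z; lra.
have mN : measurable (W t @^-1` [set g t]).
  exact: measurable_brownian_preimage.
have mbt := mb t (lexx t) (ltW tT).
apply/eqP; rewrite eq_le; apply/andP; split.
  rewrite -[leRHS](measureU0 mbt mN (brownian_point_null hW (g t) t0)).
  apply: le_measure; rewrite ?inE//; first exact: measurableU.
  move=> w /(last_passage_leP w t0) h.
  have [Wt|Wt] := ltP (W t w) (g t).
    left=> s /andP[]; rewrite le_eqVlt => /predU1P[<-//|ts sT].
    by apply: h; rewrite ts.
  right; apply/eqP; rewrite eq_le Wt andbT leNgt; apply/negP => gW.
  have e0 : 0 < W t w - g t by rewrite subr_gt0.
  have tI : `[0, T]%classic t by rewrite /= in_itv/= (ltW t0) ltW.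
  have [dl dl0 H] := within_continuousP (@cxg w) tI e0.
  pose s := Num.min T (t + dl / 2).
  have sT : s <= T by rewrite /s ge_min lexx.
  have ts : t < s by rewrite /s lt_min tT; lra.
  have sdl : s <= t + dl / 2 by rewrite /s ge_min lexx orbT.
  have sI : `[0, T]%classic s by rewrite /= in_itv/= sT andbT; lra.
  have := H s sI; rewrite !ltr_distl => H'.
  have /H'/andP[+ _] : t - dl < s < t + dl by apply/andP; split; lra.
  by have := h s; rewrite ts sT => /(_ isT); lra.
apply: le_measure; rewrite ?inE// => w b; apply/(last_passage_leP w t0) => s /andP[ts sT].
by apply: b; rewrite (ltW ts).
Qed.

Lemma below_point t : below W g t t = [set w | W t w < g t].
Proof.
apply/seteqP; split => w /=; first by apply; rewrite lexx.
by move=> h s /andP[ts st]; rewrite (_ : s = t)//; apply/eqP; rewrite eq_le ts st.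
Qed.

Lemma below_point_law t : 0 < t -> P (below W g t t) = (heat 0 (g t) t)%:E.
Proof.
by move=> t0; rewrite below_point brownian_lt.
Qed.

Lemma potential_integral (L : (R -> R) -> R) (a t : R) : tame L a -> 0 < t < T ->
  \int[P]_(w in below W g t t) potential L 0 (W t w) (T - t) =
  \int[@lebesgue_measure R]_(x in `]-oo, g t]) (potential L 0 x (T - t) * heat 1 x t).
Proof.
move=> Lt /andP[t0 tT]; have Tt : 0 < T - t by rewrite subr_gt0.
have [C C0 HC] := potential_bounded Lt 0 Tt.
rewrite below_point.
apply: (@brownian_integral _ _ _ P W hW t (g t) (fun x => potential L 0 x (T - t)) C) => //.
- by move=> x; exact: (is_derive_continuous (is_derive_potential Lt 0 x Tt)).
- by move=> x; exact: HC.
Qed.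

Lemma potential_integral_pairing (L : (R -> R) -> R) (a t : R) : tame L a -> 0 < t < T ->
  \int[P]_(w in below W g t t) potential L 0 (W t w) (T - t) =
  L (fun v => bivariate_normal_cdf (g t / Num.sqrt t) (- v / Num.sqrt T) (- Num.sqrt (t / T))).
Proof.
move=> Lt /[dup] tI /andP[t0 tT]; have Tt : 0 < T - t by rewrite subr_gt0.
have [C C0 HC] := heat_bounded 0 Tt.
have mb : measurable (below W g t t).
  by apply: (measurable_below hW hg) => //; exact: ltW.
rewrite -(@tame_integral _ _ _ P L a Lt (W t) (heat 0 ^~ (T - t))
   (@measurable_brownian _ _ _ P W t) (bsmooth_heat 0 Tt) _ mb).
congr L; apply/funext => v; rewrite bivariate_normal_heat//.
rewrite below_point.
apply: (@brownian_integral _ _ _ P W hW t (g t) (fun x => heat 0 (x - v) (T - t)) C) => //.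
- move=> x; apply: differentiable_continuous; apply/derivable1_diffP.
  have := is_derive_affine (is_derive_heat 0 (1 * x + (- v)) (T - t)).
  rewrite (_ : (fun x => heat 0 (1 * x + - v) (T - t)) = (fun x => heat 0 (x - v) (T - t))).
    by case.
  by apply/funext => y; rewrite mul1r.
- by move=> x; exact: HC.
Qed.

End last_passage_law.

(** * Differentiation in time *)

Section gaussian_primitive.
Context {R : realType}.
Local Notation leb := (@lebesgue_measure R).
Variable tau : R.
Hypothesis tau0 : 0 < tau.
Implicit Types (F G : R -> R) (C x : R) (A : set (measurableTypeR R)).

Lemma heat1_ge0 x : 0 <= heat 1 x tau.
Proof. by rewrite -normal_pdf_heat// normal_pdf_ge0. Qed.

Lemma integrable_heat1 A : measurable A -> leb.-integrable A (EFin \o heat 1 ^~ tau).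
Proof.
move=> mA; apply: (@integrableS _ _ _ _ setT) => //.
rewrite (_ : (fun x => _) = normal_pdf 0 (Num.sqrt tau)).
  exact: integrable_normal_pdf.
by apply/funext => x; rewrite normal_pdf_heat.
Qed.

Lemma Rintegral_heat1 x : \int[leb]_(y in `]-oo, x]) heat 1 y tau = heat 0 x tau.
Proof.
have := normal_prob_itv_ninfty x tau0; rewrite /normal_prob /= => h.
rewrite /Rintegral -[RHS]/(fine (heat 0 x tau)%:E) -h; congr fine.
by apply: eq_integral => y _; rewrite normal_pdf_heat.
Qed.

(** Enough to integrate from -oo, to differentiate the primitive and to make
    it vanish at -oo. *)
Definition gauss_dominated F C :=
  continuous F /\ forall x, `|F x| <= C * heat 1 x tau.

Lemma gauss_dominated_integrable F C A : measurable A -> gauss_dominated F C ->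
  leb.-integrable A (EFin \o F).
Proof.
move=> mA [cF FC]; have i1 := integrable_heat1 mA.
have h := @le_integrable _ _ _ leb A mA (EFin \o F) (EFin \o (fun x => C * heat 1 x tau)).
apply: h.
- by apply/measurable_EFinP/measurable_funTS; exact: continuous_measurable_fun.
- move=> x _; rewrite lee_fin; apply: (le_trans (FC x)); exact: ler_norm.
- by have := integrableZl mA C i1; apply: eq_integrable.
Qed.

Lemma gauss_dominated_primitive_bound F C x : gauss_dominated F C ->
  `|\int[leb]_(y in `]-oo, x]) F y| <= C * heat 0 x tau.
Proof.
move=> dF; have mA : measurable ([set` `]-oo, x]] : set (measurableTypeR R)) by exact: measurable_itv.
have iF := gauss_dominated_integrable mA dF.
apply: (le_trans (le_normr_Rintegral mA iF)).
have i1 := integrable_heat1 mA.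
rewrite -Rintegral_heat1 -RintegralZl//; apply: le_Rintegral => //.
- by have := integrable_abse iF.
- by have := integrableZl mA C i1; apply: eq_integrable.
- by move=> y _; exact: dF.2.
Qed.

Lemma is_derive_gauss_primitive F C x : gauss_dominated F C ->
  is_derive x 1 (fun x => \int[leb]_(y in `]-oo, x]) F y) (F x).
Proof.
move=> dF; have x1 : x < x + 1 by lra.
have [d1 d2] := @continuous_FTC1 R F -oo%O x (x + 1) x1
  (gauss_dominated_integrable (measurable_itv _) dF) (ltNyr x) (dF.1 x).
by rewrite -d2; exact: is_derive1.
Qed.

(** The fundamental theorem of calculus on a half line: the difference of the
    two sides has zero derivative and tends to 0 at -oo. *)
Lemma gauss_primitive_eq F G C (D : R) x : gauss_dominated F C ->
  (forall y : R, is_derive y 1 G (F y)) -> (forall y, `|G y| <= D * heat 1 y tau) ->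
  \int[leb]_(y in `]-oo, x]) F y = G x.
Proof.
move=> dF dG GD; pose H y := \int[leb]_(z in `]-oo, y]) F z - G y.
have Hc y : H y = H x.
  apply: is_derive_0_is_cst => z.
  by have := is_deriveB (is_derive_gauss_primitive z dF) (dG z); rewrite subrr.
apply/eqP; rewrite -subr_eq0 -/(H x) -normr_le0.
have s0 : 0 < Num.sqrt tau by rewrite sqrtr_gt0.
have [C0 C00 H0] := @gauss_derive_decay R 0 1.
have [C1 C10 H1] := @gauss_derive_decay R 1 1.
(* both terms of H are O(1 / |y|) at -oo, which excludes a nonzero constant *)
have key y : y < 0 -> `|y| * `|H y| <=
    `|C| * (C0 * Num.sqrt tau) + `|D| * C1.
  move=> y0; have y0' : y / Num.sqrt tau < 0 by rewrite pmulr_llt0// invr_gt0.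
  have := H0 _ y0'; have := H1 _ y0'; rewrite !expr1.
  have h0 := gauss_dominated_primitive_bound y dF.
  have h1 := GD y.
  have h2 := ler_normB (\int[leb]_(z in `]-oo, y]) F z) (G y); rewrite -/(H y) in h2.
  rewrite normrM (gtr0_norm (_ : 0 < (Num.sqrt tau)^-1)) ?invr_gt0//.
  have y1 : 0 <= `|y| by [].
  move=> k1 k0.
  have e0 : `|heat 0 y tau| * `|y| <= C0 * Num.sqrt tau.
    rewrite /heat expr0 mul1r -ler_pdivrMr//; move: k0; rewrite mulrC mulrA; exact.
  have e1 : `|heat 1 y tau| * `|y| <= C1.
    rewrite /heat expr1 normrM gtr0_norm ?invr_gt0//; move: k1; congr (_ <= _); ring.
  apply: (@le_trans _ _ (`|y| * (`|C| * `|heat 0 y tau| + `|D| * `|heat 1 y tau|))).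
    rewrite ler_wpM2l//; apply: (le_trans h2); apply: lerD.
      by apply: (le_trans h0); apply: (le_trans (ler_norm _)); rewrite normrM.
    by apply: (le_trans h1); apply: (le_trans (ler_norm _)); rewrite normrM.
  rewrite mulrDr; apply: lerD.
    by rewrite mulrCA ler_wpM2l// mulrC.
  by rewrite mulrCA ler_wpM2l// mulrC.
set K := _ + _ in key.
have K0 : 0 <= K by apply: le_trans (key (-1) _); rewrite ?mulr_ge0// oppr_lt0.
rewrite leNgt; apply/negP => Hx.
have := key (- (K / `|H x| + 1)); rewrite Hc normrN oppr_lt0.
have q0 : 0 <= K / `|H x| by rewrite divr_ge0.
have q1 : 0 < K / `|H x| + 1 by rewrite ltr_wpDl.
rewrite (gtr0_norm q1) q1 mulrDl mul1r divfK ?gt_eqF// => /(_ isT).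
by rewrite gerDl leNgt Hx.
Qed.

End gaussian_primitive.

Section crossing.
Context {R : realType}.
Local Notation leb := (@lebesgue_measure R).
Variables (T : R) (L : (R -> R) -> R) (a : R).
Hypothesis Lt : tame L a.
Implicit Types (w c t : R) (j : nat).

Definition crossing_density w t : R := heat 1 w t * (1 - potential L 0 w (T - t)).

(** Its derivative in w is the derivative of crossing_density in t: the factor
    heat 1 solves the forward heat equation and the factor 1 - potential 0 the
    backward one. *)
Definition crossing_flux w t : R :=
  2^-1 * (heat 2 w t * (1 - potential L 0 w (T - t)) + heat 1 w t * potential L 1 w (T - t)).

(** For c = g t this is the probability that W_t < g t minus the integral of
    the potential over that event; along a sequence of functionals whose
    potentials tend to 1 on the boundary it tends to P (last_passage <= t). *)
Definition crossing c t : R := \int[leb]_(w in `]-oo, c]) crossing_density w t.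

Let density_time w t : R :=
  2^-1 * (heat 3 w t * (1 - potential L 0 w (T - t)) + heat 1 w t * potential L 2 w (T - t)).

Let density_time2 w t : R :=
  2^-1 * (2^-1 * (heat 5 w t * (1 - potential L 0 w (T - t)) + heat 3 w t * potential L 2 w (T - t))
    + 2^-1 * (heat 3 w t * potential L 2 w (T - t) - heat 1 w t * potential L 4 w (T - t))).

Let density_space w t : R :=
  heat 2 w t * (1 - potential L 0 w (T - t)) - heat 1 w t * potential L 1 w (T - t).

Let dpot j w t : t < T ->
  is_derive w 1 (fun w => potential L j w (T - t)) (potential L j.+1 w (T - t)).
Proof. by move=> tT; apply: (is_derive_potential Lt); rewrite subr_gt0. Qed.

Let dpot1 w t : t < T ->
  is_derive w 1 (fun w => 1 - potential L 0 w (T - t)) (- potential L 1 w (T - t)).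
Proof.
move=> tT; have := is_deriveB (is_derive_cst (1 : R) w 1) (dpot 0 w tT).
by rewrite sub0r.
Qed.

Let dpott j w t : t < T ->
  is_derive t 1 (fun t => potential L j w (T - t)) (- (2^-1 * potential L j.+2 w (T - t))).
Proof.
move=> tT; have tE : -1 * t + T = T - t by ring.
have h := is_derive_potential_time Lt j w (_ : 0 < -1 * t + T).
have T0 : 0 < -1 * t + T by lra.
have := is_derive_affine (h T0); rewrite tE mulN1r.
by rewrite (_ : (fun t => _) = (fun t => potential L j w (T - t)))//; apply/funext => y; congr (potential _ _ _ _); ring.
Qed.

Let dpott1 w t : t < T ->
  is_derive t 1 (fun t => 1 - potential L 0 w (T - t)) (2^-1 * potential L 2 w (T - t)).
Proof.
move=> tT; have := is_deriveB (is_derive_cst (1 : R) t 1) (dpott 0 w tT).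
by rewrite sub0r opprK.
Qed.

Let is_derive_density_space w t : t < T ->
  is_derive w 1 (crossing_density ^~ t) (density_space w t).
Proof.
move=> tT; have h := is_deriveM' (is_derive_heat 1 w t) (dpot1 w tT).
by apply: (is_derive_eq h); rewrite /density_space; ring.
Qed.

Let is_derive_flux w t : t < T -> is_derive w 1 (crossing_flux ^~ t) (density_time w t).
Proof.
move=> tT; have h1 := is_deriveM' (is_derive_heat 2 w t) (dpot1 w tT).
have h2 := is_deriveM' (is_derive_heat 1 w t) (dpot 1 w tT).
have h := is_deriveM' (is_derive_cst (2^-1 : R) w 1) (is_deriveD h1 h2).
by apply: (is_derive_eq h); rewrite /density_time/=; ring.
Qed.

Let is_derive_density_time w t : 0 < t < T ->
  is_derive t 1 (crossing_density w) (density_time w t).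
Proof.
move=> /andP[t0 tT]; have h := is_deriveM' (is_derive_heat_time 1 w t0) (dpott1 w tT).
by apply: (is_derive_eq h); rewrite /density_time; ring.
Qed.

Let is_derive_density_time2 w t : 0 < t < T ->
  is_derive t 1 (density_time w) (density_time2 w t).
Proof.
move=> /andP[t0 tT]; have h1 := is_deriveM' (is_derive_heat_time 3 w t0) (dpott1 w tT).
have h2 := is_deriveM' (is_derive_heat_time 1 w t0) (dpott 2 w tT).
have h := is_deriveM' (is_derive_cst (2^-1 : R) t 1) (is_deriveD h1 h2).
by apply: (is_derive_eq h); rewrite /density_time2/=; ring.
Qed.

Let continuous_time w t : t < T -> {for w, continuous (density_time ^~ t)}.
Proof.
move=> tT; apply: differentiable_continuous; apply/derivable1_diffP.
have h1 := is_deriveM' (is_derive_heat 3 w t) (dpot1 w tT).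
have h2 := is_deriveM' (is_derive_heat 1 w t) (dpot 2 w tT).
by have [] := is_deriveM' (is_derive_cst (2^-1 : R) w 1) (is_deriveD h1 h2).
Qed.

Let continuous_density w t : t < T -> {for w, continuous (crossing_density ^~ t)}.
Proof.
by move=> tT; exact: (is_derive_continuous (is_derive_density_space w tT)).
Qed.

Section time_interval.
Variables p q : R.
Hypotheses (p0 : 0 < p) (pq : p <= q) (qT : q < T).

Let tau : R := 2 * q.

Let tau0 : 0 < tau. Proof. by rewrite mulr_gt0// (lt_le_trans p0). Qed.

Let h1_ge0 w : 0 <= heat 1 w tau. Proof. exact: heat1_ge0. Qed.

Let heat_dominated : exists2 C, 0 <= C &
  forall j w t, (j < 5)%N -> p <= t <= q -> `|heat j.+1 w t| <= C * heat 1 w tau.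
Proof.
have /choice[C HC] : forall j, exists C, 0 <= C /\
    forall w t, p <= t <= q -> `|heat j.+1 w t| <= C * heat 1 w tau.
  move=> j; have [C C0 HC] := heat_gauss_bound j q p0.
  have c0 : 0 < Num.sqrt tau * Num.sqrt (2 * pi) by rewrite mulr_gt0 ?sqrt2pi_gt0// sqrtr_gt0.
  (* the kernel of variance tau = 2 q has the exponent - w^2 / (4 q) of the bound *)
  exists (C * (Num.sqrt tau * Num.sqrt (2 * pi))); split; first by rewrite mulr_ge0// ltW.
  move=> w t tI; apply: (le_trans (HC w t tI)).
  rewrite heat1 /gauss_pdf -mulrA ler_wpM2l// mulrA -invfM mulrA mulfV ?gt_eqF// mul1r.
  rewrite expr_div_n sqr_sqrtr ?(ltW tau0)// /tau ler_expR le_eqVlt; apply/orP; left; apply/eqP.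
  have q0 : q != 0 by rewrite gt_eqF// (lt_le_trans p0).
  by field.
exists (\sum_(i < 5) C i); first by rewrite sumr_ge0// => i _; case: (HC i).
move=> j w t j5 tI; apply: (le_trans ((HC j).2 w t tI)); rewrite ler_wpM2r//.
rewrite (bigD1 (Ordinal j5))//= lerDl sumr_ge0// => i _; by case: (HC i).
Qed.

Let pot_bounded : exists2 D, 0 <= D & forall w t, t <= q ->
  `|1 - potential L 0 w (T - t)| <= D /\
  forall j, (j < 5)%N -> `|potential L j w (T - t)| <= D.
Proof.
have Tq : 0 < T - q by rewrite subr_gt0.
have /choice[C HC] : forall j, exists C, 0 <= C /\
    forall w t, T - q <= t -> `|potential L j w t| <= C.
  by move=> j; have [C C0 HC] := potential_bounded Lt j Tq; exists C.
have S0 : 0 <= \sum_(i < 5) C i by rewrite sumr_ge0// => i _; case: (HC i).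
have HS j : (j < 5)%N -> C j <= \sum_(i < 5) C i.
  move=> j5; rewrite (bigD1 (Ordinal j5))//= lerDl sumr_ge0// => i _; by case: (HC i).
exists (1 + \sum_(i < 5) C i); first by rewrite addr_ge0.
move=> w t tq; have Tt : T - q <= T - t by rewrite lerD2l lerN2.
have b j : (j < 5)%N -> `|potential L j w (T - t)| <= \sum_(i < 5) C i.
  by move=> j5; apply: le_trans (HS j j5); exact: (HC j).2.
split; first by apply: (le_trans (ler_normB _ _)); rewrite normr1 lerD2l; exact: b.
by move=> j j5; apply: (le_trans (b j j5)); rewrite lerDr.
Qed.

Let density_bounds : exists2 K, 0 <= K & forall w t, p <= t <= q ->
  [/\ `|crossing_density w t| <= K * heat 1 w tau,
      `|crossing_flux w t| <= K * heat 1 w tau,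
      `|density_time w t| <= K * heat 1 w tau,
      `|density_time2 w t| <= K * heat 1 w tau &
      `|density_space w t| <= 2 * K * heat 1 w tau].
Proof.
have [C C0 HC] := heat_dominated; have [D D0 HD] := pot_bounded.
exists (C * D); first exact: mulr_ge0.
move=> w t tI; have /andP[pt tq] := tI; have [d1 dj] := HD w t tq.
have M2 (x y : R) : `|x| <= C * heat 1 w tau -> `|y| <= D -> `|x * y| <= C * D * heat 1 w tau.
  by move=> hx hy; rewrite normrM mulrAC ler_pM.
have half (x : R) : `|x| <= 2 * (C * D * heat 1 w tau) -> `|2^-1 * x| <= C * D * heat 1 w tau.
  by rewrite normrM gtr0_norm ?invr_gt0//; lra.
have sum2 (x y : R) : `|x| <= C * D * heat 1 w tau -> `|y| <= C * D * heat 1 w tau ->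
    `|x + y| <= 2 * (C * D * heat 1 w tau).
  by move=> hx hy; apply: (le_trans (ler_normD _ _)); rewrite mulr_natl mulr2n lerD.
have dif2 (x y : R) : `|x| <= C * D * heat 1 w tau -> `|y| <= C * D * heat 1 w tau ->
    `|x - y| <= 2 * (C * D * heat 1 w tau).
  by move=> hx hy; apply: sum2; rewrite ?normrN.
split.
- by apply: M2 => //; exact: HC.
- by apply/half/sum2; apply: M2 => //; [exact: HC|exact: HC|exact: dj].
- by apply/half/sum2; apply: M2 => //; [exact: HC|exact: HC|exact: dj].
- apply/half/sum2; apply: half.
    by apply/sum2; apply: M2 => //; [exact: HC|exact: HC|exact: dj].
  by apply/dif2; apply: M2 => //; [exact: HC|exact: dj|exact: HC|exact: dj].
- rewrite -mulrA; apply: dif2; apply: M2 => //; [exact: HC|exact: HC|exact: dj].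
Qed.

Let heat1_bounded : exists2 B, 0 <= B & forall w, heat 1 w tau <= B.
Proof.
have [B B0 HB] := heat_bounded 1 tau0; exists B => // w.
by apply: (le_trans (ler_norm _)); exact: HB.
Qed.

Lemma crossing_dominated : exists2 K, 0 <= K & forall t, p <= t <= q ->
  gauss_dominated tau (crossing_density ^~ t) K.
Proof.
have [K K0 HK] := density_bounds; exists K => // t /[dup] tI /andP[pt tq].
split; last by move=> w; have [] := HK w t tI.
by move=> w; apply: continuous_density; exact: le_lt_trans qT.
Qed.

(** The increment is split into that in c at time t', the change of the slope
    in c between t and t', and the increment in t at c. In the last one the
    remainder is estimated under the integral. *)
Lemma crossing_taylor : exists2 M, 0 <= M & forall c c' t t',
  (forall y, `|y - t| <= `|t' - t| -> p <= y <= q) ->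
  `|crossing c' t' - crossing c t - (c' - c) * crossing_density c t
    - (t' - t) * crossing_flux c t| <= M * (`|c' - c| + `|t' - t|) ^+ 2.
Proof.
have [K K0 HK] := density_bounds; have [B B0 HB] := heat1_bounded.
exists (2 * (K * B) + K * B + K); first by rewrite !addr_ge0 ?mulr_ge0.
move=> c c' t t' tt; have tI : p <= t <= q by apply: tt; rewrite subrr normr0.
have tI' : p <= t' <= q by exact: tt.
have lT y : p <= y <= q -> y < T by move=> /andP[_ /le_lt_trans]; exact.
have l0 y : p <= y <= q -> 0 < y < T.
  by move=> yI; rewrite lT// andbT; apply: (lt_le_trans p0); case/andP: yI.
have KB w : K * heat 1 w tau <= K * B by rewrite ler_wpM2l.
have gd y : p <= y <= q -> gauss_dominated tau (crossing_density ^~ y) K.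
  move=> yI; split; last by move=> w; have [] := HK w y yI.
  by move=> w; apply: continuous_density; exact: lT.
have gt : gauss_dominated tau (density_time ^~ t) K.
  split; last by move=> w; have [] := HK w t tI.
  by move=> w; apply: continuous_time; exact: lT.
(* the increment in c at time t' *)
have b1 : `|crossing c' t' - crossing c t' - (c' - c) * crossing_density c t'| <=
    2 * (K * B) * (c' - c) ^+ 2.
  have := @taylor1_bound R (crossing ^~ t') (crossing_density ^~ t') (density_space ^~ t')
     c (c' - c) (2 * (K * B)).
  rewrite (addrC c) subrK; apply.
  + by move=> y _; exact: (is_derive_gauss_primitive tau0 y (gd _ tI')).
  + by move=> y _; apply: is_derive_density_space; exact: lT.
  + move=> y _; have [_ _ _ _ h] := HK y t' tI'; apply: (le_trans h).
    by rewrite -mulrA ler_pM2l.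
have b2 : `|crossing_density c t' - crossing_density c t| <= K * B * `|t' - t|.
  have := @lipschitz_bound R (crossing_density c) (density_time c) t (t' - t) (K * B).
  rewrite (addrC t) subrK; apply => y yt; have yI := tt y yt.
  + by apply: is_derive_density_time; exact: l0.
  + by have [_ _ h _ _] := HK c y yI; apply: (le_trans h).
have mI : measurable ([set` `]-oo, c]] : set (measurableTypeR R)) by exact: measurable_itv.
have i1 := gauss_dominated_integrable tau0 mI (gd _ tI').
have i2 := gauss_dominated_integrable tau0 mI (gd _ tI).
have i3 := gauss_dominated_integrable tau0 mI gt.
pose rem w := crossing_density w t' - crossing_density w t - (t' - t) * density_time w t.
have gr : gauss_dominated tau rem (K * (t' - t) ^+ 2).
  split.
    move=> w; have k1 := (gd _ tI').1 w; have k2 := (gd _ tI).1 w.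
    have k3 : {for w, continuous (fun w => (t' - t) * density_time w t)}.
      by apply: cvgM; [exact: cvg_cst|exact: (gt.1 w)].
    exact: (cvgB (cvgB k1 k2) k3).
  move=> w.
  have := @taylor1_bound R (crossing_density w) (density_time w) (density_time2 w)
     t (t' - t) (K * heat 1 w tau).
  rewrite (addrC t) subrK mulrAC; apply => y yt; have yI := tt y yt.
  + by apply: is_derive_density_time; exact: l0.
  + by apply: is_derive_density_time2; exact: l0.
  + by have [_ _ _ h _] := HK w y yI.
have b3 : `|crossing c t' - crossing c t - (t' - t) * crossing_flux c t| <= K * (t' - t) ^+ 2.
  have fE : crossing_flux c t = \int[leb]_(w in `]-oo, c]) density_time w t.
    symmetry; apply: (gauss_primitive_eq tau0 (G := crossing_flux ^~ t) (D := K) c gt).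
      by move=> y; apply: is_derive_flux; exact: lT.
    by move=> y; have [] := HK y t tI.
  have := gauss_dominated_primitive_bound tau0 c gr.
  have i12 : leb.-integrable `]-oo, c]
      (EFin \o (fun w => crossing_density w t' - crossing_density w t)).
    by have := integrableB mI i1 i2; apply: eq_integrable.
  have i4 : leb.-integrable `]-oo, c] (EFin \o (fun w => (t' - t) * density_time w t)).
    by have := integrableZl mI (t' - t) i3; apply: eq_integrable.
  rewrite /rem (RintegralB mI i12 i4) (RintegralB mI i1 i2) (RintegralZl _ mI i3) -fE => /le_trans; apply.
  by apply: ler_piMr; [rewrite mulr_ge0// sqr_ge0|rewrite heat0 normal_cdf_le1].
have split (x y z u v k l e : R) : x - z - e * u - l * k =
  (x - y - e * v) + e * (v - u) + (y - z - l * k) by ring.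
rewrite (split _ (crossing c t') _ _ (crossing_density c t')).
have e1 : (c' - c) ^+ 2 = `|c' - c| ^+ 2 by rewrite real_normK// num_real.
have e2 : (t' - t) ^+ 2 = `|t' - t| ^+ 2 by rewrite real_normK// num_real.
apply: (le_trans (ler_normD _ _)).
apply: (@le_trans _ _ (2 * (K * B) * `|c' - c| ^+ 2 + `|c' - c| * (K * B * `|t' - t|) +
    K * `|t' - t| ^+ 2)).
  apply: lerD; last by rewrite -e2.
  apply: (le_trans (ler_normD _ _)); apply: lerD; first by rewrite -e1.
  by rewrite normrM ler_wpM2l.
have x0 : 0 <= `|c' - c| by []. have y0 : 0 <= `|t' - t| by [].
have A0 : 0 <= K * B by rewrite mulr_ge0.
move: (`|c' - c|) (`|t' - t|) (K * B) x0 y0 A0 => x y A x0 y0 A0.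
have xy : 0 <= x * y by rewrite mulr_ge0.
have x2 : 0 <= x ^+ 2 by rewrite sqr_ge0. have y2 : 0 <= y ^+ 2 by rewrite sqr_ge0.
rewrite -subr_ge0 (_ : _ - _ = A * (5 * (x * y) + 3 * y ^+ 2 + x ^+ 2) + K * (x ^+ 2 + 2 * (x * y))); last by ring.
by rewrite addr_ge0// mulr_ge0// ?addr_ge0// mulr_ge0.
Qed.

End time_interval.

(** Crossing the moving level g: the transport term of the chain rule carries
    the derivative of g, the flux is the contribution of the heat equation. *)
Lemma is_derive_crossing (g : R -> R) (dg t : R) : 0 < t < T -> is_derive t 1 g dg ->
  is_derive t 1 (fun t => crossing (g t) t)
    (dg * crossing_density (g t) t + crossing_flux (g t) t).
Proof.
move=> /andP[t0 tT] dgt.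
pose e := Num.min (t / 2) ((T - t) / 2).
have e0 : 0 < e by rewrite lt_min; apply/andP; split; lra.
have et : e <= t / 2 by rewrite ge_min lexx.
have eT : e <= (T - t) / 2 by rewrite ge_min lexx orbT.
have p0 : 0 < t - e by lra. have pq : t - e <= t + e by lra. have qT : t + e < T by lra.
have [M M0 HM] := crossing_taylor p0 pq qT.
have [e1 e10 H1] : exists2 e1, 0 < e1 & forall h, `|h| < e1 ->
    `|g (t + h) - g t| <= (`|dg| + 1) * `|h|.
  have [gd gE] := dgt; have := gd => /cvg_ex[l gl].
  have lE : l = dg by rewrite -gE /derive; apply/esym/cvg_lim.
  rewrite lE in gl; have := gl => /cvgrPdist_lt/(_ 1 ltr01) [e1 /= e10 H].
  exists e1 => // h he; have [->|h0] := eqVneq h 0; first by rewrite addr0 subrr normr0 mulr0.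
  have := H h; rewrite /ball_/= sub0r normrN he h0 => /(_ isT isT).
  rewrite /GRing.scale/= mulr1 (addrC h) => d1.
  have d2 : `|h^-1 * (g (t + h) - g t)| <= `|dg| + 1.
    have -> : h^-1 * (g (t + h) - g t) = dg - (dg - h^-1 * (g (t + h) - g t)) by ring.
    by apply: (le_trans (ler_normB _ _)); rewrite lerD2l ltW.
  by move: d2; rewrite normrM normfV mulrC ler_pdivrMr ?normr_gt0.
(* without its affine part in g s and s, crossing is quadratically small at t *)
pose rem s := crossing (g s) s - ((g s - g t) * crossing_density (g t) t + (s - t) * crossing_flux (g t) t).
have dr : is_derive t 1 rem 0.
  apply: (@is_derive_quad _ _ _ _ (M * (`|dg| + 2) ^+ 2) (Num.min e e1)).
    by rewrite lt_min e0.
  move=> h; rewrite lt_min => /andP[he he1].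
  have remE : rem (t + h) - rem t - h * 0 = crossing (g (t + h)) (t + h) - crossing (g t) t -
      (g (t + h) - g t) * crossing_density (g t) t - (t + h - t) * crossing_flux (g t) t.
    by rewrite /rem; move: (crossing _ _) (crossing _ _) => x y; ring.
  have th : t + h - t = h by rewrite addrC addKr.
  rewrite remE; apply: (le_trans (HM _ _ _ _ _)); rewrite th.
    by move=> y yh; rewrite -ler_distl; apply: (le_trans yh); exact: ltW.
  rewrite -mulrA ler_wpM2l//.
  have -> : h ^+ 2 = `|h| ^+ 2 by rewrite real_normK// num_real.
  rewrite -exprMn; apply: lerXn2r; rewrite ?nnegrE ?addr_ge0 ?mulr_ge0//.
  have -> : `|dg| + 2 = (`|dg| + 1) + 1 by rewrite -addrA.
  by rewrite [leRHS]mulrDl mul1r lerD2r H1.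
have dg1 := is_deriveM' (is_deriveB dgt (is_derive_cst (g t) t 1)) (is_derive_cst (crossing_density (g t) t) t 1).
have dt1 := is_deriveM' (is_deriveB (is_derive_id t 1) (is_derive_cst t t 1)) (is_derive_cst (crossing_flux (g t) t) t 1).
have h := is_deriveD dr (is_deriveD dg1 dt1).
have -> : (fun s => crossing (g s) s) = rem \+ (fun s => (g s - g t) * crossing_density (g t) t +
    (s - t) * crossing_flux (g t) t).
  by apply/funext => s; rewrite /rem /= subrK.
by apply: (is_derive_eq h); rewrite /= !subr0 add0r !mulr0 !addr0 mul1r.
Qed.

End crossing.

Section derivative_limit.
Context {R : realType}.
Local Notation leb := (@lebesgue_measure R).
Implicit Types (s t : R).

(** Derivatives that converge boundedly, not necessarily uniformly, still
    converge to the derivative of the limit when their limit is continuous: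
    dominated convergence applies to the integrated identity. *)
Lemma is_derive_bounded_limit (E dE : nat -> R -> R) (F dF : R -> R) (p q t0 C : R) :
  p < t0 -> t0 < q ->
  (forall n t, p <= t <= q -> is_derive t 1 (E n) (dE n t)) ->
  (forall n t, p <= t <= q -> {for t, continuous (dE n)}) ->
  (forall n t, p <= t <= q -> `|dE n t| <= C) ->
  (forall t, p <= t <= q -> dE n t @[n --> \oo] --> dF t) ->
  (forall t, p <= t <= q -> E n t @[n --> \oo] --> F t) ->
  (forall t, p <= t <= q -> {for t, continuous dF}) ->
  is_derive t0 1 F (dF t0).
Proof.
move=> pt tq dEn cE bE lE lF cF.
have cw (f : R -> R) t : t <= q -> (forall s, p <= s <= q -> {for s, continuous f}) ->
    {within `[p, t], continuous f}.
  move=> tq' cf; apply: continuous_in_subspaceT => s; rewrite inE/= in_itv/= => /andP[ps st].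
  by apply: cf; rewrite ps (le_trans st).
have ftc n t : p < t -> t <= q -> \int[leb]_(s in `[p, t]) dE n s = E n t - E n p.
  move=> pt' tq'; have ct s : p <= s <= q -> {for s, continuous (E n)}.
    by move=> sI; exact: (is_derive_continuous (dEn n s sI)).
  have oo s : s \in `]p, t[ -> p <= s <= q.
    by rewrite in_itv/= => /andP[h1 h2]; rewrite (ltW h1) (le_trans (ltW h2)).
  rewrite /Rintegral (@continuous_FTC2 _ (dE n) (E n))//; first exact: (cw _ _ tq' (cE n)).
  - split.
    + by move=> s /oo sI; case: (dEn n s sI).
    + by apply/cvg_at_right_filter/ct; rewrite lexx (ltW (lt_trans pt tq)).
    + by apply/cvg_at_left_filter/ct; rewrite tq' ltW.
  - by move=> s /oo sI; rewrite derive1E; case: (dEn n s sI).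
have FE t : p < t -> t <= q -> F t = F p + \int[leb]_(s in `[p, t]) dF s.
  move=> pt' tq'; have mI : measurable ([set` `[p, t]] : set (measurableTypeR R)).
    exact: measurable_itv.
  have fI : (leb `[p, t]%classic < +oo)%E by rewrite lebesgue_measure_itv/= lte_fin pt' -EFinB ltry.
  have sub s : `[p, t]%classic s -> p <= s <= q.
    by rewrite /= in_itv/= => /andP[-> /le_trans]; exact.
  have [_ cv] := @bounded_convergence _ _ _ leb `[p, t]%classic dE dF C mI fI
    (fun n => subspace_continuous_measurable_fun mI (cw _ _ tq' (cE n)))
    (fun n s sI => bE n s (sub s sI)) (fun s sI => lE s (sub s sI)).
  have cv2 : E n t - E n p @[n --> \oo] --> F t - F p.
    by apply: cvgB; apply: lF; rewrite ?lexx ?tq' ?(ltW pt') ?(ltW (lt_trans pt tq)).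
  have e : (fun n => \int[leb]_(s in `[p, t]) dE n s) = (fun n => E n t - E n p).
    by apply/funext => n; exact: ftc.
  rewrite e in cv; rewrite -(cvg_unique _ cv2 cv)//; ring.
have iF : leb.-integrable `[p, q] (EFin \o dF).
  by apply: continuous_compact_integrable; [exact: segment_compact|exact: cw].
have t0I : p <= t0 <= q by rewrite !ltW.
have [d1 d2] := continuous_FTC1_closed tq iF pt (cF _ t0I).
have dG : is_derive t0 1 (fun t => F p + \int[leb]_(s in `[p, t]) dF s) (dF t0).
  have := is_deriveD (is_derive_cst (F p) t0 1) (is_derive1 d1).
  by rewrite d2 add0r.
apply: (near_eq_is_derive _ dG); near=> t; rewrite (FE t)//.
  by near: t; exact: lt_nbhsr.
by apply: ltW; near: t; exact: lt_nbhsl.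
Unshelve. all: by end_near. Qed.

End derivative_limit.

Section potential_along_curve.
Context {R : realType}.

(** Point evaluation turns potentials into heat functions, so that the joint
    continuity of heat is a case of that of the potential. *)
Lemma tame_eval (x : R) : tame (fun phi => phi x) x.
Proof.
split=> // e e0; exists 1, 0%N; split => // phi B _ H; rewrite mul1r.
by have := H 0%N x (leqnn _); apply; rewrite gerBl ltW.
Qed.

Lemma continuous_potential_curve (L : (R -> R) -> R) (a : R) (f s : R -> R) (t : R) j :
  tame L a -> {for t, continuous f} -> {for t, continuous s} -> 0 < s t ->
  {for t, continuous (fun t => potential L j (f t) (s t))}.
Proof.
move=> Lt cf cs st0.
exact: (@cvg_comp _ _ _ (fun t => (f t, s t)) (fun z : R * R => potential L j z.1 z.2)
  _ _ _ (cvg_pair cf cs) (@potential_continuous R L a Lt j (f t) (s t) st0)).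
Qed.

Lemma continuous_heat_curve (f s : R -> R) (t : R) j :
  {for t, continuous f} -> {for t, continuous s} -> 0 < s t ->
  {for t, continuous (fun t => heat j (f t) (s t))}.
Proof.
move=> cf cs st0.
have <- : (fun t => potential (fun phi => phi 0) j (f t) (s t)) = (fun t => heat j (f t) (s t)).
  by apply/funext => x; rewrite /potential subr0.
exact: (@continuous_potential_curve _ 0 f s t j (tame_eval 0) cf cs st0).
Qed.

End potential_along_curve.

Section crossing_limit.
Context {R : realType}.
Variables (T : R) (g : R -> R) (L : nat -> (R -> R) -> R) (a : R).
Hypothesis Lt : forall n, tame (L n) a.
Variables (I : set R) (c c1 : R) (h F : R -> R).
Hypotheses (oI : open I) (IT : I `<=` `[0, T]).
Hypothesis dg : forall t, I t -> derivable g t 1.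
Hypothesis cg : {within I, continuous (derive1 g)}.
Hypothesis ch : {within I, continuous h}.
Hypothesis Lc : forall n t, I t -> `|potential (L n) 0 (g t) (T - t)| <= c.
Hypothesis Lc1 : forall n t, I t -> `|potential (L n) 1 (g t) (T - t)| <= c1.
Hypothesis L1 : forall t, I t -> potential (L n) 0 (g t) (T - t) @[n --> \oo] --> (1 : R).
Hypothesis Lh : forall t, I t -> potential (L n) 1 (g t) (T - t) @[n --> \oo] --> h t.
Hypothesis LF : forall t, I t -> crossing T (L n) (g t) t @[n --> \oo] --> F t.

Lemma open_inside t : I t -> 0 < t < T.
Proof.
move=> It; have [e e0 H] := near_ball (open_nbhs_nbhs (conj oI It)).
have h1 : I (t - e / 2) by apply: H; rewrite addrAC subrr add0r normrN gtr0_norm; lra.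
have h2 : I (t + e / 2) by apply: H; rewrite addrAC subrr add0r gtr0_norm; lra.
move: (IT h1) (IT h2); rewrite /= !in_itv/= => /andP[k1 _] /andP[_ k2].
by apply/andP; split; lra.
Qed.

Let density n t := crossing_density T (L n) (g t) t.
Let flux n t := crossing_flux T (L n) (g t) t.

(** As the potentials tend to 1 on the boundary, the transport term and the
    part of the flux that contains 1 - potential 0 vanish in the limit. What
    remains is the part that contains potential 1. *)
Lemma crossing_limit t0 : I t0 -> is_derive t0 1 F (2^-1 * heat 1 (g t0) t0 * h t0).
Proof.
move=> It0; have [e e0 He] := near_ball (open_nbhs_nbhs (conj oI It0)).
pose p := t0 - e / 2; pose q := t0 + e / 2.
have pt : p < t0 by rewrite /p; lra. have tq : t0 < q by rewrite /q; lra.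
have sI t : p <= t <= q -> I t.
  by move=> /andP[pt' tq']; apply: He; rewrite ltr_distl; move: pt' tq'; rewrite /p /q => ? ?; apply/andP; split; lra.
have inI t : p <= t <= q -> 0 < t < T by move=> /sI; exact: open_inside.
have cgI t : I t -> {for t, continuous g}.
  by move=> It; exact: (is_derive_continuous (is_derive1 (dg It))).
have cg1 t : I t -> {for t, continuous (derive1 g)}.
  by move=> It; move: cg; rewrite continuous_open_subspace// => /(_ t); apply; rewrite inE.
have chI t : I t -> {for t, continuous h}.
  by move=> It; move: ch; rewrite continuous_open_subspace// => /(_ t); apply; rewrite inE.
have cid t : {for t, continuous (fun t : R => t)} by exact: cvg_id.
have cT t : {for t, continuous (fun t : R => T - t)} by apply: cvgB; [exact: cvg_cst|exact: cvg_id].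
have chj j t : I t -> {for t, continuous (fun t => heat j (g t) t)}.
  move=> It; have /andP[t0' _] := open_inside It.
  exact: (@continuous_heat_curve R g id t j (cgI t It) (cid t) t0').
have cpj n j t : I t -> {for t, continuous (fun t => potential (L n) j (g t) (T - t))}.
  move=> It; have /andP[_ tT] := open_inside It.
  by apply: (@continuous_potential_curve R (L n) a g (fun t => T - t) t j (Lt n) (cgI t It) (cT t)); rewrite subr_gt0.
have cp1 n t : I t -> {for t, continuous (fun t => 1 - potential (L n) 0 (g t) (T - t))}.
  by move=> It; apply: cvgB; [exact: cvg_cst|exact: cpj].
pose dE n t := derive1 g t * density n t + flux n t.
have pI : p <= p <= q by rewrite lexx (ltW (lt_trans pt tq)).
have /andP[p0 _] := inI p pI.
have [H1 H10 HH1] := heat_bounded 1 p0; have [H2 H20 HH2] := heat_bounded 2 p0.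
have [G G0 HG] : exists2 G, 0 <= G & forall t, p <= t <= q -> `|derive1 g t| <= G.
  have cw : {within `[p, q], continuous (derive1 g)}.
    apply: continuous_in_subspaceT => s; rewrite inE/= in_itv/= => sI'.
    exact/cg1/sI.
  have [M M0 HM] := compact_le_norm (continuous_compact cw (@segment_compact _ p q)).
  exists M; first exact: ltW.
  by move=> t tI; apply: HM; exists t => //=; rewrite in_itv.
have c0 : 0 <= c by apply: le_trans (Lc 0%N It0).
have b1 n t : I t -> `|1 - potential (L n) 0 (g t) (T - t)| <= 1 + c.
  by move=> It; apply: (le_trans (ler_normB _ _)); rewrite normr1 lerD2l Lc.
have dEbound n t : p <= t <= q ->
    `|dE n t| <= G * (H1 * (1 + c)) + 2^-1 * (H2 * (1 + c) + H1 * c1).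
  move=> /[dup] tI /andP[pt' _]; have It := sI t tI.
  apply: (le_trans (ler_normD _ _)); apply: lerD.
    rewrite normrM ler_pM//; first exact: HG.
    by rewrite normrM ler_pM//; [exact: HH1|exact: b1].
  rewrite normrM gtr0_norm ?invr_gt0// ler_wpM2l ?invr_ge0//.
  apply: (le_trans (ler_normD _ _)); apply: lerD; rewrite normrM ler_pM//.
  - exact: HH2.
  - exact: b1.
  - exact: HH1.
  - exact: Lc1.
apply: (@is_derive_bounded_limit R (fun n t => crossing T (L n) (g t) t) dE F
  (fun t => 2^-1 * heat 1 (g t) t * h t) p q t0 _ pt tq _ _ dEbound).
- move=> n t tI; have It := sI t tI.
  by apply: (is_derive_crossing (Lt n) (inI t tI)); apply: is_derive1; exact: dg.
- move=> n t tI; have It := sI t tI.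
  have k1 : {for t, continuous (density n)} by apply: cvgM; [exact: chj|exact: cp1].
  have k2 : {for t, continuous (fun t => heat 2 (g t) t * (1 - potential (L n) 0 (g t) (T - t)))}.
    by apply: cvgM; [exact: chj|exact: cp1].
  have k3 : {for t, continuous (fun t => heat 1 (g t) t * potential (L n) 1 (g t) (T - t))}.
    by apply: cvgM; [exact: chj|exact: cpj].
  have k4 : {for t, continuous (flux n)} by apply: cvgMl_tmp; exact: cvgD.
  by apply: cvgD => //; apply: cvgM => //; exact: cg1.
- move=> t tI; have It := sI t tI.
  have l1 : 1 - potential (L n) 0 (g t) (T - t) @[n --> \oo] --> (0 : R).
    by rewrite -[X in _ --> X](subrr 1); apply: cvgB; [exact: cvg_cst|exact: L1].
  have l2 : density n t @[n --> \oo] --> heat 1 (g t) t * 0 by apply: cvgMl_tmp.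
  have l3 : flux n t @[n --> \oo] --> 2^-1 * (heat 2 (g t) t * 0 + heat 1 (g t) t * h t).
    by apply: cvgMl_tmp; apply: cvgD; apply: cvgMl_tmp => //; exact: Lh.
  have l4 : derive1 g t * density n t @[n --> \oo] --> derive1 g t * (heat 1 (g t) t * 0).
    by apply: cvgMl_tmp.
  have l5 : dE n t @[n --> \oo] --> derive1 g t * (heat 1 (g t) t * 0) +
      2^-1 * (heat 2 (g t) t * 0 + heat 1 (g t) t * h t) by apply: cvgD.
  by move: l5; rewrite !mulr0 !add0r mulrA.
- by move=> t /sI; exact: LF.
- move=> t tI; have It := sI t tI.
  by apply: cvgM; [apply: cvgMl_tmp; exact: chj|exact: chI].
Qed.

End crossing_limit.

(** * From distributions to potentials *)

Section crossing_identity.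
Context {R : realType}.
Local Notation leb := (@lebesgue_measure R).

Lemma crossing_eq (T : R) (L : (R -> R) -> R) (a c t : R) : tame L a -> 0 < t < T ->
  crossing T L c t =
  heat 0 c t - \int[leb]_(w in `]-oo, c]) (potential L 0 w (T - t) * heat 1 w t).
Proof.
move=> Lt /andP[t0 tT]; have [K K0 HK] := crossing_dominated Lt t0 (lexx t) tT.
have tI : t <= t <= t by rewrite lexx.
have t20 : 0 < 2 * t by rewrite mulr_gt0.
have mI : measurable ([set` `]-oo, c]] : set (measurableTypeR R)) by exact: measurable_itv.
have i1 := integrable_heat1 t0 mI.
have i2 := gauss_dominated_integrable t20 mI (HK t tI).
rewrite -(Rintegral_heat1 t0 c).
have -> : \int[leb]_(w in `]-oo, c]) (potential L 0 w (T - t) * heat 1 w t) =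
    \int[leb]_(w in `]-oo, c]) (heat 1 w t - crossing_density T L w t).
  by apply: eq_Rintegral => w _; rewrite /crossing_density; ring.
by rewrite (RintegralB mI i1 i2) subKr.
Qed.

End crossing_identity.

Section distribution_potential.
Context {R : realType}.
Variables (T : R) (mu : (R -> R) -> R) (a : R).
Hypotheses (hmu : is_distribution mu) (cmu : compact (distribution_support mu)).
Hypothesis smu : distribution_support mu `<=` `[a, +oo[.

Lemma U_potential w t : 0 <= t < T -> U T mu w t = potential (pairing mu) 0 w (T - t).
Proof.
by move=> tT; rewrite /U tT /potential; congr (pairing mu _); apply/funext => v; rewrite heat0.
Qed.

Lemma U_derive_potential w t : 0 <= t < T ->
  U T (distribution_derive mu) w t = potential (pairing mu) 1 w (T - t).
Proof.
move=> tT; have Lt := tame_pairing hmu cmu smu.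
have [s0 d0] := @smooth_heat_reflect R 0 w (T - t).
have [s1 _] := @smooth_heat_reflect R 1 w (T - t).
rewrite /U tT (_ : (fun v => _) = (fun v => heat 0 (w - v) (T - t))); last first.
  by apply/funext => v; rewrite heat0.
rewrite pairing_distribution_derive//.
have -> : derive1 (fun v => heat 0 (w - v) (T - t)) = (fun v => - 1 * heat 1 (w - v) (T - t)).
  by have := d0 1%N; rewrite derive1n1 expr1.
by rewrite (tameZ Lt (-1) s1) mulN1r opprK.
Qed.

End distribution_potential.

Theorem theorem3p1 (R : realType) (d : measure_display)
  (Omega : measurableType d) (P : probability Omega R)
  (W : R -> {RV P >-> R}) (hW : standard_brownian_motion W)
  (T : R) (hT : 0 < T)
  (g : R -> R) (hg : {within `[0, T], continuous g})
  (mu : nat -> (R -> R) -> R)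
  (hmu : forall n, is_distribution (mu n))
  (hcompact : forall n, compact (distribution_support (mu n)))
  (hsupp : forall n, distribution_support (mu n) `<=` `[g T, +oo[)
  (hU1 : forall t, 0 <= t < T -> U T (mu n) (g t) t @[n --> \oo] --> (1 : R))
  (hUc : exists c : R, forall n t w, 0 <= t < T -> w <= g t ->
     `|U T (mu n) w t| <= c) :
  (forall t, 0 < t < T ->
     exists2 l : R,
       pairing (mu n) (fun v => bivariate_normal_cdf (g t / Num.sqrt t)
         (- v / Num.sqrt T) (- Num.sqrt (t / T))) @[n --> \oo] --> l &
       P [set w | last_passage W g T w <= t] =
       (normal_cdf (g t / Num.sqrt t) - l)%:E) /\
  P [set w | last_passage W g T w < T] =
    (normal_cdf (g T / Num.sqrt T))%:E /\
  (forall (I : set R) (h : R -> R), open I -> I `<=` `[0, T] ->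
     (forall t, I t -> derivable g t 1) -> {within I, continuous derive1 g} ->
     (exists c : R, forall n t, I t ->
        `|U T (distribution_derive (mu n)) (g t) t| <= c) ->
     {within I, continuous h} ->
     (forall t, I t ->
        U T (distribution_derive (mu n)) (g t) t @[n --> \oo] --> h t) ->
     forall t, I t ->
       is_derive t 1 (fun s => fine (P [set w | last_passage W g T w <= s]))
         ((2 * Num.sqrt t)^-1 * derive1 normal_cdf (g t / Num.sqrt t) * h t)).
Proof.
pose L n := pairing (mu n).
have Lt n : tame (L n) (g T) := tame_pairing (hmu n) (hcompact n) (@hsupp n).
have [c Hc] := hUc.
have Lc n r x : 0 <= r < T -> x <= g r -> `|potential (L n) 0 x (T - r)| <= c.
  by move=> rT xg; rewrite -U_potential//; exact: Hc.
have L1 r : 0 <= r < T -> potential (L n) 0 (g r) (T - r) @[n --> \oo] --> (1 : R).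
  move=> rT; rewrite (_ : (fun n => _) = (fun n => U T (mu n) (g r) r)); first exact: hU1.
  by apply/funext => n; rewrite U_potential.
pose F t := fine (P [set w | last_passage W g T w <= t]).
have mb t : 0 < t < T -> measurable (below W g t T).
  by move=> /andP[t0 tT]; apply: (measurable_below hW hg) => //; exact: ltW.
have FE t : 0 < t < T -> P [set w | last_passage W g T w <= t] = (F t)%:E.
  move=> tI; rewrite /F (last_passage_le_law hW hg tI) fineK//.
  by apply: fin_num_measure; exact: mb.
have cvgF t : 0 < t < T ->
    \int[P]_(w in below W g t t) potential (L n) 0 (W t w) (T - t) @[n --> \oo] -->
    heat 0 (g t) t - F t.
  move=> /[dup] tI /andP[t0 tT].
  have tr r : t <= r < T -> 0 <= r < T by move=> /andP[/(le_trans (ltW t0)) -> ->].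
  have := potential_integral_cvg hW hg (ltW t0) tT Lt
    (fun n r x rI => @Lc n r x (tr r rI)) (fun r rI => L1 r (tr r rI)).
  by rewrite (below_point_law hW g t0) /F (last_passage_le_law hW hg tI).
split; [|split].
- move=> t /[dup] tI /andP[t0 tT]; exists (heat 0 (g t) t - F t).
    have := cvgF t tI; rewrite (_ : (fun n => _) = (fun n => pairing (mu n) (fun v =>
      bivariate_normal_cdf (g t / Num.sqrt t) (- v / Num.sqrt T) (- Num.sqrt (t / T)))))//.
    by apply/funext => n; rewrite (potential_integral_pairing hW hg (Lt n) tI).
  by rewrite FE// -heat0 subKr.
- by rewrite (last_passage_lt_law hW hT hg) heat0.
move=> I h oI IT dg cg [c1 Hc1] ch Uh t It.
have inI s : I s -> 0 < s < T := @open_inside R T I oI IT s.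
have inI0 s : I s -> 0 <= s < T by move=> /inI/andP[/ltW -> ->].
have Lc1 n s : I s -> `|potential (L n) 1 (g s) (T - s)| <= c1.
  by move=> Is; rewrite -(U_derive_potential (hmu n) (hcompact n) (@hsupp n) _ (inI0 s Is)) Hc1.
have Lh s : I s -> potential (L n) 1 (g s) (T - s) @[n --> \oo] --> h s.
  move=> Is; rewrite (_ : (fun n => _) = (fun n => U T (distribution_derive (mu n)) (g s) s)).
    exact: Uh.
  by apply/funext => n; rewrite (U_derive_potential (hmu n) (hcompact n) (@hsupp n) _ (inI0 s Is)).
have LF s : I s -> crossing T (L n) (g s) s @[n --> \oo] --> F s.
  move=> /inI sI; rewrite -[X in _ --> X](subKr (heat 0 (g s) s)).
  rewrite (_ : (fun n => _) = (fun n => heat 0 (g s) s -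
    \int[P]_(w in below W g s s) potential (L n) 0 (W s w) (T - s))).
    by apply: cvgB; [exact: cvg_cst|exact: cvgF].
  apply/funext => n.
  by rewrite (crossing_eq _ (Lt n) sI) (potential_integral hW g (Lt n) sI).
have := @crossing_limit R T g L (g T) Lt I c c1 h F oI IT dg cg ch
  (fun n s Is => Lc n s (g s) (inI0 s Is) (lexx _)) Lc1 (fun s Is => L1 s (inI0 s Is)) Lh LF t It.
move=> H; apply: (is_derive_eq H).
by rewrite (derive1_eq (@is_derive_normal_cdf R)) heat1 invfM !mulrA.
Qed.
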